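(* Let $\sigma\in C([0,\infty);\mathbb{R}^{d\times r})$ and let $A\in C([0,\infty);\mathbb{R}^{d\times d})$ be $T$-periodic for some $T>0$. Let $\Psi$ be the unique continuous $\mathbb{R}^{d\times d}$-valued solution of \[ \Psi'(t)=A(t)\Psi(t),\quad t\ge 0;\quad \Psi(0)=I_d, \] and suppose that $\rho(\Psi(T))<1$. For $\xi\in\mathbb{R}^d$ let $X(\cdot,\xi)$ be the unique continuous adapted solution of \[ dX(t)=A(t)X(t)\,dt+\sigma(t)\,dB(t),\quad t\ge 0;\quad X(0)=\xi. \] Let $h>0$ and for $\epsilon>0$ define \[ S_h'(\epsilon)=\sum_{n=1}^\infty \sqrt{\int_{nh}^{(n+1)h}\|\sigma(s)\|_F^2\,ds}\cdot\exp\left(-\frac{\epsilon^2}{2\int_{nh}^{(n+1)h}\|\sigma(s)\|_F^2\,ds}\right). \] Suppose further that \[ \lim_{n\to\infty}\int_{nh}^{(n+1)h}\|\sigma(s)\|_F^2\,ds=0. \] (A) If $S_h'(\epsilon)<+\infty$ for all $\epsilon>0$, then $\lim_{t\to\infty}X(t,\xi)=0$ a.s. for each $\xi\in\mathbb{R}^d$. (B) If there exists $\epsilon'>0$ such that $S_h'(\epsilon)<+\infty$ for all $\epsilon>\epsilon'$ and $S_h'(\epsilon)=+\infty$ for all $0<\epsilon<\epsilon'$, then there exist deterministic $0<c_1\le c_2<\infty$, independent of $\xi$, such that for each $\xi\in\mathbb{R}^d$ \[ c_1\le\limsup_{t\to\infty}\|X(t,\xi)\|\le c_2,\quad\text{a.s.}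 \] Moreover, for each $\xi\in\mathbb{R}^d$, \[ \liminf_{t\to\infty}\|X(t,\xi)\|=0,\quad \lim_{t\to\infty}\frac1t\int_0^t\|X(s,\xi)\|^2\,ds=0,\quad\text{a.s.} \] (C) If $S_h'(\epsilon)=+\infty$ for all $\epsilon>0$, then $\limsup_{t\to\infty}\|X(t,\xi)\|=+\infty$ a.s. for each $\xi\in\mathbb{R}^d$. Moreover, for each $\xi\in\mathbb{R}^d$, \[ \liminf_{t\to\infty}\|X(t,\xi)\|=0,\quad \lim_{t\to\infty}\frac1t\int_0^t\|X(s,\xi)\|^2\,ds=0,\quad\text{a.s.} \]
   Context: $d,r$ are positive integers, $B$ is an $r$-dimensional standard Brownian motion, $\sigma$ and $A$ are deterministic, $\|\cdot\|$ is the Euclidean norm on $\mathbb{R}^d$, $\|\cdot\|_F$ is the Frobenius norm on $\mathbb{R}^{d\times r}$, $\rho(C)$ denotes the spectral radius of a square matrix $C$, and $I_d$ is the $d\times d$ identity matrix. A term of $S_h'(\epsilon)$ for which $\int_{nh}^{(n+1)h}\|\sigma(s)\|_F^2\,ds=0$ is interpreted as $0$. *)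

(* Defs.v *)
From HB Require Import structures.
From mathcomp Require Import all_boot all_order all_algebra.
From mathcomp Require Import complex.
From mathcomp Require Import all_classical all_reals all_analysis.

Set Implicit Arguments.
Unset Strict Implicit.
Unset Printing Implicit Defensive.

Import Order.TTheory GRing.Theory Num.Theory.
Import numFieldNormedType.Exports.

Local Open Scope classical_set_scope.
Local Open Scope ring_scope.

(* Functions of time have domain R; only their values on [0, +oo[ are ever
   constrained or used. *)

Definition halfline {R : realType} : set R := `[0, +oo[.

(* The canonical norm of 'M[R]_(m, n) in the library is the sup norm.  For
   n = 1 this is the Euclidean norm of a column vector. *)
Definition frobenius {R : realType} {m n : nat} (M : 'M[R]_(m, n)) : R :=
  Num.sqrt (\sum_(i < m) \sum_(j < n) M i j ^+ 2).

Definition spectral_radius {R : realType} {n : nat} (C : 'M[R]_n) : R :=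
  sup [set complex.Re `|l| | l in
        [set l : R[i] | eigenvalue (map_mx (real_complex R) C) l]].

Section LinearODE.
Context {R : realType} {d : nat}.

(* Psi' = A Psi on [0, +oo[ with Psi 0 = I; the derivative is taken relative to
   [0, +oo[, hence one-sided at 0. *)
Definition fundamental_solution (A Psi : R -> 'M[R]_d) : Prop :=
  [/\ {within halfline, continuous Psi},
      Psi 0 = 1%:M
    & forall t, 0 <= t ->
        (s - t)^-1 *: (Psi s - Psi t) @[s --> within halfline t^']
          --> A t *m Psi t].

End LinearODE.

Section StochasticIntegral.
Context {R : realType} {dis : measure_display} {Omega : measurableType dis}.
Variable P : probability Omega R.

Definition filtration (F : R -> set (set Omega)) : Prop :=
  [/\ forall t, 0 <= t -> sigma_algebra setT (F t),
      forall t, 0 <= t -> F t `<=` measurable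
    & forall s t, 0 <= s -> s <= t -> F s `<=` F t].

Definition adapted {n : nat} (F : R -> set (set Omega))
    (X : R -> Omega -> 'cV[R]_n) : Prop :=
  forall t, 0 <= t -> forall (i : 'I_n) (U : set R), measurable U ->
    F t [set w | U (X t w i ord0)].

Definition ae_continuous {n : nat} (X : R -> Omega -> 'cV[R]_n) : Prop :=
  {ae P, forall w, {within halfline, continuous (fun t => X t w)}}.

(* The last clause says at once that B t - B s is independent of F s and that
   its law is the product of the centred normal laws of variance t - s
   ([normal_prob] takes the standard deviation). *)
Definition brownian_motion {r : nat} (F : R -> set (set Omega))
    (B : R -> Omega -> 'cV[R]_r) : Prop :=
  [/\ adapted F B,
      {ae P, forall w, B 0 w = 0},
      ae_continuous B
    & forall s t, 0 <= s -> s < t ->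
      forall (E : set Omega) (U : 'I_r -> set R),
        F s E -> (forall j, measurable (U j)) ->
        P (E `&` [set w | forall j, U j (B t w j ord0 - B s w j ord0)]) =
        (P E * \prod_(j < r) normal_prob 0 (Num.sqrt (t - s)) (U j))%E].

Definition subdivision (t : R) (n : nat) (p : nat -> R) : Prop :=
  [/\ p 0%N = 0, p n = t & forall k, (k < n)%N -> p k <= p k.+1].

(* The step function equal to c k on ]p k, p (k+1)]. *)
Definition step_fun {m n : nat} (k : nat) (p : nat -> R)
    (c : nat -> 'M[R]_(m, n)) (s : R) : 'M[R]_(m, n) :=
  \sum_(i < k) \1_(`]p i, p i.+1]%classic : set R) s *: c i.

Definition step_integral {m n : nat} (B : R -> Omega -> 'cV[R]_n) (k : nat)
    (p : nat -> R) (c : nat -> 'M[R]_(m, n)) (w : Omega) : 'cV[R]_m :=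
  \sum_(i < k) c i *m (B (p i.+1) w - B (p i) w).

(* I is (a version of) the integral over [0, t] of the deterministic function f
   against dB: the L^2(P)-limit of the elementary integrals of step functions
   that converge to f in L^2([0, t]). *)
Definition is_wiener_integral {m n : nat} (B : R -> Omega -> 'cV[R]_n) (t : R)
    (f : R -> 'M[R]_(m, n)) (I : Omega -> 'cV[R]_m) : Prop :=
  (forall i, measurable_fun setT (fun w => I w i ord0)) /\
  exists (k : nat -> nat) (p : nat -> nat -> R) (c : nat -> nat -> 'M[R]_(m, n)),
    [/\ forall N, subdivision t (k N) (p N),
        (\int[lebesgue_measure]_(s in `[0%R, t])
           (frobenius (step_fun (k N) (p N) (c N) s - f s) ^+ 2)%:E)%E
          @[N --> \oo] --> 0%E
      & (\int[P]_w
           (frobenius (step_integral B (k N) (p N) (c N) w - I w) ^+ 2)%:E)%E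
          @[N --> \oo] --> 0%E].

(* X is a continuous adapted solution of dX = A X dt + sigma dB, X 0 = xi, in
   integral form; M is the process of stochastic integrals. *)
Definition sde_solution {d r : nat} (F : R -> set (set Omega))
    (B : R -> Omega -> 'cV[R]_r) (A : R -> 'M[R]_d) (sigma : R -> 'M[R]_(d, r))
    (xi : 'cV[R]_d) (X : R -> Omega -> 'cV[R]_d) : Prop :=
  [/\ adapted F X,
      ae_continuous X,
      {ae P, forall w, X 0 w = xi}
    & exists M : R -> Omega -> 'cV[R]_d,
        (forall t, 0 <= t -> is_wiener_integral B t sigma (M t)) /\
        {ae P, forall w, forall t, 0 <= t ->
           X t w = xi
             + (\col_i \int[lebesgue_measure]_(s in `[0, t])
                         (A s *m X s w) i ord0)
             + M t w}].

End StochasticIntegral.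

Section Series.
Context {R : realType} {d r : nat}.

Definition block_variance (h : R) (sigma : R -> 'M[R]_(d, r)) (n : nat) : R :=
  \int[lebesgue_measure]_(s in `[n%:R * h, n.+1%:R * h])
    frobenius (sigma s) ^+ 2.

Definition S' (h : R) (sigma : R -> 'M[R]_(d, r)) (eps : R) : \bar R :=
  (\sum_(1 <= n <oo)
    (let v := block_variance h sigma n in
     if v == 0 then 0 else Num.sqrt v * expR (- (eps ^+ 2 / (2 * v))))%R%:E)%E.

End Series.

Section LongTime.
Context {R : realType} {d : nat}.

Definition limsup_norm (x : R -> 'cV[R]_d) : \bar R :=
  limf_esup (fun t => (frobenius (x t))%:E) (nbhs +oo%R).

Definition liminf_norm (x : R -> 'cV[R]_d) : \bar R :=
  limf_einf (fun t => (frobenius (x t))%:E) (nbhs +oo%R).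

Definition time_average_sq (x : R -> 'cV[R]_d) (t : R) : R :=
  t^-1 * \int[lebesgue_measure]_(s in `[0, t]) frobenius (x s) ^+ 2.

End LongTime.

(* Main.v *)
Require Import Defs.
From HB Require Import structures.
From mathcomp Require Import all_boot all_order all_algebra.
From mathcomp Require Import complex.
From mathcomp Require Import ring lra.
From mathcomp Require Import all_classical all_reals all_analysis.
From mathcomp Require Import measurable_realfun.

Set Implicit Arguments.
Unset Strict Implicit.
Unset Printing Implicit Defensive.

Import Order.TTheory GRing.Theory Num.Theory.
Import numFieldNormedType.Exports.

Local Open Scope classical_set_scope.
Local Open Scope ring_scope.

(** The proof separates a deterministic estimate from a probabilistic one; they
    meet at the oscillation [z k] of the process [M t] of stochastic integrals,
    [int_0^t sigma dB], over the block from [k h] to [(k + 1) h].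

    Deterministic part.  A continuous path with [x t = xi + int_0^t A x + m t] is
    compared, over one period, with the homogeneous solution that starts at the
    same point: by Gronwall's inequality they differ by at most a multiple of the
    oscillation of [m] over the period ([period_step]).  Since the spectral radius
    of [Psi T] is less than one, [Psi T] contracts a norm equivalent to the given
    one ([contracting_norm]), so [x] sampled at multiples of the period obeys a
    scalar recursion [u (k + 1) <= q * u k + K * osc k] with [q < 1].  Hence [x] is
    eventually bounded by a multiple of any eventual bound of [z]
    ([path_bounded]), and if the sums of [z k ^ 2] over [k < N] are [o (N)] then the
    mean of [|x| ^ 2] over time vanishes, so that [x] comes arbitrarily close to
    zero ([path_average], [path_liminf]).  Conversely the equation itself bounds the
    block increments of [m] by a multiple of an eventual bound of [x]
    ([path_lower]).  Constants are immaterial here: in (A) and (C) the series is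
    known at every [eps], and in (B) only some bounds [c1] and [c2] are asked for.

    Probabilistic part.  Given the past, the increment of [M] over block [k] is
    centred normal with a variance comparable to the variance [v k] of the block.
    Ottaviani's inequality ([ottaviani]) extends its upper tail to the oscillation,
    so that, up to the scale of [eps], [sqrt (v k) * exp (- eps ^ 2 / (2 * v k))]
    bounds the conditional probability that [z k] exceeds [eps] from above, and
    that the increment does from below, as [v k] tends to zero.  A convergent
    series thus makes [z] eventually small ([series_finite_exceed], by
    Borel-Cantelli), a divergent one makes the increments infinitely often large
    ([series_infinite_jump], by the conditional form of the converse).  Whatever
    the series, an exponential Chernoff bound shows that the averages of [z k ^ 2]
    vanish ([exceed_average]), because [v k] does.

    The stochastic integral is only given as an [L ^ 2] limit of integrals of step
    functions.  These are normal conditionally on the past, which is read off from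
    their exponential moments ([list_mgf]); Chernoff's bound above and the
    Paley-Zygmund inequality below turn the moments into tails, with constants that
    leave room for the passage to the limit ([wiener_upper_tail],
    [wiener_lower_tail]).  Conditioning requires measurability for a filtration
    that need not contain the null sets, whence an adapted version of the integral
    ([adapted_version]), compared with the paths at dyadic times only. *)

(** * Comparison of weighted laws *)

Section compare.
Local Open Scope ereal_scope.
Context {R : realType}.
Context d (T : measurableType d) d1 (T1 : measurableType d1)
  d2 (T2 : measurableType d2).
Variables (mu1 : {measure set T1 -> \bar R}) (mu2 : {measure set T2 -> \bar R}).
Variables (Z1 : T1 -> T) (Z2 : T2 -> T) (g1 : T1 -> R) (g2 : T2 -> R).
Hypothesis mZ1 : measurable_fun setT Z1.
Hypothesis mZ2 : measurable_fun setT Z2.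
Hypothesis mg1 : measurable_fun setT g1.
Hypothesis mg2 : measurable_fun setT g2.
Hypothesis g10 : (forall x, 0 <= g1 x)%R.
Hypothesis g20 : (forall x, 0 <= g2 x)%R.

Import HBNNSimple.

Lemma integral_weight_fimfun d0 (T0 : measurableType d0)
    (mu0 : {measure set T0 -> \bar R}) (Z : T0 -> T) (g : T0 -> R)
    (f : {nnsfun T >-> R}) :
  measurable_fun setT Z -> measurable_fun setT g -> (forall x, 0 <= g x)%R ->
  \int[mu0]_x ((g x)%:E * (f (Z x))%:E) =
  \sum_(y \in range f) (y%:E *
     \int[mu0]_x ((g x)%:E * (\1_(f @^-1` [set y]) (Z x))%:E)).
Proof.
move=> mZ mg g0.
have f0 x : (0 <= f x)%R by [].
have mi y : measurable_fun setT
    (fun x => (g x)%:E * (\1_(f @^-1` [set y]) (Z x))%:E).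
  apply: emeasurable_funM => //; apply/measurable_EFinP => //.
  by apply: (measurableT_comp (measurable_indic _)).
transitivity (\int[mu0]_x (\sum_(y \in range f)
    (`|y|%:E * ((g x)%:E * (\1_(f @^-1` [set y]) (Z x))%:E)))).
  apply: eq_integral => x _.
  rewrite fimfunE -fsumEFin// ge0_mule_fsumr; last first.
    move=> y; rewrite lee_fin indicE; case: (boolP (_ \in _)) => [|_].
      by rewrite inE => <-; rewrite mulr1.
    by rewrite mulr0.
  apply: eq_fsbigr => y; rewrite inE => -[u _ <-].
  by rewrite ger0_norm// EFinM muleCA.
rewrite ge0_integral_fsum//.
- apply: eq_fsbigr => y; rewrite inE => -[u _ <-].
  rewrite ge0_integralZl_EFin ?ger0_norm//.
  by move=> x _; rewrite mule_ge0// lee_fin.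
- by move=> y; apply: measurable_funeM.
- by move=> y x _; rewrite !mule_ge0// lee_fin.
Qed.

(** Two weighted laws on [T] are compared on indicators; simple functions and
    monotone convergence extend the comparison to all nonnegative functions. *)
Lemma le_integral_weight (f : T -> \bar R) :
  (forall V, measurable V ->
    \int[mu1]_x ((g1 x)%:E * (\1_V (Z1 x))%:E) <=
    \int[mu2]_x ((g2 x)%:E * (\1_V (Z2 x))%:E)) ->
  measurable_fun setT f -> (forall x, 0 <= f x) ->
  \int[mu1]_x ((g1 x)%:E * f (Z1 x)) <= \int[mu2]_x ((g2 x)%:E * f (Z2 x)).
Proof.
move=> H mf f0.
pose a := nnsfun_approx measurableT mf.
have lim0 d0 (T0 : measurableType d0)
    (mu0 : {measure set T0 -> \bar R}) (Z : T0 -> T) (g : T0 -> R) :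
  measurable_fun setT Z -> measurable_fun setT g -> (forall x, 0 <= g x)%R ->
  \int[mu0]_x ((g x)%:E * (a n (Z x))%:E) @[n --> \oo] -->
  \int[mu0]_x ((g x)%:E * f (Z x)).
  move=> mZ mg g0.
  have -> : \int[mu0]_x ((g x)%:E * f (Z x)) =
      \int[mu0]_x limn (fun n => (g x)%:E * (a n (Z x))%:E).
    apply: eq_integral => x _; apply/esym/cvg_lim => //.
    by apply: cvgeZl => //; exact: cvg_nnsfun_approx.
  apply: cvg_monotone_convergence => //.
  - move=> n; apply: emeasurable_funM => //; apply/measurable_EFinP => //.
    exact: measurableT_comp.
  - by move=> n x _; rewrite mule_ge0// lee_fin.
  - move=> x _ m n mn; rewrite lee_wpmul2l// ?lee_fin//.
    by have /lefP/(_ (Z x)) := nd_nnsfun_approx measurableT mf mn.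
have L1 := lim0 _ _ mu1 _ _ mZ1 mg1 g10.
have L2 := lim0 _ _ mu2 _ _ mZ2 mg2 g20.
apply: (lee_cvg_to L1 L2).
apply: nearW => n; rewrite !integral_weight_fimfun//.
apply: lee_fsum => // y [u _ <-].
rewrite lee_wpmul2l ?lee_fin//; exact: H.
Qed.
End compare.

(** * Exponential moments of Brownian increments *)

Section eq_weight.
Local Open Scope ereal_scope.
Context {R : realType}.
Context d (T : measurableType d) d1 (T1 : measurableType d1)
  d2 (T2 : measurableType d2).
Lemma eq_integral_weight
  (mu1 : {measure set T1 -> \bar R}) (mu2 : {measure set T2 -> \bar R})
  (Z1 : T1 -> T) (Z2 : T2 -> T) (g1 : T1 -> R) (g2 : T2 -> R) (f : T -> \bar R) :
  measurable_fun setT Z1 -> measurable_fun setT Z2 ->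
  measurable_fun setT g1 -> measurable_fun setT g2 ->
  (forall x, 0 <= g1 x)%R -> (forall x, 0 <= g2 x)%R ->
  (forall V, measurable V ->
    \int[mu1]_x ((g1 x)%:E * (\1_V (Z1 x))%:E) =
    \int[mu2]_x ((g2 x)%:E * (\1_V (Z2 x))%:E)) ->
  measurable_fun setT f -> (forall x, 0 <= f x) ->
  \int[mu1]_x ((g1 x)%:E * f (Z1 x)) = \int[mu2]_x ((g2 x)%:E * f (Z2 x)).
Proof.
move=> mZ1 mZ2 mg1 mg2 g10 g20 H mf f0; apply/eqP; rewrite eq_le.
by rewrite !le_integral_weight// => V mV; rewrite H.
Qed.
End eq_weight.

Section normal_mgf.
Context {R : realType}.

Lemma measurable_expRM (u : R) :
  measurable_fun [set: R] (fun x => (expR (u * x))%:E).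
Proof.
by apply/measurable_EFinP/measurableT_comp => //; exact: measurable_funM.
Qed.

(** Completing the square turns the tilted density into the density of a
    normal law with shifted mean, whose total mass is one. *)
Lemma normal_mgf (u s : R) : s != 0 ->
  (\int[normal_prob 0 s]_x (expR (u * x))%:E)%E =
  (expR (u ^+ 2 * s ^+ 2 / 2))%:E.
Proof.
move=> s0.
have mf := measurable_expRM u.
transitivity (\int[lebesgue_measure]_x
   ((normal_pdf 0 s x)%:E * (expR (u * x))%:E))%E.
  rewrite -(@eq_integral_weight R _ _ _ _ _ _ (normal_prob 0 s)
    (@lebesgue_measure R) idfun idfun (cst 1) (normal_pdf 0 s)
    (fun x => (expR (u * x))%:E)) //=.
  - by apply: eq_integral => x _; rewrite mul1e.
  - exact: measurable_id.
  - exact: measurable_id.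
  - exact: measurable_normal_pdf.
  - by move=> x; exact: normal_pdf_ge0.
  - move=> V mV; under eq_integral do rewrite mul1e.
    rewrite integral_indic// setIT /normal_prob.
    rewrite [LHS]integral_mkcond; apply: eq_integral => x _.
    by rewrite patchE indicE; case: (_ \in _); rewrite ?mule1 ?mule0.
transitivity (\int[lebesgue_measure]_x
   ((expR (u ^+ 2 * s ^+ 2 / 2))%:E * (normal_pdf (u * s ^+ 2) s x)%:E))%E.
  apply: eq_integral => x _; rewrite -!EFinM; congr EFin.
  rewrite !normal_pdfE// [RHS]mulrCA -[LHS]mulrA; congr (_ * _).
  rewrite /normal_fun -!expRD; congr expR; field.
  by rewrite s0.
rewrite ge0_integralZl_EFin//.
- by rewrite integral_normal_pdf mule1.
- by move=> x _; rewrite lee_fin normal_pdf_ge0.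
- by apply/measurable_EFinP; exact: measurable_normal_pdf.
Qed.
End normal_mgf.

(** Measurability with respect to a sub-sigma-algebra given as a set of sets; the
    filtration is not completed, so this is stronger than measurability of an
    almost surely equal function. *)
Definition measurable_in {dis : measure_display} {Omega : measurableType dis}
    {d : measure_display} {T : measurableType d} (G : set (set Omega))
    (Y : Omega -> T) : Prop :=
  forall U, measurable U -> G (Y @^-1` U).

Lemma measurable_inP {dis : measure_display} {Omega : measurableType dis}
    {d : measure_display} {T : measurableType d} (G : set (set Omega))
    (Y : Omega -> T) : sigma_algebra setT G ->
  measurable_in G Y <->
  measurable_fun [set: g_sigma_algebraType G] (Y : g_sigma_algebraType G -> T).
Proof.
move=> sG; have GE : G.-sigma.-measurable = G := sigma_algebra_id sG.
split=> [h _ U mU|h U mU]; first by rewrite setTI GE; exact: h.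
by rewrite -GE -[_ @^-1` _]setTI; exact: h.
Qed.

Section brownian_mgf.
Context {R : realType} {dis : measure_display} {Omega : measurableType dis}.
Variable P : probability Omega R.
Variables (r : nat) (F : R -> set (set Omega)) (B : R -> Omega -> 'cV[R]_r).
Hypothesis F_filtration : filtration F.
Hypothesis B_brownian : brownian_motion P F B.

Lemma filtration_measurable (t : R) E : 0 <= t -> F t E -> measurable E.
Proof. by case: F_filtration => _ h _ t0; exact: h. Qed.

Lemma measurable_in_fun d (T : measurableType d) (t : R) (Y : Omega -> T) : 0 <= t -> measurable_in (F t) Y ->
  measurable_fun setT Y.
Proof.
by move=> t0 h _ U mU; rewrite setTI; apply: filtration_measurable (h _ mU).
Qed.

Lemma brownian_measurable (t : R) j : 0 <= t ->
  measurable_fun setT (fun w => B t w j ord0).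
Proof.
move=> t0; apply: (measurable_in_fun t0) => U mU.
by case: B_brownian => h _ _ _; exact: h.
Qed.

Let inc (s t : R) j w := B t w j ord0 - B s w j ord0.

Let minc (s t : R) j : 0 <= s -> s < t -> measurable_fun setT (inc s t j).
Proof.
move=> s0 st; apply: measurable_funB; apply: brownian_measurable => //.
exact: le_trans (ltW st).
Qed.

(** The defining property of Brownian motion gives the joint law of the
    coordinates of an increment only on boxes.  The indicators of the sides of
    the box are exchanged for exponentials one coordinate at a time: [lhs U k] has
    exponentials in the first [k] coordinates. *)
Lemma increment_mgf_indic (s t : R) (E : set Omega) (u : 'I_r -> R) :
  0 <= s -> s < t -> F s E ->
  (\int[P]_w ((\1_E w * expR (\sum_j u j * inc s t j w))%R)%:E =
   (fine (P E) * expR ((\sum_j u j ^+ 2) * (t - s) / 2))%:E)%E.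
Proof.
move=> s0 st FE.
have mE := filtration_measurable s0 FE.
pose sd := Num.sqrt (t - s).
have sd0 : sd != 0 by rewrite gt_eqF// sqrtr_gt0 subr_gt0.
pose lhs (U : 'I_r -> set R) k (j : 'I_r) w :=
  if (j < k)%N then expR (u j * inc s t j w) else \1_(U j) (inc s t j w).
pose rhs (U : 'I_r -> set R) k (j : 'I_r) :=
  if (j < k)%N then expR (u j ^+ 2 * (t - s) / 2)
  else fine (normal_prob 0 sd (U j)).
have mlhs (U : 'I_r -> set R) k j : measurable (U j) -> measurable_fun setT (lhs U k j).
  move=> mU; rewrite /lhs; case: (j < k)%N.
    by apply: measurableT_comp => //; apply: measurable_funM => //; exact: minc.
  by apply: (measurableT_comp (measurable_indic _)) => //; exact: minc.
have lhs0 U k j w : 0 <= lhs U k j w by rewrite /lhs; case: ifP => // _; exact: expR_ge0.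
have rhs0 U k j : 0 <= rhs U k j.
  by rewrite /rhs; case: ifP => _; rewrite ?expR_ge0// fine_ge0.
suff claim k : (k <= r)%N -> forall U, (forall j, measurable (U j)) ->
    (\int[P]_w (\1_E w * \prod_j lhs U k j w)%:E =
     (fine (P E) * \prod_j rhs U k j)%:E)%E.
  have := claim r (leqnn r) (fun=> setT) (fun=> measurableT).
  have -> : \prod_j rhs (fun=> setT) r j =
      expR ((\sum_j u j ^+ 2) * (t - s) / 2).
    rewrite -mulrA mulr_suml expR_sum; apply: eq_bigr => j _.
    by rewrite /rhs ltn_ord mulrA.
  move=> <-; apply: eq_integral => w _; rewrite expR_sum.
  congr (_ * _)%:E; apply: eq_bigr => j _.
  by rewrite /lhs ltn_ord.
elim: k => [_ U mU|k IH kr U mU].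
  have [_ _ _ /(_ s t s0 st E U FE mU)] := B_brownian.
  have mUj : measurable [set w | forall j, U j (inc s t j w)].
    have -> : [set w | forall j, U j (inc s t j w)] =
        \bigcap_(j in [set: 'I_r]) (inc s t j @^-1` U j).
      by apply/seteqP; split => w h //= j; [move=> _|]; apply: h.
    apply: fin_bigcap_measurable => // j _.
    by rewrite -[_ @^-1` _]setTI; apply: minc.
  move=> h; transitivity (P (E `&` [set w | forall j, U j (inc s t j w)])).
    rewrite -[E `&` _]setIT -integral_indic//; last exact: measurableI.
    apply: eq_integral => w _; congr EFin; rewrite indicI; congr (_ * _).
    rewrite indicE; case: (boolP (_ \in _)) => [|/negP nh].
      rewrite inE /= => h'; rewrite big1// => j _.
      by rewrite /lhs /= indicE mem_set.
    apply/eqP/prodf_eq0; apply: contrapT => /= h'; apply: nh; rewrite inE /=.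
    move=> j; apply: contrapT => nU; apply: h'; exists j => //.
    by rewrite /lhs /= indicE memNset.
  rewrite h EFinM fineK ?fin_num_measure//; congr (_ * _)%E.
  rewrite -prodEFin; apply: eq_bigr => j _.
  rewrite /rhs /= fineK //. apply: fin_num_measure. exact: mU.
pose j0 := Ordinal kr.
pose c := fine (P E) * \prod_(j | j != j0) rhs U k j.
pose g w := \1_E w * \prod_(j | j != j0) lhs U k j w.
transitivity (\int[P]_w ((g w)%:E * (expR (u j0 * inc s t j0 w))%:E))%E.
  apply: eq_integral => w _; rewrite -EFinM -mulrA; congr (_ * _)%:E.
  rewrite (bigD1 j0)//= mulrC; congr (_ * _); last by rewrite /lhs leqnn.
  by apply: eq_bigr => j jj0; have /negbTE jk : (j : nat) != k by []; rewrite /lhs ltnS (leq_eqVlt j k) jk.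
have c0 : 0 <= c by rewrite mulr_ge0 ?fine_ge0// prodr_ge0.
rewrite (@eq_integral_weight R _ _ _ _ _ _ P (normal_prob 0 sd) (inc s t j0)
  idfun g (cst c) (fun x => (expR (u j0 * x))%:E)).
- rewrite ge0_integralZl_EFin ?normal_mgf//.
  + rewrite -EFinM /c; congr EFin; rewrite -[LHS]mulrA; congr (_ * _).
    rewrite [RHS](bigD1 j0)//= mulrC; congr (_ * _).
      by rewrite /rhs leqnn sqr_sqrtr// subr_ge0 ltW.
    by apply: eq_bigr => j jj0; have /negbTE jk : (j : nat) != k by []; rewrite /rhs ltnS (leq_eqVlt j k) jk.
  + exact: measurable_expRM.
- exact: minc.
- exact: measurable_id.
- apply: measurable_funM; first exact: measurable_indic.
  under eq_fun do rewrite big_mkcond.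
  by apply: measurable_prod => j _; case: (j != j0) => //; exact: mlhs.
- exact: measurable_cst.
- by move=> w; rewrite mulr_ge0// prodr_ge0.
- by move=> w.
- move=> V mV; pose U' j := if j == j0 then V else U j.
  have mU' j : measurable (U' j) by rewrite /U'; case: ifP.
  have gE w : g w * \1_V (inc s t j0 w) = \1_E w * \prod_j lhs U' k j w.
    rewrite /g -mulrA; congr (_ * _).
    rewrite [RHS](bigD1 j0)//= mulrC; congr (_ * _); first by rewrite /lhs ltnn /U' eqxx.
    by apply: eq_bigr => j jj0; rewrite /lhs /U' (negbTE jj0).
  transitivity (\int[P]_w (\1_E w * \prod_j lhs U' k j w)%:E)%E.
    by apply: eq_integral => w _; rewrite -gE.
  rewrite (IH (ltnW kr) U' mU').
  rewrite ge0_integralZl_EFin//; last first.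
    by apply/measurable_EFinP; exact: measurable_indic.
  rewrite integral_indic// setIT -[X in _ = (_ * X)%E]fineK ?fin_num_measure//.
  rewrite -EFinM /c; congr EFin; rewrite -[RHS]mulrA; congr (_ * _).
  rewrite (bigD1 j0)//= mulrC; congr (_ * _); last by rewrite /rhs ltnn /U' eqxx.
  by apply: eq_bigr => j jj0; rewrite /rhs /U' (negbTE jj0).
- exact: measurable_expRM.
- by move=> x; rewrite lee_fin expR_ge0.
Qed.

(** The increment after [s] is independent of the weight [Y]; the previous lemma
    on the level sets of [Y] extends to [Y] by comparing weighted laws. *)
Lemma increment_mgf (s t : R) (Y : Omega -> R) (u : 'I_r -> R) :
  0 <= s -> s < t -> measurable_in (F s) Y -> (forall w, 0 <= Y w) ->
  (\int[P]_w ((Y w * expR (\sum_j u j * inc s t j w))%R)%:E =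
   (expR ((\sum_j u j ^+ 2) * (t - s) / 2))%:E * \int[P]_w (Y w)%:E)%E.
Proof.
move=> s0 st FY Y0.
have mY := measurable_in_fun s0 FY.
have mg : measurable_fun setT (fun w => expR (\sum_j u j * inc s t j w)).
  apply: measurableT_comp => //; apply: measurable_sum => j.
  by apply: measurable_funM => //; exact: minc.
set c := expR (_ / 2).
transitivity (\int[P]_w ((expR (\sum_j u j * inc s t j w))%:E *
    (`|Y w|)%:E))%E.
  by apply: eq_integral => w _; rewrite ger0_norm// mulrC EFinM.
rewrite (@eq_integral_weight R _ _ _ _ _ _ P P Y Y _ (cst c)
  (fun x => `|x|%:E)).
- rewrite ge0_integralZl_EFin ?expR_ge0//.
  + by under eq_integral do rewrite ger0_norm//.
  + by apply/measurable_EFinP/measurableT_comp.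
- exact: mY.
- exact: mY.
- exact: mg.
- exact: measurable_cst.
- by move=> w; exact: expR_ge0.
- by move=> w; exact: expR_ge0.
- move=> V mV.
  have mYV : measurable (Y @^-1` V) by rewrite -[_ @^-1` _]setTI; exact: mY.
  have := increment_mgf_indic u s0 st (FY _ mV).
  rewrite -/c => h; transitivity ((fine (P (Y @^-1` V)) * c)%:E).
    by rewrite -h; apply: eq_integral => w _; rewrite -EFinM mulrC.
  rewrite ge0_integralZl_EFin ?expR_ge0//.
  + rewrite (_ : (\int[P]_w _)%E = P (Y @^-1` V)).
      by rewrite EFinM fineK ?fin_num_measure// muleC.
    by rewrite -[Y @^-1` V]setIT -integral_indic.
  + apply/measurable_EFinP; apply: (measurableT_comp (measurable_indic _)) => //.
- by apply/measurable_EFinP; exact: normr_measurable.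
- by move=> x; rewrite lee_fin.
Qed.

End brownian_mgf.

Section grid_mgf.
Context {R : realType} {dis : measure_display} {Omega : measurableType dis}.
Variable P : probability Omega R.
Variables (r : nat) (F : R -> set (set Omega)) (B : R -> Omega -> 'cV[R]_r).
Hypothesis F_filtration : filtration F.
Hypothesis B_brownian : brownian_motion P F B.

Lemma measurable_in_le d (T : measurableType d) (s t : R) (Y : Omega -> T) :
  0 <= s -> s <= t -> measurable_in (F s) Y -> measurable_in (F t) Y.
Proof. by case: F_filtration => _ _ h s0 st mY U mU; apply: (h s t) => //; exact: mY. Qed.

Lemma measurable_in_brownian (s t : R) j : 0 <= s -> s <= t ->
  measurable_in (F t) (fun w => B s w j ord0).
Proof.
move=> s0 st; apply: (measurable_in_le s0 st) => U mU.
by case: B_brownian => h _ _ _; exact: h.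
Qed.

Definition grid_sum (m : nat) (q : nat -> R) (a : nat -> 'I_r -> R) w : R :=
  \sum_(l < m) \sum_j a l j * (B (q l.+1) w j ord0 - B (q l) w j ord0).

Definition grid_var (m : nat) (q : nat -> R) (a : nat -> 'I_r -> R) : R :=
  \sum_(l < m) (\sum_j a l j ^+ 2) * (q l.+1 - q l).

Lemma grid_mono m (q : nat -> R) :
  (forall l, (l < m)%N -> q l <= q l.+1) ->
  forall l k, (l <= k)%N -> (k <= m)%N -> q l <= q k.
Proof.
move=> h l; elim=> [|k IH]; first by rewrite leqn0 => /eqP ->.
rewrite leq_eqVlt => /predU1P[->//|lk] km.
exact: le_trans (IH lk (ltnW km)) (h _ km).
Qed.

Lemma measurable_in_grid_sum m (q : nat -> R) (a : nat -> 'I_r -> R) (t : R) :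
  0 <= q 0%N ->
  (forall l, (l <= m)%N -> 0 <= q l <= t) ->
  measurable_in (F t) (grid_sum m q a).
Proof.
move=> q0 qh.
have t0 : 0 <= t by have /andP[] := qh 0%N (leq0n _); exact: le_trans.
have sF : sigma_algebra setT (F t) by case: F_filtration => h _ _; exact: h.
apply/(measurable_inP _ sF); apply: measurable_sum => l.
apply: measurable_sum => j; apply: measurable_funM => //.
have /andP[? ?] := qh l (ltnW (ltn_ord l)).
have /andP[? ?] := qh l.+1 (ltn_ord l).
by apply: measurable_funB; apply/(measurable_inP _ sF);
  exact: measurable_in_brownian.
Qed.

(** Peel off the last increment: it is independent of the partial exponential,
    which is measurable for the sigma-algebra at the last but one time. *)
Lemma grid_mgf m (q : nat -> R) (a : nat -> 'I_r -> R) E :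
  0 <= q 0%N -> (forall l, (l < m)%N -> q l <= q l.+1) -> F (q 0%N) E ->
  (\int[P]_w ((\1_E w * expR (grid_sum m q a w))%R)%:E =
   (expR (grid_var m q a / 2))%:E * P E)%E.
Proof.
move=> q0; elim: m => [_ FE|m IH qh FE].
  have mE : measurable E by apply: (filtration_measurable F_filtration q0).
  rewrite /grid_var big_ord0 mul0r expR0 mul1e.
  rewrite -[E in RHS]setIT -integral_indic//; apply: eq_integral => w _.
  by rewrite /grid_sum big_ord0 expR0 mulr1.
have {}IH := IH (fun l lm => qh l (ltnW lm)) FE.
have qm0 : 0 <= q m by apply: le_trans q0 (grid_mono qh (leq0n m) (leqnSn m)).
have := qh m (ltnSn m); rewrite le_eqVlt => /orP[/eqP qE|qlt].
  have -> : grid_var m.+1 q a = grid_var m q a.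
    by rewrite /grid_var big_ord_recr/= qE subrr mulr0 addr0.
  rewrite -IH; apply: eq_integral => w _; congr (_ * expR _)%:E.
  rewrite /grid_sum big_ord_recr/= -[RHS]addr0; congr (_ + _).
  by apply: big1 => j _; rewrite qE subrr mulr0.
pose Y w := \1_E w * expR (grid_sum m q a w).
have sF : sigma_algebra setT (F (q m)) by case: F_filtration => h _ _; exact: h.
have mY : measurable_in (F (q m)) Y.
  apply/(measurable_inP _ sF); apply: measurable_funM.
    apply: measurable_indic.
    have -> : (F (q m)).-sigma.-measurable = F (q m) := sigma_algebra_id sF.
    case: F_filtration => _ _ h; apply: (h (q 0%N)) => //.
    exact: (grid_mono qh (leq0n m) (leqnSn m)).
  apply: measurableT_comp => //; apply/(measurable_inP _ sF).
  apply: measurable_in_grid_sum => // l lm; apply/andP; split.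
    by apply: le_trans q0 (grid_mono qh _ _) => //; exact: leq_trans lm _.
  by apply: (grid_mono qh lm).
have Y0 w : 0 <= Y w by rewrite mulr_ge0// expR_ge0.
have := increment_mgf F_filtration B_brownian (a m) qm0 qlt mY Y0.
rewrite IH muleA -EFinM -expRD.
rewrite /grid_var big_ord_recr/=
  [X in expR X](_ : _ = (\sum_(l < m) (\sum_j a l j ^+ 2) * (q l.+1 - q l) +
                         (\sum_j a m j ^+ 2) * (q m.+1 - q m)) / 2).
  move=> <-; apply: eq_integral => w _; rewrite /Y -mulrA -expRD.
  by rewrite /grid_sum big_ord_recr.
by rewrite mulrDl addrC.
Qed.

End grid_mgf.

(** * Step integrands and grids *)

Section telescope.
Context {R : realType}.

Definition clamp (a b x : R) := if x <= a then a else if x <= b then x else b.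

Lemma clamp_increment (phi : R -> R) (a b x y : R) : a <= b -> x <= y ->
  ~ (x < a < y) -> ~ (x < b < y) ->
  (if a < y <= b then phi y - phi x else 0) =
  phi (clamp a b y) - phi (clamp a b x).
Proof.
move=> ab xy na nb; rewrite /clamp [y <= a]leNgt.
case: (ltP a y) => ay /=; last by rewrite (le_trans xy ay) subrr.
case: (leP y b) => yb /=.
  have [xa|ax] := leP x a; last by rewrite (le_trans xy yb).
  have [->//|xa'] := eqVneq x a.
  by exfalso; apply: na; rewrite ay lt_neqAle xa' xa.
have [xa|ax] := leP x a.
  have [ba|ab'] := leP b a; first by have -> : a = b by [lra]; rewrite subrr.
  by exfalso; apply: nb; rewrite yb (le_lt_trans xa ab').
have [xb|bx] := leP x b; last by rewrite subrr.
have [->|xb'] := eqVneq x b; first by rewrite subrr.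
by exfalso; apply: nb; rewrite yb lt_neqAle xb' xb.
Qed.

(** Composed with the projection [clamp a b] onto [a, b], the path telescopes over
    the grid and moves only on the cells inside the interval. *)
Lemma grid_telescope (phi : R -> R) (q : nat -> R) m a b :
  (forall l k, (l <= k)%N -> (k <= m)%N -> q l <= q k) ->
  (exists2 l, (l <= m)%N & q l = a) -> (exists2 l, (l <= m)%N & q l = b) ->
  a <= b ->
  phi b - phi a =
  \sum_(l < m) (if a < q l.+1 <= b then phi (q l.+1) - phi (q l) else 0).
Proof.
move=> qm qa qb ab.
have nomid c : (exists2 l, (l <= m)%N & q l = c) ->
    forall l, (l < m)%N -> ~ (q l < c < q l.+1).
  move=> [k km <-] l lm /andP[h1 h2].
  have [kl|lk] := leqP k l.
    by have := qm _ _ kl (ltnW lm); rewrite leNgt h1.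
  by have := qm _ _ lk km; rewrite leNgt h2.
transitivity (\sum_(l < m) (phi (clamp a b (q l.+1)) - phi (clamp a b (q l)))).
  rewrite -(big_mkord xpredT (fun l => phi (clamp a b (q l.+1)) - phi (clamp a b (q l)))).
  rewrite telescope_sumr//; case: qa => la lam qa; case: qb => lb lbm qb.
  have q0a : q 0%N <= a by rewrite -qa qm.
  have bqm : b <= q m by rewrite -qb qm.
  rewrite /clamp q0a [q m <= a]leNgt; case: (ltP a (q m)) => aq /=.
    have [qmb|//] := leP (q m) b.
    by have -> : q m = b by lra.
  by have -> : b = a by lra.
apply: eq_bigr => l _; rewrite clamp_increment//.
- exact: qm.
- exact: nomid.
- exact: nomid.
Qed.

End telescope.

Section refinement.
Context {R : realType} {I : finType}.

(** A list of triples (left end, right end, coefficients) stands for the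
    integrand [\sum_x x.2 \1_(]x.1.1, x.1.2])].  Its integral against any path
    is a sum of increments; the random path and the indicator functions of
    half-lines are the two paths that matter. *)
Definition list_sum (L : seq (R * R * (I -> R))) (phi : I -> R -> R) : R :=
  \sum_(x <- L) \sum_j x.2 j * (phi j x.1.2 - phi j x.1.1).

(** One sorted grid refines all the intervals of a list. *)
Lemma list_sum_refine (s t : R) (L : seq (R * R * (I -> R))) : s <= t ->
  (forall x, x \in map fst L -> s <= x.1 /\ x.1 <= x.2 /\ x.2 <= t) ->
  exists (m : nat) (q : nat -> R) (a : nat -> I -> R),
  [/\ q 0%N = s, q m = t, forall l, (l < m)%N -> q l <= q l.+1 &
    forall phi : I -> R -> R, list_sum L phi =
      \sum_(l < m) \sum_j a l j * (phi j (q l.+1) - phi j (q l))].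
Proof.
move=> st hL.
pose pts := s :: t :: (map (fun x => x.1.1) L ++ map (fun x => x.1.2) L).
pose sp := sort <=%R pts.
pose m := (size sp).-1.
pose q l := nth s sp l.
have szsp : size sp = m.+1 by rewrite /m size_sort.
have sorted_sp : sorted <=%R sp by apply: sort_sorted; exact: le_total.
have qmono l k : (l <= k)%N -> (k <= m)%N -> q l <= q k.
  move=> lk km; apply: (sorted_leq_nth le_trans lexx) => //; rewrite inE szsp ltnS//.
  exact: leq_trans km.
have qpts c : c \in pts -> exists2 l, (l <= m)%N & q l = c.
  rewrite -(mem_sort <=%R) => /(nthP s)[l lm <-]; exists l => //.
  by rewrite -ltnS -szsp.
have ptsb c : c \in pts -> s <= c <= t.
  rewrite !inE mem_cat => /orP[/eqP->|/orP[/eqP->|/orP[]/mapP[x xL ->]]].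
  - by rewrite lexx.
  - by rewrite lexx st.
  - by have [? []] := hL x.1 (map_f _ xL); lra.
  - by have [? []] := hL x.1 (map_f _ xL); lra.
have qs : q 0%N = s.
  have [l lm ql] := qpts s (mem_head _ _).
  apply/eqP; rewrite eq_le -{1}ql qmono//=.
  have /ptsb/andP[] // : q 0%N \in pts.
  by rewrite -(mem_sort <=%R) mem_nth// szsp.
have qt : q m = t.
  have [|l lm ql] := qpts t; first by rewrite !inE eqxx orbT.
  apply/eqP; rewrite eq_le -{2}ql qmono//= andbT.
  have /ptsb/andP[] // : q m \in pts.
  by rewrite -(mem_sort <=%R) mem_nth// szsp.
exists m, q, (fun l j => \sum_(x <- L) if x.1.1 < q l.+1 <= x.1.2 then x.2 j else 0).
split=> //; first by move=> l lm; apply: qmono.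
move=> phi; rewrite /list_sum.
transitivity (\sum_(x <- L) \sum_(l < m) \sum_j
   (if x.1.1 < q l.+1 <= x.1.2 then x.2 j else 0) *
   (phi j (q l.+1) - phi j (q l))).
  rewrite big_seq [RHS]big_seq; apply: eq_bigr => x xL.
  rewrite exchange_big/=; apply: eq_bigr => j _.
  have [_ [x12 _]] := hL x.1 (map_f _ xL).
  rewrite (grid_telescope (phi j) qmono _ _ x12).
  - rewrite mulr_sumr; apply: eq_bigr => l _.
    by case: ifP => _; rewrite ?mul0r ?mulr0.
  - by apply: qpts; rewrite !inE mem_cat (map_f (fun x => x.1.1) xL) ?orbT.
  - apply: qpts; rewrite !inE mem_cat.
    by rewrite (map_f (fun x => x.1.2) xL) !orbT.
rewrite exchange_big/=; apply: eq_bigr => l _.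
rewrite exchange_big/=; apply: eq_bigr => j _.
by rewrite mulr_suml.
Qed.

End refinement.

(** * Tail bounds from exponential moments *)

Section level_sets.
Context {R : realType} {dis : measure_display} {Omega : measurableType dis}.

Lemma measurable_abs_gt (Z : Omega -> R) (x : R) :
  measurable_fun setT Z -> measurable [set w | x < `|Z w|].
Proof.
move=> mZ.
have -> : [set w | x < `|Z w|] = (fun w => `|Z w|) @^-1` `]x, +oo[.
  by apply/seteqP; split => w /=; rewrite in_itv/= andbT.
by rewrite -[_ @^-1` _]setTI; apply: measurableT_comp.
Qed.

Lemma measurable_gt (Z : Omega -> R) (x : R) :
  measurable_fun setT Z -> measurable [set w | x < Z w].
Proof.
move=> mZ.
have -> : [set w | x < Z w] = Z @^-1` `]x, +oo[.
  by apply/seteqP; split => w /=; rewrite in_itv/= andbT.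
by rewrite -[_ @^-1` _]setTI; apply: mZ.
Qed.

End level_sets.

Section mgf_tails.
Context {R : realType} {dis : measure_display} {Omega : measurableType dis}.
Variable P : probability Omega R.
Variables (E : set Omega) (S : Omega -> R) (V : R).
Hypothesis mE : measurable E.
Hypothesis mS : measurable_fun setT S.
Hypothesis mgfS : forall lam : R,
  (\int[P]_w ((\1_E w * expR (lam * S w))%R)%:E =
   (expR (lam ^+ 2 * V / 2))%:E * P E)%E.

Let mSgt x : measurable [set w | x < S w].
Proof. exact: measurable_gt. Qed.

Let mexp lam : measurable_fun setT (fun w => expR (lam * S w)).
Proof. by apply: measurableT_comp => //; exact: measurable_funM. Qed.

Lemma chernoff_bound lam x : 0 <= lam ->
  (P (E `&` [set w | (x < S w)%R]) <=
   (expR (lam ^+ 2 * V / 2 - lam * x))%:E * P E)%E.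
Proof.
move=> l0; have mI : measurable (E `&` [set w | x < S w]) by exact: measurableI.
have H : ((expR (lam * x))%:E * P (E `&` [set w | (x < S w)%R]) <=
   (expR (lam ^+ 2 * V / 2))%:E * P E)%E.
  rewrite -mgfS -[E `&` _]setIT -integral_indic//.
  rewrite -ge0_integralZl_EFin ?expR_ge0//; last first.
    by apply/measurable_EFinP; exact: measurable_indic.
  apply: ge0_le_integral => //.
  - by apply: measurable_funeM; apply/measurable_EFinP; exact: measurable_indic.
  - by apply/measurable_EFinP; apply: measurable_funM => //; exact: measurable_indic.
  move=> w _; rewrite -EFinM lee_fin indicI /= mulrCA ler_wpM2l//.
  rewrite indicE; case: (boolP (_ \in _)) => [|_]; last by rewrite mulr0 expR_ge0.
  by rewrite inE /= mulr1 ler_expR => xS; rewrite ler_wpM2l// ltW.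
rewrite [_ - _]addrC expRD EFinM -muleA expRN.
by rewrite lee_pdivlMl ?expR_gt0.
Qed.

Hypothesis V0 : 0 <= V.

(** The Paley-Zygmund argument: [W = exp (lam S)] has mean [m] and second
    moment [m ^ 4] on [E], so it exceeds [m / 2] with probability [m ^ -2 / 4]
    at least.  The Cauchy-Schwarz step is the pointwise inequality
    [W <= al / 2 * W ^ 2 + 1 / (2 al)] with the optimal [al = 1 / (2 m ^ 3)]. *)
Lemma lower_tail x : 0 < x -> 0 < V -> V <= 4 * x ^+ 2 ->
  ((expR (- (16 * x ^+ 2 / V)) / 4)%:E * P E <=
   P (E `&` [set w | (x < S w)%R]))%E.
Proof.
move=> x0 V_gt0 Vx.
(* With this [lam] the threshold [m / 2] of [W] lies above [exp (lam x)], by the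
   assumption [V <= 4 x ^ 2], and [m ^ -2 = exp (- 16 x ^ 2 / V)]. *)
pose lam := 4 * x / V.
have lam0 : 0 < lam by rewrite divr_gt0// mulr_gt0.
pose m := expR (lam ^+ 2 * V / 2).
have m0 : 0 < m by exact: expR_gt0.
have c1 : 0 <= m / 2 by rewrite divr_ge0// ltW.
have c3 : 0 <= m ^+ 3 by rewrite exprn_ge0// ltW.
have c2 : 0 <= (4 * m ^+ 3)^-1 by rewrite invr_ge0 mulr_ge0.
pose W w := expR (lam * S w).
pose A := [set w | x < S w].
have mA : measurable A by exact: mSgt.
have WA w : m / 2 < W w -> A w.
  rewrite ltr_pdivrMr// => h.
  have e1 : 2 <= expR 1 :> R by have := expR_ge1Dx (1 : R); lra.
  have : m < expR (lam * S w + 1).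
    by rewrite expRD (lt_le_trans h)// ler_wpM2l// expR_ge0.
  rewrite /m ltr_expR /A /= => h2.
  rewrite -(ltr_pM2l lam0).
  have -> : lam * x = lam ^+ 2 * V / 2 - 1 - (lam ^+ 2 * V / 2 - 1 - lam * x) by ring.
  have : 0 <= lam ^+ 2 * V / 2 - 1 - lam * x.
    have -> : lam ^+ 2 * V / 2 - 1 - lam * x = (4 * x ^+ 2 - V) / V.
      by rewrite /lam; field; rewrite gt_eqF.
    by rewrite divr_ge0 ?subr_ge0// ltW.
  lra.
have p_fin := fin_num_measure P _ mE.
have mI : measurable (E `&` A) by exact: measurableI.
have q_fin := fin_num_measure P _ mI.
pose p := fine (P E); pose q := fine (P (E `&` A)).
have pE : P E = p%:E by rewrite fineK.
have qE : P (E `&` A) = q%:E by rewrite fineK.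
have M1 : (\int[P]_w (\1_E w * W w)%:E = (m * p)%:E)%E.
  by rewrite mgfS pE EFinM.
have M2 : (\int[P]_w (\1_E w * W w ^+ 2)%:E = (m ^+ 4 * p)%:E)%E.
  have -> : m ^+ 4 = expR ((2 * lam) ^+ 2 * V / 2).
    by rewrite /m -expRM_natl; congr expR; ring.
  rewrite EFinM -pE -mgfS; apply: eq_integral => w _.
  by rewrite /W -expRM_natl mulrA.
have T1 w : 0 <= (4 * m ^+ 3)^-1 * (\1_E w * W w ^+ 2).
  by apply: mulr_ge0 => //; apply: mulr_ge0 => //; exact: sqr_ge0.
have T2 w : 0 <= m ^+ 3 * \1_(E `&` A) w by exact: mulr_ge0.
have key : (\int[P]_w (\1_E w * W w)%:E <=
    \int[P]_w ((m / 2)%:E * (\1_E w)%:E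
      + ((4 * m ^+ 3)^-1%:E * (\1_E w * W w ^+ 2)%:E
      + (m ^+ 3)%:E * (\1_(E `&` A) w)%:E)))%E.
  apply: ge0_le_integral => //.
  - by move=> w _; rewrite lee_fin mulr_ge0// expR_ge0.
  - by apply/measurable_EFinP; apply: measurable_funM; [exact: measurable_indic|exact: mexp].
  - under eq_fun do rewrite -!EFinM -!EFinD.
    apply/measurable_EFinP; apply: measurable_funD; first by apply: measurable_funM => //; exact: measurable_indic.
    apply: measurable_funD; (apply: measurable_funM => //); try exact: measurable_indic.
    apply: measurable_funM; first exact: measurable_indic.
    by apply: measurable_funX; exact: mexp.
  move=> w _; rewrite -!EFinM -!EFinD lee_fin indicI /=.
  have [Ew|nEw] := boolP (w \in E); last by rewrite !indicE (negbTE nEw) !(mul0r, mulr0) !addr0.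
  rewrite [\1_E w]indicE Ew !mul1r mulr1.
  have [WA'|] := ltP (m / 2) (W w).
    rewrite indicE mem_set ?mulr1; last exact: WA.
    (* The choice [al = 1 / (2 m ^ 3)] completes this square. *)
    have sq : 0 <= (4 * m ^+ 3)^-1 * (W w - 2 * m ^+ 3) ^+ 2.
      by rewrite mulr_ge0 ?sqr_ge0// invr_ge0 mulr_ge0// exprn_ge0// ltW.
    have E1 : (4 * m ^+ 3)^-1 * (W w - 2 * m ^+ 3) ^+ 2 =
       (4 * m ^+ 3)^-1 * W w ^+ 2 - W w + m ^+ 3.
      by field; rewrite gt_eqF.
    rewrite E1 in sq; lra.
  move=> h; rewrite (le_trans h)// lerDl addr_ge0//.
    by rewrite mulr_ge0 ?sqr_ge0// invr_ge0 mulr_ge0// exprn_ge0// ltW.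
  by rewrite mulr_ge0// exprn_ge0// ltW.
move: key; rewrite M1 ge0_integralD//=; last 4 first.
- by move=> w _; rewrite -EFinM lee_fin mulr_ge0// ltW// divr_gt0.
- by apply: measurable_funeM; apply/measurable_EFinP; exact: measurable_indic.
- move=> w _; rewrite -!EFinM -!EFinD lee_fin.
  exact: addr_ge0 (T1 w) (T2 w).
- apply: emeasurable_funD; apply: measurable_funeM; apply/measurable_EFinP.
    apply: measurable_funM; first exact: measurable_indic.
    by apply: measurable_funX; exact: mexp.
  exact: measurable_indic.
rewrite ge0_integralD//=; last 4 first.
- by move=> w _; rewrite -!EFinM lee_fin; exact: T1.
- apply: measurable_funeM; apply/measurable_EFinP.
  apply: measurable_funM; first exact: measurable_indic.
  by apply: measurable_funX; exact: mexp.
- by move=> w _; rewrite -EFinM lee_fin mulr_ge0// exprn_ge0// ltW.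
- by apply: measurable_funeM; apply/measurable_EFinP; exact: measurable_indic.
rewrite !ge0_integralZl_EFin//; last 4 first.
- by apply/measurable_EFinP; exact: measurable_indic.
- by move=> w _; rewrite lee_fin; apply: mulr_ge0 => //; exact: sqr_ge0.
- apply/measurable_EFinP; apply: measurable_funM; first exact: measurable_indic.
  by apply: measurable_funX; exact: mexp.
- by apply/measurable_EFinP; exact: measurable_indic.
have I1 : (\int[P]_w (\1_E w)%:E = p%:E)%E by rewrite integral_indic// setIT -pE.
have I2 : (\int[P]_w (\1_(E `&` A) w)%:E = q%:E)%E.
  by rewrite integral_indic// setIT -qE.
rewrite M2 I1 I2 pE qE -!EFinM -!EFinD !lee_fin => key.
have -> : expR (- (16 * x ^+ 2 / V)) = (m ^+ 2)^-1.
  rewrite /m -expRM_natl -expRN; congr expR; rewrite /lam.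
  by field; rewrite gt_eqF.
have E2 : (4 * m ^+ 3)^-1 * (m ^+ 4 * p) = m * p / 4 by field; rewrite gt_eqF.
rewrite E2 in key.
have k2 : m * p / 4 <= m ^+ 3 * q by lra.
have m3 : 0 < m ^+ 3 by rewrite exprn_gt0.
rewrite -(ler_pM2l m3) (le_trans _ k2)//.
by rewrite le_eqVlt; apply/orP; left; apply/eqP; field; rewrite gt_eqF.
Qed.

Lemma upper_tail x v : 0 < x -> 0 < v -> V <= v ->
  (P (E `&` [set w | (x < S w)%R]) <=
   (expR (- (x ^+ 2 / (2 * v))))%:E * P E)%E.
Proof.
move=> x0 v0 Vv; apply: le_trans (chernoff_bound x (ltW (divr_gt0 x0 v0))) _.
rewrite lee_wpmul2r ?measure_ge0// lee_fin ler_expR.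
have -> : - (x ^+ 2 / (2 * v)) = (x / v) ^+ 2 * v / 2 - x / v * x.
  by field; rewrite gt_eqF.
by rewrite lerD2r ler_wpM2r// ler_wpM2l// sqr_ge0.
Qed.

End mgf_tails.

Section mgf_tail_abs.
Context {R : realType} {dis : measure_display} {Omega : measurableType dis}.
Variable P : probability Omega R.

(** The moment generating function is even in [lam], so the upper tail also
    bounds the lower one. *)
Lemma abs_tail (E : set Omega) (S : Omega -> R) (V : R) :
  measurable E -> measurable_fun setT S -> 0 <= V ->
  (forall lam : R,
    (\int[P]_w ((\1_E w * expR (lam * S w))%R)%:E =
     (expR (lam ^+ 2 * V / 2))%:E * P E)%E) ->
  forall x v, 0 < x -> 0 < v -> V <= v ->
  (P (E `&` [set w | (x < `|S w|)%R]) <=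
   (2 * expR (- (x ^+ 2 / (2 * v))))%:E * P E)%E.
Proof.
move=> mE mS V0 mgf x v x0 v0 Vv.
have mN : measurable_fun setT (fun w => - S w) by exact: measurableT_comp.
have mgt (Z : Omega -> R) : measurable_fun setT Z -> measurable (E `&` [set w | x < Z w]).
  by move=> mZ; apply: measurableI => //; exact: measurable_gt.
have mgfN lam : (\int[P]_w ((\1_E w * expR (lam * - S w))%R)%:E =
     (expR (lam ^+ 2 * V / 2))%:E * P E)%E.
  by rewrite -sqrrN -mgf; apply: eq_integral => w _; rewrite mulrN mulNr.
have -> : E `&` [set w | x < `|S w|] =
    (E `&` [set w | x < S w]) `|` (E `&` [set w | x < - S w]).
  apply/seteqP; split => w /=; rewrite lter_normr.
    by move=> [Ew /orP[|]]; [left|right].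
  by move=> [[Ew ->]|[Ew ->]]; rewrite ?orbT.
apply: (le_trans (measureU2 _ _ _)); [exact: mgt|exact: mgt|].
rewrite mulrDl mul1r EFinD ge0_muleDl ?lee_fin ?expR_ge0//.
by apply: leeD; apply: upper_tail Vv.
Qed.

End mgf_tail_abs.

(** * Approximation of the stochastic integral by normal variables *)

Section list_mgf.
Context {R : realType} {dis : measure_display} {Omega : measurableType dis}.
Variable P : probability Omega R.
Variables (r : nat) (F : R -> set (set Omega)) (B : R -> Omega -> 'cV[R]_r).
Hypothesis F_filtration : filtration F.
Hypothesis B_brownian : brownian_motion P F B.
Local Notation mu := (@lebesgue_measure R).

Lemma indic_itv_oc (a b x : R) :
  \1_(`]a, b]%classic : set R) x = (a < x <= b)%R%:R :> R.
Proof. by rewrite indicE mem_setE in_itv. Qed.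

Lemma indic_itv_ocB (a b x : R) : a <= b ->
  (a < x <= b)%R%:R = (x <= b)%R%:R - (x <= a)%R%:R :> R.
Proof.
move=> ab; rewrite ltNge; case: (leP x a) => xa /=; last by rewrite subr0.
by rewrite (le_trans xa ab) subrr.
Qed.

(** The cells of a grid are disjoint, so the square has no cross terms. *)
Lemma sqr_sum_indic m (q : nat -> R) (a : nat -> R) x :
  (forall l, (l < m)%N -> q l <= q l.+1) ->
  (\sum_(l < m) a l * (q l < x <= q l.+1)%R%:R) ^+ 2 =
  \sum_(l < m) a l ^+ 2 * (q l < x <= q l.+1)%R%:R.
Proof.
move=> qh; case: (pselect (exists l : 'I_m, q l < x <= q l.+1)) => [[l0 h0]|nex].
  have oth (l : 'I_m) : l != l0 -> (q l < x <= q l.+1) = false.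
    move=> ll0; apply/negP => /andP[h1 h2]; move/andP: h0 => [h3 h4].
    have [ltl|] := ltnP l l0.
      have := grid_mono qh ltl (ltnW (ltn_ord l0)); lra.
    rewrite leq_eqVlt => /predU1P[/val_inj/esym|l0l]; first exact/eqP.
    have := grid_mono qh l0l (ltnW (ltn_ord l)); lra.
  rewrite (bigD1 l0)//= big1 ?addr0; last by move=> l /oth->; rewrite mulr0.
  rewrite [RHS](bigD1 l0)//= [X in _ + X]big1 ?addr0; last by move=> l /oth->; rewrite mulr0.
  by rewrite h0 !mulr1.
have no (l : 'I_m) : (q l < x <= q l.+1) = false.
  by apply/negP => h; apply: nex; exists l.
rewrite !big1 ?expr0n//; first by move=> l _; rewrite no mulr0.
by move=> l _; rewrite no mulr0.
Qed.

Lemma grid_var_integral m (q : nat -> R) (a : nat -> 'I_r -> R) :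
  (forall l, (l < m)%N -> q l <= q l.+1) ->
  (\int[mu]_(x in `]q 0%N, q m])
     (\sum_j (\sum_(l < m) a l j * (q l < x <= q l.+1)%R%:R) ^+ 2)%:E =
   (grid_var m q a)%:E)%E.
Proof.
move=> qh.
have b0 l : 0 <= \sum_j a l j ^+ 2 by apply: sumr_ge0 => j _; exact: sqr_ge0.
transitivity (\int[mu]_(x in `]q 0%N, q m])
    (\sum_(l < m) (\sum_j a l j ^+ 2)%:E * (\1_(`]q l, q l.+1]%classic : set R) x)%:E))%E.
  apply: eq_integral => x _.
  under [in RHS]eq_bigr do rewrite -EFinM.
  rewrite sumEFin; congr EFin.
  under eq_bigr => j _ do rewrite (sqr_sum_indic (fun l => a l j) x qh).
  rewrite exchange_big/=; apply: eq_bigr => l _.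
  by rewrite mulr_suml; apply: eq_bigr => j _; rewrite indic_itv_oc.
rewrite ge0_integral_sum//.
- rewrite /grid_var -sumEFin; apply: eq_bigr => l _.
  rewrite ge0_integralZl_EFin//; last first.
    by apply/measurable_EFinP; apply: measurable_funTS; exact: measurable_indic.
  rewrite integral_indic// setIidl.
    have := qh l (ltn_ord l).
    rewrite /= lebesgue_measure_itv/= lte_fin le_eqVlt => /predU1P[->|->].
      by rewrite ltxx subrr mulr0 mule0.
    by rewrite EFinM EFinB.
  move=> x /=; rewrite !in_itv/= => /andP[h1 h2].
  have h3 := grid_mono qh (leq0n l) (ltnW (ltn_ord l)).
  have h4 := grid_mono qh (ltn_ord l) (leqnn m).
  by rewrite (le_lt_trans h3 h1) (le_trans h2 h4).
- move=> l; apply: measurable_funeM; apply/measurable_EFinP.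
  by apply: measurable_funTS; exact: measurable_indic.
- by move=> l x _; rewrite -EFinM lee_fin mulr_ge0.
Qed.

(** The integrand of a list, recovered as its integral against the path
    [u |-> (x <= u)]; facts about the integral, such as refinement or splitting at
    a time, thereby hold for the integrand too. *)
Definition list_fun (L : seq (R * R * ('I_r -> R))) (j : 'I_r) (x : R) : R :=
  list_sum L (fun j' u => if j' == j then (x <= u)%R%:R else 0).

(** On a common grid the integral of a list is a sum of independent increments:
    conditionally on the past it is centred normal, and its variance is the one
    given by the Ito isometry. *)
Lemma list_mgf (s t : R) (L : seq (R * R * ('I_r -> R))) E :
  0 <= s -> s <= t -> F s E ->
  (forall x, x \in map fst L -> s <= x.1 /\ x.1 <= x.2 /\ x.2 <= t) ->
  measurable_fun setT (fun w => list_sum L (fun j u => B u w j ord0)) /\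
  exists2 V : R, 0 <= V &
  (\int[mu]_(x in `]s, t]) (\sum_j (list_fun L j x) ^+ 2)%:E = V%:E)%E /\
  forall lam,
  (\int[P]_w ((\1_E w * expR (lam * list_sum L (fun j u => B u w j ord0)))%R)%:E =
     (expR (lam ^+ 2 * V / 2))%:E * P E)%E.
Proof.
move=> s0 st FE hL.
have [m [q [a [q0 qm qh phiE]]]] := list_sum_refine st hL.
have qb l : (l <= m)%N -> 0 <= q l <= t.
  move=> lm; rewrite (le_trans s0) /=; last by rewrite -q0; exact: (grid_mono qh).
  by rewrite -qm; exact: (grid_mono qh).
have SE w : list_sum L (fun j u => B u w j ord0) = grid_sum B m q a w by rewrite phiE.
have q00 : 0 <= q 0%N by rewrite q0.
split.
  under eq_fun do rewrite SE.
  apply: (measurable_in_fun F_filtration (le_trans s0 st)).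
  exact: (measurable_in_grid_sum F_filtration B_brownian).
exists (grid_var m q a).
  apply: sumr_ge0 => l _; apply: mulr_ge0; last by rewrite subr_ge0 qh.
  by apply: sumr_ge0 => j _; exact: sqr_ge0.
split.
  rewrite -grid_var_integral// q0 qm; apply: eq_integral => x _; congr EFin.
  apply: eq_bigr => j _; congr (_ ^+ 2); rewrite /list_fun phiE.
  apply: eq_bigr => l _; rewrite (bigD1 j)//= eqxx big1 ?addr0.
    by rewrite -indic_itv_ocB// qh.
  by move=> j' /negbTE ->; rewrite subrr mulr0.
move=> lam.
have -> : lam ^+ 2 * grid_var m q a = grid_var m q (fun l j => lam * a l j).
  rewrite /grid_var mulr_sumr; apply: eq_bigr => l _; rewrite mulrA; congr (_ * _).
  by rewrite mulr_sumr; apply: eq_bigr => j _; rewrite exprMn.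
rewrite -(grid_mgf F_filtration B_brownian) ?q0//.
apply: eq_integral => w _; congr (_ * expR _)%:E; rewrite SE /grid_sum mulr_sumr.
by apply: eq_bigr => l _; rewrite mulr_sumr; apply: eq_bigr => j _; rewrite mulrA.
Qed.

End list_mgf.

Lemma cvge0_lt {R : realType} {T : Type} {F : set_system T} {FF : Filter F}
    (f : T -> \bar R) (e : R) :
  f @ F --> 0%E -> 0 < e -> \forall x \near F, (f x < e%:E)%E.
Proof.
by move=> /(_ [set y | (y < e%:E)%E]) f0 e0; apply: f0; apply: open_ereal_lt'; rewrite lte_fin.
Qed.

Section tends0.
Context {R : realType} {dis : measure_display} {Omega : measurableType dis}.
Variable P : probability Omega R.

(** Convergence to zero in probability. *)
Definition tends0 (Z : nat -> Omega -> R) : Prop :=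
  (forall N, measurable_fun setT (Z N)) /\
  forall eta del : R, 0 < eta -> 0 < del ->
    \forall N \near \oo, (P [set w | (eta < `|Z N w|)%R] <= del%:E)%E.

Lemma tends0D Z1 Z2 : tends0 Z1 -> tends0 Z2 -> tends0 (fun N w => Z1 N w + Z2 N w).
Proof.
move=> [m1 h1] [m2 h2]; split=> [N|eta del eta0 del0]; first exact: measurable_funD.
have e2 : 0 < eta / 2 by rewrite divr_gt0.
have d2 : 0 < del / 2 by rewrite divr_gt0.
near=> N.
apply: (@le_trans _ _ (P ([set w | (eta / 2 < `|Z1 N w|)%R] `|`
    [set w | (eta / 2 < `|Z2 N w|)%R]))).
  apply: le_measure; rewrite ?inE; [|apply: measurableU|].
  - by apply: measurable_abs_gt; exact: measurable_funD.
  - exact: measurable_abs_gt.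
  - exact: measurable_abs_gt.
  move=> w /= h; apply/orP; rewrite -[_ || _]negbK negb_or -!leNgt.
  apply/negP => /andP[ha hb]; have := ler_normD (Z1 N w) (Z2 N w); lra.
rewrite (splitr del) EFinD.
apply: (le_trans (measureU2 _ _ _)); [exact: measurable_abs_gt..|].
apply: leeD.
  by near: N; exact: h1.
by near: N; exact: h2.
Unshelve. all: by end_near. Qed.

Lemma tends0N Z : tends0 Z -> tends0 (fun N w => - Z N w).
Proof.
move=> [m h]; split=> [N|eta del e0 d0]; first exact: measurableT_comp.
by under eq_near do under eq_set do rewrite normrN; exact: h.
Qed.

Lemma tends0_ext Z1 Z2 : (forall N w, Z1 N w = Z2 N w) -> tends0 Z1 -> tends0 Z2.
Proof. by move=> h; have -> : Z1 = Z2 by apply/funext => N; apply/funext => w. Qed.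

(** Chebyshev's inequality. *)
Lemma tends0_L2 (Z : nat -> Omega -> R) (G : nat -> Omega -> R) :
  (forall N, measurable_fun setT (Z N)) -> (forall N, measurable_fun setT (G N)) ->
  (forall N w, Z N w ^+ 2 <= G N w) ->
  (\int[P]_w (G N w)%:E)%E @[N --> \oo] --> 0%E -> tends0 Z.
Proof.
move=> mZ mG ZG G0; split=> // eta del eta0 del0.
have ed : 0 < del * eta ^+ 2 by rewrite mulr_gt0// exprn_gt0.
have : \forall N \near \oo, (\int[P]_w (G N w)%:E < (del * eta ^+ 2)%:E)%E.
  exact: (cvge0_lt G0).
apply: filterS => N /ltW h.
have e2 : 0 < eta ^+ 2 by rewrite exprn_gt0.
rewrite -(@lee_pmul2r _ (eta ^+ 2)%:E)// -EFinM muleC.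
apply: le_trans h.
have mA := measurable_abs_gt eta (mZ N).
rewrite -[X in P X]setIT -integral_indic//.
rewrite -ge0_integralZl_EFin ?(ltW e2)//; last first.
  by apply/measurable_EFinP; exact: measurable_indic.
apply: ge0_le_integral => //.
- by move=> w _; rewrite -EFinM lee_fin mulr_ge0// ltW.
- by apply: measurable_funeM; apply/measurable_EFinP; exact: measurable_indic.
- exact/measurable_EFinP.
move=> w _; rewrite -EFinM lee_fin (le_trans _ (ZG N w))// indicE.
case: (boolP (_ \in _)) => [|_]; last by rewrite mulr0 sqr_ge0.
by rewrite inE /= mulr1 -[Z N w ^+ 2]real_normK ?num_real// => hlt; rewrite lerXn2r ?nnegrE// ltW.
Qed.

Lemma expRN_le (y : R) : 0 < y -> expR (- y) <= y^-1.
Proof.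
move=> y0; rewrite expRN lef_pV2 ?posrE ?expR_gt0//.
by have := expR_ge1Dx y; lra.
Qed.

(** Normal variables with vanishing variance; the Gaussian tail is more than
    enough. *)
Lemma tends0_gauss (Z : nat -> Omega -> R) (V : nat -> R) :
  (forall N, measurable_fun setT (Z N)) -> (forall N, 0 <= V N) ->
  (forall N lam, (\int[P]_w ((\1_(setT : set Omega) w * expR (lam * Z N w))%R)%:E =
     (expR (lam ^+ 2 * V N / 2))%:E * P setT)%E) ->
  V N @[N --> \oo] --> 0 -> tends0 Z.
Proof.
move=> mZ V0 mgf V00; split=> // eta del eta0 del0.
pose v := del * eta ^+ 2 / 4.
have v0 : 0 < v by rewrite divr_gt0// mulr_gt0// exprn_gt0.
have : \forall N \near \oo, V N < v by apply: (cvgr_lt _ V00).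
apply: filterS => N /ltW VN.
have := abs_tail measurableT (mZ N) (V0 N) (mgf N) eta0 v0 VN.
rewrite setTI probability_setT mule1 => h; apply: (le_trans h).
rewrite lee_fin -ler_pdivlMl//.
apply: (le_trans (expRN_le _)); first by rewrite divr_gt0 ?exprn_gt0// mulr_gt0.
rewrite le_eqVlt; apply/orP; left; apply/eqP; rewrite /v; field.
by rewrite !gt_eqF.
Qed.

End tends0.

Section wiener_lists.
Context {R : realType} {r : nat}.
Implicit Types (L : seq (R * R * ('I_r -> R))).
Local Notation mu := (@lebesgue_measure R).

(** Restrictions of an integrand to the times after and before [s]: clamping the
    ends leaves degenerate intervals, which contribute nothing. *)
Definition list_after (s : R) L := [seq ((Num.max x.1.1 s, Num.max x.1.2 s), x.2) | x <- L].
Definition list_before (s : R) L := [seq ((Num.min x.1.1 s, Num.min x.1.2 s), x.2) | x <- L].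
Definition list_opp L := [seq (x.1, fun j => - x.2 j) | x <- L].

Lemma list_sum_split s L phi :
  list_sum L phi = list_sum (list_before s L) phi + list_sum (list_after s L) phi.
Proof.
rewrite /list_sum /list_before /list_after !big_map -big_split/=.
apply: eq_bigr => x _; rewrite -big_split/=; apply: eq_bigr => j _.
by case: leP => _; case: leP => _; ring.
Qed.

Lemma list_sum_cat L L' (phi : 'I_r -> R -> R) :
  list_sum (L ++ L') phi = list_sum L phi + list_sum L' phi.
Proof. by rewrite /list_sum big_cat. Qed.

Lemma list_sum_opp L (phi : 'I_r -> R -> R) :
  list_sum (list_opp L) phi = - list_sum L phi.
Proof.
rewrite /list_sum big_map -sumrN; apply: eq_bigr => x _; rewrite -sumrN.
by apply: eq_bigr => j _; rewrite mulNr.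
Qed.

Lemma list_fun_after s L j x : s < x -> list_fun (list_after s L) j x = list_fun L j x.
Proof.
move=> sx; rewrite /list_fun /list_sum big_map; apply: eq_bigr => y _.
by apply: eq_bigr => j' _ /=; rewrite !le_max [x <= s]leNgt sx !orbF.
Qed.

Lemma list_fun_before s L j x : x <= s -> list_fun (list_before s L) j x = list_fun L j x.
Proof.
move=> xs; rewrite /list_fun /list_sum big_map; apply: eq_bigr => y _.
by apply: eq_bigr => j' _ /=; rewrite !le_min xs !andbT.
Qed.

Lemma measurable_list_fun L j D : measurable_fun D (list_fun L j).
Proof.
apply: (@measurable_funS _ _ _ _ setT) => //.
have mle (u : R) : measurable_fun setT (fun x : R => ((x <= u)%R%:R : R)).
  have -> : (fun x : R => ((x <= u)%R%:R : R)) = \1_(`]-oo, u]%classic).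
    by apply/funext => x; rewrite indicE mem_setE in_itv.
  exact: measurable_indic.
apply: measurable_sum => x; apply: measurable_sum => j'.
by apply: measurable_funM => //; apply: measurable_funB; case: eqP => _ //.
Qed.

Definition subdiv_list (k : nat) (p : nat -> R) (a : nat -> 'I_r -> R) :=
  [seq ((p l, p l.+1), a l) | l <- index_iota 0 k].

Lemma list_sum_subdiv k p a phi :
  list_sum (subdiv_list k p a) phi =
  \sum_(l < k) \sum_j a l j * (phi j (p l.+1) - phi j (p l)).
Proof.
by rewrite /list_sum big_map big_mkord.
Qed.

End wiener_lists.

Lemma frobenius_sqr {R : realType} {m n : nat} (A : 'M[R]_(m, n)) :
  frobenius A ^+ 2 = \sum_i \sum_j A i j ^+ 2.
Proof.
by rewrite sqr_sqrtr//; apply: sumr_ge0 => i _; apply: sumr_ge0 => j _; exact: sqr_ge0.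
Qed.

Lemma within_coord {R : realType} {m n : nat} (D : set R) (f : R -> 'M[R]_(m, n)) i j :
  {within D, continuous f} -> {within D, continuous (fun x => f x i j)}.
Proof.
move=> cf x; apply: (@continuous_comp _ _ _ (f : subspace D -> 'M[R]_(m, n)) (fun M : 'M[R]_(m, n) => M i j)).
  exact: cf.
exact: coord_continuous.
Qed.

Lemma measurable_coord {R : realType} {m n : nat} (D E : set R) (f : R -> 'M[R]_(m, n)) i j :
  measurable D -> {within D, continuous f} -> E `<=` D -> measurable_fun E (fun x => f x i j).
Proof.
move=> mD cf ED; apply: (measurable_funS mD ED).
by apply: subspace_continuous_measurable_fun => //; exact: within_coord.
Qed.

(** From [(a + b) ^ 2 <= 2 a ^ 2 + 2 b ^ 2]. *)
Lemma le_integral_sumsq {R : realType} {I : finType} (D : set R) (f g k : I -> R -> R) :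
  measurable D ->
  (forall j, measurable_fun D (f j)) -> (forall j, measurable_fun D (g j)) ->
  (forall j, measurable_fun D (k j)) ->
  (forall j x, D x -> f j x = g j x + k j x) ->
  (\int[lebesgue_measure]_(x in D) (\sum_j f j x ^+ 2)%:E <=
   2%:E * \int[lebesgue_measure]_(x in D) (\sum_j g j x ^+ 2)%:E +
   2%:E * \int[lebesgue_measure]_(x in D) (\sum_j k j x ^+ 2)%:E)%E.
Proof.
move=> mD mf mg mk fgk.
have mS (h : I -> R -> R) : (forall j, measurable_fun D (h j)) ->
    measurable_fun D (fun x => (\sum_j h j x ^+ 2)%:E).
  by move=> mh; apply/measurable_EFinP; apply: measurable_sum => j; exact: measurable_funX.
have S0 (h : I -> R -> R) x : 0 <= \sum_j h j x ^+ 2.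
  by apply: sumr_ge0 => j _; exact: sqr_ge0.
rewrite -!ge0_integralZl_EFin//; try (by apply: mS); try (by move=> x _; rewrite lee_fin).
rewrite -ge0_integralD//; last 4 first.
- by move=> x _; rewrite -EFinM lee_fin mulr_ge0.
- by apply: measurable_funeM; exact: mS.
- by move=> x _; rewrite -EFinM lee_fin mulr_ge0.
- by apply: measurable_funeM; exact: mS.
apply: ge0_le_integral => //.
- by move=> x _; rewrite lee_fin.
- exact: mS.
- by apply: emeasurable_funD; apply: measurable_funeM; exact: mS.
move=> x Dx; rewrite -!EFinM -EFinD lee_fin !mulr_sumr -big_split/=.
apply: ler_sum => j _; rewrite fgk//.
have := sqr_ge0 (g j x - k j x); lra.
Qed.

Section wiener.
Context {R : realType} {dis : measure_display} {Omega : measurableType dis}.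
Variable P : probability Omega R.
Variables (d r : nat) (F : R -> set (set Omega)) (B : R -> Omega -> 'cV[R]_r).
Hypothesis F_filtration : filtration F.
Hypothesis B_brownian : brownian_motion P F B.
Variable sigma : R -> 'M[R]_(d, r).
Hypothesis sigma_cont : {within halfline, continuous sigma}.
Local Notation mu := (@lebesgue_measure R).

Let msigma (D : set R) i j : D `<=` halfline -> measurable_fun D (fun x => sigma x i j).
Proof. by move=> Dh; apply: (measurable_coord _ _ _ sigma_cont) => //; exact: measurable_itv. Qed.

Let path w j u := B u w j ord0.

Let oc_half (a b : R) : 0 <= a -> `]a, b]%classic `<=` (halfline : set R).
Proof. by move=> a0 x; rewrite /halfline /= !in_itv/= andbT => /andP[/ltW h _]; exact: le_trans h. Qed.

(** What is kept of the definition of the stochastic integral: each coordinate is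
    a limit in probability of integrals of lists, whose integrands converge to a
    row of [sigma] in square mean. *)
Lemma wiener_row t I i : 0 <= t -> is_wiener_integral P B t sigma I ->
  exists L : nat -> seq (R * R * ('I_r -> R)),
  [/\ forall N x, x \in map fst (L N) -> 0 <= x.1 /\ x.1 <= x.2 /\ x.2 <= t,
      tends0 P (fun N w => I w i ord0 - list_sum (L N) (path w)) &
      (\int[mu]_(x in `]0%R, t])
        (\sum_j (list_fun (L N) j x - sigma x i j) ^+ 2)%:E)%E @[N --> \oo] --> 0%E].
Proof.
move=> t0 [mI [k [p [c [sub fcv Icv]]]]].
pose L N := subdiv_list (k N) (p N) (fun l j => c N l i j).
have pb N l : (l <= k N)%N -> 0 <= p N l <= t.
  have [p0 pt ph] := sub N; move=> lk.
  by rewrite -{1}p0 -pt !(grid_mono ph).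
have LE N w : list_sum (L N) (path w) = step_integral B (k N) (p N) (c N) w i ord0.
  rewrite list_sum_subdiv /step_integral summxE; apply: eq_bigr => l _.
  by rewrite mxE; apply: eq_bigr => j _; rewrite !mxE.
have mstep N i' : measurable_fun setT (fun w => step_integral B (k N) (p N) (c N) w i' ord0).
  have -> : (fun w => step_integral B (k N) (p N) (c N) w i' ord0) =
     (fun w => \sum_(l < k N) \sum_j c N l i' j * (B (p N l.+1) w j ord0 - B (p N l) w j ord0)).
    apply/funext => w; rewrite /step_integral summxE; apply: eq_bigr => l _.
    by rewrite mxE; apply: eq_bigr => j _; rewrite !mxE.
  apply: measurable_sum => l; apply: measurable_sum => j; apply: measurable_funM => //.
  have /andP[h1 _] := pb N l (ltnW (ltn_ord l)); have /andP[h2 _] := pb N l.+1 (ltn_ord l).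
  by apply: measurable_funB; exact: (brownian_measurable F_filtration B_brownian).
exists L; split.
- move=> N x; rewrite /L /subdiv_list -map_comp => /mapP[l]; rewrite mem_index_iota /= => lk ->/=.
  have /andP[h1 _] := pb N l (ltnW lk); have /andP[_ h2] := pb N l.+1 lk.
  by have [_ _ ph] := sub N; split=> //; split=> //; exact: ph.
- apply: (@tends0_L2 _ _ _ _ _
    (fun N w => frobenius (step_integral B (k N) (p N) (c N) w - I w) ^+ 2)) => //.
  + by move=> N; apply: measurable_funB => //; under eq_fun do rewrite LE; exact: mstep.
  + move=> N; under eq_fun do rewrite frobenius_sqr.
    apply: measurable_sum => i'; apply: measurable_sum => j; apply: measurable_funX.
    under eq_fun do rewrite !mxE.
    by apply: measurable_funB; rewrite (ord1 j).
  + move=> N w; rewrite LE frobenius_sqr (bigD1 i)//= big_ord1.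
    rewrite !mxE -sqrrN opprB lerDl.
    by apply: sumr_ge0 => i' _; apply: sumr_ge0 => j _; exact: sqr_ge0.
apply: (@squeeze_cvge _ _ _ _ (cst 0%E) _ (fun N =>
  \int[lebesgue_measure]_(s in `[0%R, t])
           (frobenius (step_fun (k N) (p N) (c N) s - sigma s) ^+ 2)%:E)%E) => //; last exact: cvg_cst.
have fE N i' j x : step_fun (k N) (p N) (c N) x i' j =
   list_fun (subdiv_list (k N) (p N) (fun l j => c N l i' j)) j x.
  rewrite /list_fun list_sum_subdiv /step_fun summxE; apply: eq_bigr => l _.
  rewrite mxE indic_itv_oc mulrC (bigD1 j)//= eqxx big1 ?addr0; last first.
    by move=> j' /negbTE->; rewrite subrr mulr0.
  by have [_ _ ph] := sub N; rewrite -indic_itv_ocB// ph.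
apply: nearW => N; apply/andP; split.
  by apply: integral_ge0 => x _; rewrite lee_fin sumr_ge0// => j _; exact: sqr_ge0.
have mfr : measurable_fun `[0, t] (fun x => (frobenius (step_fun (k N) (p N) (c N) x - sigma x) ^+ 2)%:E).
  apply/measurable_EFinP; apply: (eq_measurable_fun (fun x => \sum_i' \sum_j
      (list_fun (subdiv_list (k N) (p N) (fun l j => c N l i' j)) j x - sigma x i' j) ^+ 2)).
    move=> x _; rewrite frobenius_sqr; apply: eq_bigr => i' _.
    by apply: eq_bigr => j _; rewrite !mxE fE.
  apply: measurable_sum => i'; apply: measurable_sum => j; apply: measurable_funX.
  apply: measurable_funB; first exact: measurable_list_fun.
  by apply: msigma => x; rewrite /halfline /= !in_itv/= andbT => /andP[].
apply: (@le_trans _ _ (\int[mu]_(x in `]0%R, t])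
   (frobenius (step_fun (k N) (p N) (c N) x - sigma x) ^+ 2)%:E)%E).
  apply: ge0_le_integral => //.
  - by move=> x _; rewrite lee_fin sumr_ge0// => j _; exact: sqr_ge0.
  - apply/measurable_EFinP; apply: measurable_sum => j; apply: measurable_funX.
    apply: measurable_funB; first exact: measurable_list_fun.
    by apply: msigma; exact: oc_half.
  - apply: measurable_funS mfr => //; exact: subset_itv_oc_cc.
  move=> x _; rewrite lee_fin frobenius_sqr (bigD1 i)//=.
  under [X in _ <= X + _]eq_bigr do rewrite !mxE fE.
  by rewrite lerDl sumr_ge0// => i' _; apply: sumr_ge0 => j _; exact: sqr_ge0.
apply: ge0_subset_integral => //.
- by move=> x _; rewrite lee_fin sqr_ge0.
- exact: subset_itv_oc_cc.
Qed.

End wiener.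

Section wiener_tails.
Context {R : realType} {dis : measure_display} {Omega : measurableType dis}.
Variable P : probability Omega R.
Variables (d r : nat) (F : R -> set (set Omega)) (B : R -> Omega -> 'cV[R]_r).
Hypothesis F_filtration : filtration F.
Hypothesis B_brownian : brownian_motion P F B.
Variable sigma : R -> 'M[R]_(d, r).
Hypothesis sigma_cont : {within halfline, continuous sigma}.
Local Notation mu := (@lebesgue_measure R).
Local Notation path w := (fun j u => B u w j ord0).

Let oc_half (a b : R) : 0 <= a -> `]a, b]%classic `<=` (halfline : set R).
Proof. by move=> a0 x; rewrite /halfline /= !in_itv/= andbT => /andP[/ltW h _]; exact: le_trans h. Qed.

Let msigma (D : set R) i j : D `<=` halfline -> measurable_fun D (fun x => sigma x i j).
Proof. by move=> Dh; apply: (measurable_coord _ _ _ sigma_cont) => //; exact: measurable_itv. Qed.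

(** The increments over [s, t] of two stochastic integrals are approximated in
    probability by list integrals living on [s, t].  The approximation of the
    integral up to [t] need not restrict to that of the integral up to [s]; by
    the isometry the discrepancy on [0, s] is negligible. *)
Lemma wiener_increment_approx (s t v : R) Is It i E : 0 <= s -> s <= t ->
  is_wiener_integral P B s sigma Is -> is_wiener_integral P B t sigma It ->
  (\int[mu]_(x in `]s, t]) (\sum_j sigma x i j ^+ 2)%:E = v%:E)%E -> F s E ->
  exists (S : nat -> Omega -> R) (V : nat -> R),
  [/\ forall N, 0 <= V N, forall N, measurable_fun setT (S N),
    forall N lam,
      (\int[P]_w ((\1_E w * expR (lam * S N w))%R)%:E =
       (expR (lam ^+ 2 * V N / 2))%:E * P E)%E,
    tends0 P (fun N w => It w i ord0 - Is w i ord0 - S N w) &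
    forall e, 0 < e -> \forall N \near \oo, V N <= 2 * v + e /\ v <= 2 * V N + e].
Proof.
move=> s0 st Ws Wt vE FE; have t0 := le_trans s0 st.
have [Ls [hs ps cs]] := wiener_row F_filtration B_brownian sigma_cont i s0 Ws.
have [Lt [ht pt ct]] := wiener_row F_filtration B_brownian sigma_cont i t0 Wt.
(* [L1] lives on [s, t]; [L2] is the discrepancy of the two approximations on
   [0, s]. *)
pose L1 N := list_after s (Lt N).
pose L2 N := list_before s (Lt N) ++ list_opp (Ls N).
have h1 N x : x \in map fst (L1 N) -> s <= x.1 /\ x.1 <= x.2 /\ x.2 <= t.
  rewrite -map_comp => /mapP[y yL ->] /=.
  have [_ [h12 h2t]] := ht N y.1 (map_f _ yL).
  split; first by rewrite le_max lexx orbT.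
  split; first by rewrite ge_max !le_max h12 lexx !orbT.
  by rewrite ge_max h2t st.
have h2 N x : x \in map fst (L2 N) -> 0 <= x.1 /\ x.1 <= x.2 /\ x.2 <= s.
  rewrite map_cat mem_cat => /orP[|].
    rewrite -map_comp => /mapP[y yL ->] /=.
    have [h01 [h12 h2t]] := ht N y.1 (map_f _ yL).
    split; first by rewrite le_min h01 s0.
    split; last by rewrite ge_min lexx orbT.
    by rewrite le_min !ge_min h12 lexx !orbT.
  by rewrite -map_comp => /mapP[y yL ->] /=; exact: (hs N y.1 (map_f _ yL)).
have G1 N := list_mgf F_filtration B_brownian s0 st FE (h1 N).
have sF0 : sigma_algebra setT (F 0) by case: F_filtration => h _ _; exact: h.
have F0T : F 0 setT.
  by rewrite -[setT]setC0 -setTD; case: sF0 => e c _; apply: c.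
have G2 N := list_mgf F_filtration B_brownian (lexx 0) s0 F0T (h2 N).
pose S N w := list_sum (L1 N) (path w).
pose V N := projT1 (cid2 (G1 N).2).
pose V2 N := projT1 (cid2 (G2 N).2).
have V0 N : 0 <= V N by rewrite /V; case: cid2.
have V20 N : 0 <= V2 N by rewrite /V2; case: cid2.
have VE N : (\int[mu]_(x in `]s, t]) (\sum_j (list_fun (L1 N) j x) ^+ 2)%:E = (V N)%:E)%E.
  by rewrite /V; case: cid2 => ? ? [].
have V2E N : (\int[mu]_(x in `]0%R, s]) (\sum_j (list_fun (L2 N) j x) ^+ 2)%:E = (V2 N)%:E)%E.
  by rewrite /V2; case: cid2 => ? ? [].
have mgf N lam : (\int[P]_w ((\1_E w * expR (lam * S N w))%R)%:E =
       (expR (lam ^+ 2 * V N / 2))%:E * P E)%E.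
  by rewrite /V; case: cid2 => ? ? [].
have mgf2 N lam : (\int[P]_w ((\1_(setT : set Omega) w * expR (lam * list_sum (L2 N) (path w)))%R)%:E =
       (expR (lam ^+ 2 * V2 N / 2))%:E * P setT)%E.
  by rewrite /V2; case: cid2 => ? ? [].
have mLf (L : seq (R * R * ('I_r -> R))) j (D : set R) : measurable_fun D (list_fun L j).
  exact: measurable_list_fun.
have mdiff (L : seq (R * R * ('I_r -> R))) (D : set R) j : D `<=` halfline ->
    measurable_fun D (fun x => list_fun L j x - sigma x i j).
  by move=> Dh; apply: measurable_funB; [exact: mLf|exact: msigma].
have small (a b : R) (L : nat -> seq (R * R * ('I_r -> R))) (a' b' : R) :
    0 <= a -> `]a', b']%classic `<=` `]a, b]%classic ->
    (\int[mu]_(x in `]a, b]) (\sum_j (list_fun (L N) j x - sigma x i j) ^+ 2)%:E)%E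
       @[N --> \oo] --> 0%E ->
    forall e, 0 < e -> \forall N \near \oo,
    (\int[mu]_(x in `]a', b']) (\sum_j (list_fun (L N) j x - sigma x i j) ^+ 2)%:E <= e%:E)%E.
  move=> a0 ab h e e0; apply: filterS (cvge0_lt h e0) => N /ltW hh; apply: le_trans hh.
  apply: ge0_subset_integral => //.
  - apply/measurable_EFinP; apply: measurable_sum => j; apply: measurable_funX.
    by apply: mdiff; exact: oc_half.
  - by move=> x _; rewrite lee_fin; apply: sumr_ge0 => j _; exact: sqr_ge0.
have sub1 : `]s, t]%classic `<=` `]0, t]%classic.
  by move=> x /=; rewrite !in_itv/= => /andP[h ->]; rewrite (le_lt_trans s0 h).
have sub2 : `]0, s]%classic `<=` `]0, t]%classic.
  by move=> x /=; rewrite !in_itv/= => /andP[-> h]; rewrite (le_trans h st).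
have e1 := small 0 t Lt s t (lexx _) sub1 ct.
have e2 := small 0 t Lt 0 s (lexx _) sub2 ct.
have e3 := small 0 s Ls 0 s (lexx _) (fun _ => id) cs.
have V2cvg : V2 N @[N --> \oo] --> 0.
  apply/cvgrPdist_le => e e0; have e40 : 0 < e / 4 by rewrite divr_gt0.
  apply: filterS (filterI (e2 _ e40) (e3 _ e40)) => N [h h'].
  rewrite sub0r normrN ger0_norm// -lee_fin -V2E.
  apply: le_trans (le_integral_sumsq
    (g := fun j x => list_fun (Lt N) j x - sigma x i j)
    (k := fun j x => sigma x i j - list_fun (Ls N) j x) _ _ _ _ _) _ => //.
  - by move=> j; apply: mdiff; exact: oc_half.
  - by move=> j; apply: measurable_funB; [apply: msigma; exact: oc_half|exact: mLf].
  - move=> j x /=; rewrite in_itv/= => /andP[_ xs].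
    have -> : list_fun (L2 N) j x =
        list_fun (list_before s (Lt N)) j x - list_fun (Ls N) j x.
      by rewrite /list_fun list_sum_cat list_sum_opp.
    by rewrite list_fun_before//; ring.
  rewrite [in X in (_ + 2%:E * X)%E](_ :
    (fun x => (\sum_j (sigma x i j - list_fun (Ls N) j x) ^+ 2)%:E) =
    (fun x => (\sum_j (list_fun (Ls N) j x - sigma x i j) ^+ 2)%:E)); last first.
    by apply/funext => x; congr EFin; apply: eq_bigr => j _; rewrite -sqrrN opprB.
  apply: (@le_trans _ _ (2%:E * (e / 4)%:E + 2%:E * (e / 4)%:E)%E).
    by apply: leeD; apply: lee_wpmul2l.
  by rewrite -!EFinM -EFinD lee_fin; lra.
exists S, V; split=> //.
- by move=> N; exact: (G1 N).1.
- have q1 := tends0D pt (tends0N ps).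
  have q2 := tends0_gauss (fun N => (G2 N).1) V20 mgf2 V2cvg.
  apply: tends0_ext (tends0D q1 q2) => N w.
  rewrite /S /L1 /L2 list_sum_cat list_sum_opp (list_sum_split s (Lt N)); ring.
move=> e e0; have e20 : 0 < e / 2 by rewrite divr_gt0.
apply: filterS (e1 _ e20) => N h; split.
  rewrite -lee_fin -VE.
  apply: le_trans (le_integral_sumsq
    (g := fun j x => sigma x i j)
    (k := fun j x => list_fun (Lt N) j x - sigma x i j) _ _ _ _ _) _ => //.
  - by move=> j; apply: msigma; exact: oc_half.
  - by move=> j; apply: mdiff; exact: oc_half.
  - move=> j x /=; rewrite in_itv/= => /andP[sx _].
    by rewrite list_fun_after//; ring.
  rewrite vE; apply: (@le_trans _ _ (2%:E * v%:E + 2%:E * (e / 2)%:E)%E).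
    by rewrite leeD2l// lee_wpmul2l.
  by rewrite -!EFinM -EFinD lee_fin; lra.
rewrite -lee_fin -vE.
apply: le_trans (le_integral_sumsq
    (g := fun j x => list_fun (L1 N) j x)
    (k := fun j x => sigma x i j - list_fun (Lt N) j x) _ _ _ _ _) _ => //.
- by move=> j; apply: msigma; exact: oc_half.
- by move=> j; apply: measurable_funB; [apply: msigma; exact: oc_half|exact: mLf].
- move=> j x /=; rewrite in_itv/= => /andP[sx _].
  by rewrite list_fun_after//; ring.
rewrite VE.
rewrite [in X in (_ + 2%:E * X)%E](_ :
    (fun x => (\sum_j (sigma x i j - list_fun (Lt N) j x) ^+ 2)%:E) =
    (fun x => (\sum_j (list_fun (Lt N) j x - sigma x i j) ^+ 2)%:E)); last first.
  by apply/funext => x; congr EFin; apply: eq_bigr => j _; rewrite -sqrrN opprB.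
apply: (@le_trans _ _ (2%:E * (V N)%:E + 2%:E * (e / 2)%:E)%E).
  by rewrite leeD2l// lee_wpmul2l.
by rewrite -!EFinM -EFinD lee_fin; lra.
Qed.

(** The tail of a list integral with variance at most [v'] survives the limit in
    probability at the price of halving [x]; the strict inequality [2 * v < v']
    absorbs the error in the variances. *)
Lemma wiener_upper_tail (s t v : R) Is It i E : 0 <= s -> s <= t ->
  is_wiener_integral P B s sigma Is -> is_wiener_integral P B t sigma It ->
  (\int[mu]_(x in `]s, t]) (\sum_j sigma x i j ^+ 2)%:E = v%:E)%E -> F s E ->
  forall x v', 0 < x -> 0 <= v -> 2 * v < v' ->
  (P (E `&` [set w | (x < `|It w i ord0 - Is w i ord0|)%R]) <=
   (2 * expR (- (x ^+ 2 / (8 * v'))))%:E * P E)%E.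
Proof.
move=> s0 st Ws Wt vE FE x v' x0 v0 vv'.
have [S [V [V0 mS mgf apx Vv]]] := wiener_increment_approx s0 st Ws Wt vE FE.
have mE := filtration_measurable F_filtration s0 FE.
have v'0 : 0 < v' by lra.
have x20 : 0 < x / 2 by rewrite divr_gt0.
have mD : measurable_fun setT (fun w => It w i ord0 - Is w i ord0).
  by apply: measurable_funB; [exact: Wt.1|exact: Ws.1].
apply/lee_addgt0Pr => del del0.
have [N [hV hP]] : exists N, V N <= v' /\
    (P [set w | (x / 2 < `|It w i ord0 - Is w i ord0 - S N w|)%R] <= del%:E)%E.
  have e0 : 0 < v' - 2 * v by lra.
  have [N [[h _] h']] := filter_ex (filterI (Vv _ e0) (apx.2 _ _ x20 del0)).
  exists N; split=> //.
  by lra.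
have tail := abs_tail mE (mS N) (V0 N) (mgf N) x20 v'0 hV.
have eq8 : x ^+ 2 / (8 * v') = (x / 2) ^+ 2 / (2 * v') by field; rewrite gt_eqF.
rewrite eq8; apply: (@le_trans _ _ (P ((E `&` [set w | (x / 2 < `|S N w|)%R]) `|`
   [set w | (x / 2 < `|It w i ord0 - Is w i ord0 - S N w|)%R]))).
  apply: le_measure; rewrite ?inE.
  - by apply: measurableI => //; exact: measurable_abs_gt.
  - apply: measurableU; first by apply: measurableI => //; exact: measurable_abs_gt.
    by apply: measurable_abs_gt; exact: measurable_funB.
  move=> w /= [Ew h]; have [a|a] := ltP (x / 2) `|S N w|; first by left.
  right; have := ler_normD (It w i ord0 - Is w i ord0 - S N w) (S N w).
  by rewrite subrK; lra.
apply: (le_trans (measureU2 _ _ _)).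
- by apply: measurableI => //; exact: measurable_abs_gt.
- by apply: measurable_abs_gt; exact: measurable_funB.
exact: leeD.
Qed.

(** As for the upper tail: the variances of the approximations eventually lie
    between [v / 4] and [3 v], and an approximation exceeding [x] leaves [x / 2]
    for the limit. *)
Lemma wiener_lower_tail (s t v : R) Is It i E : 0 <= s -> s <= t ->
  is_wiener_integral P B s sigma Is -> is_wiener_integral P B t sigma It ->
  (\int[mu]_(x in `]s, t]) (\sum_j sigma x i j ^+ 2)%:E = v%:E)%E -> F s E ->
  forall x, 0 < x -> 0 < v -> 3 * v <= 4 * x ^+ 2 ->
  ((expR (- (64 * x ^+ 2 / v)) / 4)%:E * P E <=
   P (E `&` [set w | (x / 2 < It w i ord0 - Is w i ord0)%R]))%E.
Proof.
move=> s0 st Ws Wt vE FE x x0 v0 vx.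
have [S [V [V0 mS mgf apx Vv]]] := wiener_increment_approx s0 st Ws Wt vE FE.
have mE := filtration_measurable F_filtration s0 FE.
have x20 : 0 < x / 2 by rewrite divr_gt0.
have mD : measurable_fun setT (fun w => It w i ord0 - Is w i ord0).
  by apply: measurable_funB; [exact: Wt.1|exact: Ws.1].
apply/lee_addgt0Pr => del del0.
have [N [hV1 hV2 hP]] : exists N, [/\ V N <= 3 * v, v <= 4 * V N &
    (P [set w | (x / 2 < `|It w i ord0 - Is w i ord0 - S N w|)%R] <= del%:E)%E].
  have e0 : 0 < v / 2 by rewrite divr_gt0.
  have [N [[h h2] h']] := filter_ex (filterI (Vv _ e0) (apx.2 _ _ x20 del0)).
  exists N; split=> //.
    by lra.
  by lra.
have V_gt0 : 0 < V N by lra.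
have tail := lower_tail mE (mS N) (mgf N) (V0 N) x0 V_gt0 (le_trans hV1 vx).
apply: (@le_trans _ _ ((expR (- (16 * x ^+ 2 / V N)) / 4)%:E * P E)%E).
  rewrite lee_wpmul2r// lee_fin ler_pM2r// ler_expR lerN2.
  have -> : 64 * x ^+ 2 / v = 16 * x ^+ 2 / (v / 4) by field; rewrite gt_eqF.
  apply: ler_wpM2l; first by rewrite mulr_ge0 ?sqr_ge0.
  rewrite lef_pV2 ?posrE ?divr_gt0//; lra.
apply: (le_trans tail).
apply: (@le_trans _ _ (P ((E `&` [set w | (x / 2 < It w i ord0 - Is w i ord0)%R]) `|`
   [set w | (x / 2 < `|It w i ord0 - Is w i ord0 - S N w|)%R]))).
  apply: le_measure; rewrite ?inE.
  - by apply: measurableI => //; exact: measurable_gt.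
  - apply: measurableU; first by apply: measurableI => //; exact: measurable_gt.
    by apply: measurable_abs_gt; exact: measurable_funB.
  move=> w /= [Ew h]; have [a|a] := ltP (x / 2) (It w i ord0 - Is w i ord0); first by left.
  right; have := ler_norm (- (It w i ord0 - Is w i ord0 - S N w)).
  by rewrite normrN; lra.
apply: (le_trans (measureU2 _ _ _)).
- by apply: measurableI => //; exact: measurable_gt.
- by apply: measurable_abs_gt; exact: measurable_funB.
exact: leeD.
Qed.

End wiener_tails.

(** * An adapted version of the stochastic integral *)

Section ae_tools.
Context {R : realType} {dis : measure_display} {Omega : measurableType dis}.
Variable P : probability Omega R.

Lemma borel_cantelli_ae (G : nat -> set Omega) :
  (forall n, measurable (G n)) -> (\sum_(n <oo) P (G n) < +oo)%E ->
  {ae P, forall w, exists n0, forall n, (n0 <= n)%N -> ~ G n w}.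
Proof.
move=> mG sG; have mL : measurable (lim_sup_set G).
  by apply: bigcap_measurable => // n _; apply: bigcup_measurable => k _.
exists (lim_sup_set G); split => //; first exact: lim_sup_set_cvg0.
move=> w /= h n _; apply: contrapT => h2; apply: h; exists n => k nk Gk.
by apply: h2; exists k.
Qed.

Lemma series_bounded_lty (u : nat -> \bar R) (C : R) :
  (forall n, 0 <= u n)%E -> (forall n, (\sum_(0 <= k < n) u k <= C%:E)%E) ->
  (\sum_(n <oo) u n < +oo)%E.
Proof.
move=> u0 h; apply: (@le_lt_trans _ _ C%:E); last by rewrite ltry.
by apply: lime_le; [exact: is_cvg_nneseries|exact: nearW].
Qed.

Lemma sum_half_le (n : nat) : \sum_(0 <= k < n) (2^-1 : R) ^+ k <= 2.
Proof.
suff -> : \sum_(0 <= k < n) (2^-1 : R) ^+ k = 2 - 2 * 2^-1 ^+ n.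
  have h : 0 <= (2^-1 : R) ^+ n by rewrite exprn_ge0.
  lra.
elim: n => [|n IH]; first by rewrite big_geq// expr0; lra.
by rewrite big_nat_recr//= IH exprS; lra.
Qed.

(** A limit in probability of functions measurable for a sub-sigma-algebra has
    a version measurable for it: a subsequence converges almost surely. *)
Lemma tends0_version (G : set (set Omega)) (I : Omega -> R) (Z : nat -> Omega -> R) :
  sigma_algebra setT G -> (forall N, measurable_in G (Z N)) ->
  tends0 P (fun N w => I w - Z N w) ->
  exists2 Y : Omega -> R, measurable_in G Y & {ae P, forall w, Y w = I w}.
Proof.
move=> sG mZ [mIZ cvZ].
pose eta k : R := k.+1%:R^-1.
have eta0 k : 0 < eta k by rewrite invr_gt0 ltr0n.
have half0 k : 0 < (2^-1 : R) ^+ k by rewrite exprn_gt0.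
have ex k : exists N, (P [set w | (eta k < `|I w - Z N w|)%R] <= (2^-1 ^+ k)%:E)%E.
  exact: (filter_ex (cvZ _ _ (eta0 k) (half0 k))).
pose nn k := projT1 (cid (ex k)).
have nnP k : (P [set w | (eta k < `|I w - Z (nn k) w|)%R] <= (2^-1 ^+ k)%:E)%E.
  by rewrite /nn; case: cid.
have mA k : measurable [set w | (eta k < `|I w - Z (nn k) w|)%R].
  exact: measurable_abs_gt.
exists (fun w => fine (limn_esup (fun k => (Z (nn k) w)%:E))).
  apply/(measurable_inP _ sG).
  apply: (measurableT_comp (@fine_measurable R setT measurableT)).
  apply: measurable_fun_limn_esup => k; apply/measurable_EFinP.
  by apply/(measurable_inP _ sG).
have fin : (\sum_(n <oo) P [set w | (eta n < `|I w - Z (nn n) w|)%R] < +oo)%E.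
  apply: (@series_bounded_lty _ 2) => // n.
  apply: (@le_trans _ _ (\sum_(0 <= k < n) (2^-1 ^+ k)%:E)%E); first exact: lee_sum.
  by rewrite sumEFin lee_fin sum_half_le.
apply: filterS (borel_cantelli_ae mA fin) => w [n0 hn0].
have cv : (Z (nn k) w)%:E @[k --> \oo] --> (I w)%:E.
  apply/fine_cvgP; split; first exact: nearW.
  apply/cvgrPdist_le => e e0; near=> k => /=.
  have : ~ (eta k < `|I w - Z (nn k) w|).
    by apply: hn0; near: k; exists n0.
  move/negP; rewrite -leNgt => h; apply: (le_trans h).
  apply: ltW; near: k; exact: (near_infty_natSinv_lt (PosNum e0)).
by rewrite limn_esup_lim (cvg_lim _ (cvg_esups cv)).
Unshelve. all: by end_near. Qed.
End ae_tools.

Section rowvar.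
Context {R : realType} {d r : nat}.
Variable sigma : R -> 'M[R]_(d, r).
Hypothesis sigma_cont : {within halfline, continuous sigma}.
Local Notation mu := (@lebesgue_measure R).

Definition rowsq i x : R := \sum_j sigma x i j ^+ 2.

(** The variance that the [i]-th coordinate of the stochastic integral gains over
    [s, t]. *)
Definition rowvar i s t : R := \int[mu]_(x in `]s, t]) rowsq i x.

Lemma rowsq_ge0 i x : 0 <= rowsq i x.
Proof. by apply: sumr_ge0 => j _; exact: sqr_ge0. Qed.

Lemma within_rowsq i : {within (halfline : set R), continuous (rowsq i)}.
Proof.
move=> x; rewrite /rowsq; apply: cvg_big => [|j _]; first exact: add_continuous.
have h := within_coord (i := i) (j := j) sigma_cont.
by apply: (@cvgM R _ (nbhs x) _ (fun y : subspace halfline => sigma y i j)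
  (fun y : subspace halfline => sigma y i j)); exact: h.
Qed.

Let cc_half (s t : R) : 0 <= s -> `[s, t]%classic `<=` (halfline : set R).
Proof. by move=> s0 x; rewrite /halfline /= !in_itv/= andbT => /andP[h _]; exact: le_trans h. Qed.

Lemma rowsq_integrable_cc i s t : 0 <= s -> mu.-integrable `[s, t] (EFin \o rowsq i).
Proof.
move=> s0; apply: continuous_compact_integrable; first exact: segment_compact.
exact: (continuous_subspaceW (@cc_half s t s0) (@within_rowsq i)).
Qed.

Lemma rowsq_integrable_oc i s t : 0 <= s -> mu.-integrable `]s, t] (EFin \o rowsq i).
Proof.
move=> s0; apply: integrableS (rowsq_integrable_cc i t s0) => //.
exact: subset_itv_oc_cc.
Qed.

Lemma rowvarE i s t : 0 <= s ->
  (\int[mu]_(x in `]s, t]) (rowsq i x)%:E = (rowvar i s t)%:E)%E.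
Proof.
by move=> s0; rewrite fineK//; apply: integrable_fin_num => //; exact: rowsq_integrable_oc.
Qed.

Lemma rowvar_ge0 i s t : 0 <= rowvar i s t.
Proof. by apply: Rintegral_ge0 => x _; exact: rowsq_ge0. Qed.

Lemma le_rowvar i a b s t : 0 <= a -> a <= s -> t <= b -> rowvar i s t <= rowvar i a b.
Proof.
move=> a0 as_ tb; have s0 := le_trans a0 as_.
rewrite -lee_fin -!rowvarE//; apply: ge0_subset_integral => //.
- by have /integrableP[] := rowsq_integrable_oc i b a0.
- by move=> x _; rewrite lee_fin rowsq_ge0.
- move=> x /=; rewrite !in_itv/= => /andP[h1 h2].
  by rewrite (le_lt_trans as_ h1) (le_trans h2 tb).
Qed.

Lemma block_varianceE h n : 0 <= h ->
  block_variance h sigma n = \sum_i rowvar i (n%:R * h) (n.+1%:R * h).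
Proof.
move=> h0; have nh0 : 0 <= n%:R * h by rewrite mulr_ge0.
have mI i : measurable_fun `]n%:R * h, n.+1%:R * h] (rowsq i).
  by have /integrableP[/measurable_EFinP] := rowsq_integrable_oc i (n.+1%:R * h) nh0.
rewrite /block_variance -Rintegral_itv_obnd_cbnd; last first.
  apply: (@eq_integrable _ _ _ mu _ _ (fun x => (\sum_i (rowsq i x)%:E)%E)) => //.
    by move=> x _; rewrite /= frobenius_sqr sumEFin.
  by apply: integrable_sum => // i _; exact: rowsq_integrable_oc.
pose D : set R := `]n%:R * h, n.+1%:R * h]%classic.
have mD : measurable D by exact: measurable_itv.
transitivity (fine (\int[mu]_(x in D) (\sum_i (rowsq i x)%:E))%E).
  by congr fine; apply: eq_integral => x _; rewrite frobenius_sqr sumEFin.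
rewrite ge0_integral_sum//; last 2 first.
- by move=> i; apply/measurable_EFinP; exact: mI.
- by move=> i x _; rewrite lee_fin rowsq_ge0.
by under eq_bigr do rewrite rowvarE//; rewrite sumEFin.
Qed.

Lemma rowvar_le_block i h n : 0 <= h ->
  rowvar i (n%:R * h) (n.+1%:R * h) <= block_variance h sigma n.
Proof.
move=> h0; rewrite block_varianceE// (bigD1 i)//= lerDl.
by apply: sumr_ge0 => k _; exact: rowvar_ge0.
Qed.

Lemma block_le_rowvar h n : 0 <= h -> (0 < d)%N ->
  exists i, block_variance h sigma n / d%:R <= rowvar i (n%:R * h) (n.+1%:R * h).
Proof.
move=> h0 d0; apply: contrapT => nex.
have lt i : rowvar i (n%:R * h) (n.+1%:R * h) < block_variance h sigma n / d%:R.
  by rewrite ltNge; apply/negP => le; apply: nex; exists i.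
have : block_variance h sigma n < block_variance h sigma n; last by rewrite ltxx.
rewrite {1}block_varianceE//.
apply: (@lt_le_trans _ _ (\sum_(i < d) block_variance h sigma n / d%:R)).
  by apply: ltr_sum => //; apply/hasP; exists (Ordinal d0); rewrite ?mem_index_enum.
by rewrite sumr_const card_ord -[(_ / _) *+ d]mulr_natr divfK// pnatr_eq0 -lt0n.
Qed.

Lemma block_variance_ge0 h n : 0 <= block_variance h sigma n.
Proof. by apply: Rintegral_ge0 => x _; exact: sqr_ge0. Qed.

End rowvar.

Section adapted_version.
Context {R : realType} {dis : measure_display} {Omega : measurableType dis}.
Variable P : probability Omega R.

Lemma le_measure_ae (A A' : set Omega) : measurable A -> measurable A' ->
  {ae P, forall w, A w -> A' w} -> (P A <= P A')%E.
Proof.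
move=> mA mA' [Z [mZ Z0 AZ]].
apply: (@le_trans _ _ (P (A' `|` Z))).
  apply: le_measure; rewrite ?inE//; first exact: measurableU.
  move=> w Aw; have [A'w|nA'w] := pselect (A' w); first by left.
  by right; apply: AZ => /= h; apply: nA'w; exact: h.
apply: (le_trans (measureU2 _ _ _)) => //.
by rewrite [X in (_ + X)%E](_ : _ = 0%E) ?adde0//; exact: Z0.
Qed.

Variables (d r : nat) (F : R -> set (set Omega)) (B : R -> Omega -> 'cV[R]_r).
Hypothesis F_filtration : filtration F.
Hypothesis B_brownian : brownian_motion P F B.
Variable sigma : R -> 'M[R]_(d, r).
Hypothesis sigma_cont : {within halfline, continuous sigma}.

(** What the rest of the argument uses of the Gaussian process with independent
    increments [int_0^t sigma dB]: adaptedness, and two-sided tail bounds for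
    its increments that hold conditionally on the past. *)
Record increment_tails (V : 'I_d -> R -> R -> R) (N : R -> 'I_d -> Omega -> R) : Prop := {
  tails_adapted : forall t i, 0 <= t -> measurable_in (F t) (N t i) ;
  tails_upper : forall i s t E x v, 0 <= s -> s <= t -> F s E -> 0 < x ->
    2 * V i s t < v ->
    (P (E `&` [set w | (x < `|N t i w - N s i w|)%R]) <=
     (2 * expR (- (x ^+ 2 / (8 * v))))%:E * P E)%E ;
  tails_lower : forall i s t E x, 0 <= s -> s <= t -> F s E -> 0 < x ->
    0 < V i s t -> 3 * V i s t <= 4 * x ^+ 2 ->
    ((expR (- (64 * x ^+ 2 / V i s t)) / 4)%:E * P E <=
     P (E `&` [set w | (x / 2 < N t i w - N s i w)%R]))%E }.

(** The stochastic integral is only defined up to null sets, which need not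
    belong to the filtration; as a limit of adapted elementary integrals it has
    an adapted version, and the tail bounds do not see the change. *)
Lemma adapted_version (M : R -> Omega -> 'cV[R]_d) :
  (forall t, 0 <= t -> is_wiener_integral P B t sigma (M t)) ->
  exists2 N : R -> 'I_d -> Omega -> R, increment_tails (rowvar sigma) N &
    forall t i, 0 <= t -> {ae P, forall w, N t i w = M t w i ord0}.
Proof.
move=> WM.
have ex t i : exists Y : Omega -> R, 0 <= t -> measurable_in (F t) Y /\
    {ae P, forall w, Y w = M t w i ord0}.
  have [t0|_] := boolP (0 <= t); last by exists (cst 0).
  have [L [hL cL _]] := wiener_row F_filtration B_brownian sigma_cont i t0 (WM t t0).
  have sF : sigma_algebra setT (F t) by case: F_filtration => h _ _; exact: h.
  have [|Y mY aeY] := tends0_version sF _ cL; last by exists Y.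
  move=> n; apply/(measurable_inP _ sF); rewrite /list_sum.
  under eq_fun do rewrite big_seq big_mkcond.
  apply: measurable_sum => x; case: (boolP (x \in L n)) => [xL|_]; last exact: measurable_cst.
  have [h0 [h1 h2]] := hL n x.1 (map_f _ xL).
  apply: measurable_sum => j; apply: measurable_funM => //.
  by apply: measurable_funB; apply/(measurable_inP _ sF);
    apply: (measurable_in_brownian F_filtration B_brownian) => //;
    [exact: le_trans h1|exact: le_trans h2].
pose N t i := projT1 (cid (ex t i)).
have mN t i : 0 <= t -> measurable_in (F t) (N t i).
  by rewrite /N; case: cid => Y /= h /h[].
have aeN t i : 0 <= t -> {ae P, forall w, N t i w = M t w i ord0}.
  by rewrite /N; case: cid => Y /= h /h[].
exists N => //.
have mNf t i : 0 <= t -> measurable_fun setT (N t i).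
  by move=> t0; exact: (measurable_in_fun F_filtration t0 (mN t i t0)).
have mMf t i : 0 <= t -> measurable_fun setT (fun w => M t w i ord0).
  by move=> t0; exact: (WM t t0).1.
have FE s E : 0 <= s -> F s E -> measurable E by exact: filtration_measurable.
split=> // i s t E x.
  move=> v s0 st FsE x0 vv; have t0 := le_trans s0 st.
  apply: le_trans (wiener_upper_tail F_filtration B_brownian sigma_cont s0 st
    (WM s s0) (WM t t0) (rowvarE sigma_cont i t s0) FsE x0 (rowvar_ge0 _ _ _ _) vv).
  apply: le_measure_ae.
  - apply: measurableI; first exact: FE FsE.
    by apply: measurable_abs_gt; apply: measurable_funB; exact: mNf.
  - apply: measurableI; first exact: FE FsE.
    by apply: measurable_abs_gt; apply: measurable_funB; exact: mMf.
  by apply: filterS2 (aeN t i t0) (aeN s i s0) => w h1 h2 /=; rewrite h1 h2.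
move=> s0 st FsE x0 v0 vx; have t0 := le_trans s0 st.
apply: le_trans (wiener_lower_tail F_filtration B_brownian sigma_cont s0 st
    (WM s s0) (WM t t0) (rowvarE sigma_cont i t s0) FsE x0 v0 vx) _.
apply: le_measure_ae.
- apply: measurableI; first exact: FE FsE.
  by apply: measurable_gt; apply: measurable_funB; exact: mMf.
- apply: measurableI; first exact: FE FsE.
  by apply: measurable_gt; apply: measurable_funB; exact: mNf.
by apply: filterS2 (aeN t i t0) (aeN s i s0) => w h1 h2 /=; rewrite h1 h2.
Qed.

End adapted_version.

(** * Matrices of spectral radius less than one *)

Section contraction.
Context {R : realType}.

Lemma contraction_iter (q b : R) (u : nat -> R) (n0 : nat) : 0 <= q < 1 -> 0 <= b ->
  (forall n, 0 <= u n) -> (forall n, (n0 <= n)%N -> u n.+1 <= q * u n + b) ->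
  forall k, u (n0 + k)%N <= q ^+ k * u n0 + b / (1 - q).
Proof.
move=> /andP[q0 q1] b0 u0 h; have q2 : 0 < 1 - q by lra.
have bq : 0 <= b / (1 - q) by rewrite divr_ge0// ltW.
elim=> [|k IH]; first by rewrite addn0 expr0 mul1r lerDl.
rewrite addnS; apply: (le_trans (h _ (leq_addr _ _))).
apply: (@le_trans _ _ (q * (q ^+ k * u n0 + b / (1 - q)) + b)).
  by rewrite lerD2r ler_wpM2l.
by rewrite le_eqVlt; apply/orP; left; apply/eqP; rewrite exprS; field; rewrite gt_eqF.
Qed.

(** A contraction forgets its initial value. *)
Lemma contraction_limsup (q b : R) (u : nat -> R) : 0 <= q < 1 -> 0 <= b ->
  (forall n, 0 <= u n) -> (\forall n \near \oo, u n.+1 <= q * u n + b) ->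
  forall e, 0 < e -> \forall n \near \oo, u n <= b / (1 - q) + e.
Proof.
move=> q01 b0 u0 [n0 _ h] e e0; have /andP[q0 q1] := q01.
have nq : `|q| < 1 by rewrite ger0_norm.
have ue : 0 < e / (u n0 + 1) by rewrite divr_gt0// ltr_wpDl.
have /cvgrPdist_le/(_ _ ue)[k0 _ hk] := cvg_expr nq.
exists (n0 + k0)%N => // n /= kn.
have n0n : (n0 <= n)%N by apply: leq_trans kn; exact: leq_addr.
rewrite -(subnKC n0n).
apply: (le_trans (contraction_iter q01 b0 u0 h _)).
rewrite addrC lerD2l.
have : q ^+ (n - n0) <= e / (u n0 + 1).
  rewrite -[q ^+ _]ger0_norm ?exprn_ge0// -normrN -sub0r; apply: hk => /=.
  by rewrite leq_subRL.
move=> /(ler_wpM2r (u0 n0)) hh; apply: (le_trans hh).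
rewrite -mulrA; apply: ler_piMr; first exact: ltW.
rewrite mulrC ler_pdivrMr ?mul1r ?ltr_wpDl//; lra.
Qed.

Lemma contraction_cvg0 (q : R) (u b : nat -> R) : 0 <= q < 1 ->
  (forall n, 0 <= u n) -> (forall n, u n.+1 <= q * u n + b n) ->
  b n @[n --> \oo] --> 0 -> u n @[n --> \oo] --> 0.
Proof.
move=> q01 u0 h b0; have /andP[q0 q1] := q01.
apply/cvgrPdist_le => e e0.
pose b' := (1 - q) * (e / 2).
have b'0 : 0 < b' by rewrite mulr_gt0 ?divr_gt0//; lra.
have hb : \forall n \near \oo, u n.+1 <= q * u n + b'.
  apply: filterS (cvgr_lt 0 b0 b' b'0) => n hn.
  by apply: (le_trans (h n)); rewrite lerD2l ltW.
have e2 : 0 < e / 2 by rewrite divr_gt0.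
apply: filterS (contraction_limsup q01 (ltW b'0) u0 hb e2) => n.
rewrite sub0r normrN ger0_norm// => /le_trans; apply.
rewrite /b' mulrAC divff ?mul1r; last by rewrite gt_eqF//; lra.
lra.
Qed.

(** Sum the recursion and move [q * \sum u] to the left. *)
Lemma contraction_sum (q : R) (u b : nat -> R) : 0 <= q < 1 ->
  (forall n, 0 <= u n) -> (forall n, u n.+1 <= q * u n + b n) ->
  forall N, \sum_(n < N) u n <= (u 0%N + \sum_(n < N) b n) / (1 - q).
Proof.
move=> /andP[q0 q1] u0 h N; rewrite ler_pdivlMr; last by lra.
suff : (\sum_(n < N) u n) * (1 - q) <= u 0%N - u N + \sum_(n < N) b n.
  by have := u0 N; lra.
elim: N => [|N IH]; first by rewrite !big_ord0 mul0r subrr addr0.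
rewrite !big_ord_recr/= mulrDl; have := h N; lra.
Qed.

End contraction.

Section spectral.
Context {R : realType}.
Local Notation normc := (@Normc.normc R).

Lemma normc_ge0 (z : R[i]) : 0 <= normc z.
Proof. by case: z => a b; exact: sqrtr_ge0. Qed.

Lemma Re_normE (z : R[i]) : complex.Re `|z| = normc z.
Proof. by rewrite normc_def; case: z. Qed.

Lemma normc_real (a : R) : normc (a%:C)%C = `|a|.
Proof. by rewrite /= expr0n/= addr0 sqrtr_sqr. Qed.

(** The eigenvalues are finitely many, so the supremum that defines the spectral
    radius is an upper bound. *)
Lemma spectral_radius_ge n (C : 'M[R]_n.+1) (l : R[i]) :
  root (char_poly (map_mx (real_complex R) C)) l -> normc l <= spectral_radius C.
Proof.
move=> rl; rewrite -Re_normE /spectral_radius.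
pose p := char_poly (map_mx (real_complex R) C).
have pm : p \is monic by exact: char_poly_monic.
have [zs pE] := closed_field_poly_normal p.
apply: ub_le_sup; last by exists l => //=; rewrite eigenvalue_root_char.
exists (\sum_(z <- zs) normc z) => _ [z /= hz <-].
move: hz; rewrite eigenvalue_root_char -/p pE (monicP pm) scale1r root_prod_XsubC => zz.
rewrite (big_rem z)//= lerDl; apply: sumr_ge0 => y _; exact: normc_ge0.
Qed.

(** A factor ['X - z] can be removed: the entries [a k] of [C ^ k p(C)] satisfy
    [a (k + 1) = z a k + b k], where [b] are those of [C ^ k p(C) (C - z)], and
    [|z| < 1]. *)
Lemma horner_pow_cvg0 n (C : 'M[R[i]]_n.+1) (zs : seq R[i]) (p : {poly R[i]}) :
  (forall z, z \in zs -> normc z < 1) ->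
  (forall i j, normc (horner_mx C ('X^k * (p * \prod_(z <- zs) ('X - z%:P))) i j) @[k --> \oo] --> 0) ->
  forall i j, normc (horner_mx C ('X^k * p) i j) @[k --> \oo] --> 0.
Proof.
elim: zs p => [|z zs IH] p hz h; first by move: h; rewrite big_nil mulr1.
have z1 : normc z < 1 by apply: hz; rewrite mem_head.
have {}h i j : normc (horner_mx C ('X^k * (p * ('X - z%:P))) i j) @[k --> \oo] --> 0.
  apply: IH => [y yz|{}i {}j]; first by apply: hz; rewrite inE yz orbT.
  by have := h i j; rewrite big_cons mulrA.
move=> i j; apply: (@contraction_cvg0 _ (normc z) _ _ _ _ _ (h i j)).
- by rewrite normc_ge0.
- by move=> k; exact: normc_ge0.
move=> k.
have -> : ('X^(k.+1) * p)%R = (z%:P * ('X^k * p) + 'X^k * (p * ('X - z%:P)))%R :> {poly R[i]}.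
  by rewrite exprS; ring.
rewrite rmorphD rmorphM /= horner_mx_C -mulmxE mul_scalar_mx !mxE.
apply: (le_trans (le_normcD _ _)); rewrite lerD2r.
by rewrite Normc.normcM.
Qed.

(** By Cayley-Hamilton the characteristic polynomial annihilates [C]; its linear
    factors are removed one by one. *)
Lemma spectral_radius_pow n (C : 'M[R]_n.+1) : spectral_radius C < 1 ->
  forall i j, `|(C ^+ k) i j| @[k --> \oo] --> (0 : R).
Proof.
move=> hC i j; pose Cc := map_mx (real_complex R) C.
have [zs pE] := closed_field_poly_normal (char_poly Cc).
rewrite (monicP (char_poly_monic _)) scale1r in pE.
have hz z : z \in zs -> normc z < 1.
  move=> zz; apply: le_lt_trans hC; apply: spectral_radius_ge.
  by rewrite pE root_prod_XsubC.
have := @horner_pow_cvg0 _ Cc zs 1 hz _ i j.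
rewrite (_ : (fun k => normc _) = (fun k => `|(C ^+ k) i j|)); last first.
  apply/funext => k; rewrite mulr1 rmorphXn /= horner_mx_X -normc_real.
  by rewrite -rmorphXn /= mxE.
apply => {}i {}j.
rewrite (_ : (fun k => normc _) = (fun=> 0)); first exact: cvg_cst.
apply/funext => k; rewrite mul1r -pE rmorphM /= Cayley_Hamilton mulr0 mxE.
by rewrite /Normc.normc /= expr0n /= addr0 sqrtr0.
Qed.

End spectral.

Section mxnorm.
Context {R : realType}.

Lemma coord_le_norm {m n} (M : 'M[R]_(m, n)) i j : `|M i j| <= `|M|.
Proof.
rewrite [leRHS]/Num.norm /= mx_normrE.
exact: (le_bigmax _ (fun ij : 'I_m * 'I_n => `|M ij.1 ij.2|) (i, j)).
Qed.

Lemma norm_le_coord {m n} (M : 'M[R]_(m, n)) c : 0 <= c ->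
  (forall i j, `|M i j| <= c) -> `|M| <= c.
Proof.
move=> c0 h; rewrite [leLHS]/Num.norm /= mx_normrE.
by apply/bigmax_leP; split => // -[i j] _ /=; exact: h.
Qed.

Lemma norm_mulmx {m n p} (M : 'M[R]_(m, n)) (N : 'M[R]_(n, p)) :
  `|M *m N| <= n%:R * `|M| * `|N|.
Proof.
apply: norm_le_coord => [|i j]; first by rewrite !mulr_ge0.
rewrite mxE; apply: (le_trans (ler_norm_sum _ _ _)).
apply: (@le_trans _ _ (\sum_(k < n) `|M| * `|N|)).
  by apply: ler_sum => k _; rewrite normrM ler_pM// coord_le_norm.
by rewrite sumr_const card_ord -[(_ * _) *+ n]mulr_natl mulrA.
Qed.

(** Some power [C ^ k] contracts the given norm by the factor [exp (- 1)].  The sum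
    [\sum_(j < k) Q ^ j |C ^ j x|] with [Q ^ k = exp 1] is then contracted by [Q^-1]
    in one step: applying [C] shifts the sum, and the new last term is dominated
    by the old first one. *)
Lemma contracting_norm n (C : 'M[R]_n.+1) : spectral_radius C < 1 ->
  exists (nu : 'cV[R]_n.+1 -> R) (q K : R),
  [/\ 0 <= q < 1, 0 < K, forall x, `|x| <= nu x <= K * `|x|,
      forall x y, nu (x + y) <= nu x + nu y & forall x, nu (C *m x) <= q * nu x].
Proof.
move=> hC.
have Ssum : (\sum_i \sum_j `|(C ^+ k) i j|) @[k --> \oo] --> (0 : R).
  have : (\sum_i \sum_j `|(C ^+ k) i j|) @[k --> \oo] -->
      (\sum_(i < n.+1) \sum_(j < n.+1) (0 : R)).
    apply: cvg_big => [|i _]; first exact: add_continuous.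
    apply: cvg_big => [|j _]; first exact: add_continuous.
    exact: spectral_radius_pow.
  by rewrite big1// => i _; rewrite big1.
pose e : R := expR (- 1) / n.+1%:R.
have e0 : 0 < e by rewrite divr_gt0 ?expR_gt0.
have [k [k0 hk]] : exists k, (0 < k)%N /\ forall i j, `|(C ^+ k) i j| <= e.
  have /cvgrPdist_le/(_ _ e0)[k0 _ hk] := Ssum.
  exists k0.+1; split=> // i j; have := hk k0.+1 (leqnSn _).
  rewrite sub0r normrN ger0_norm; last first.
    by apply: sumr_ge0 => ? _; apply: sumr_ge0.
  apply: le_trans; rewrite (bigD1 i)//= (bigD1 j)//= -addrA lerDl.
  by rewrite addr_ge0// sumr_ge0// => ? _; apply: sumr_ge0.
have Ck x : `|C ^+ k *m x| <= expR (- 1) * `|x|.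
  apply: (le_trans (norm_mulmx _ _)); apply: ler_wpM2r => //.
  apply: (@le_trans _ _ (n.+1%:R * e)); last by rewrite /e mulrC divfK.
  by apply: ler_wpM2l => //; apply: norm_le_coord => //; exact: ltW.
pose Q : R := expR (k%:R^-1).
have Q0 : 0 < Q by exact: expR_gt0.
have Q1 : 1 < Q by rewrite expR_gt1 invr_gt0 ltr0n.
have Qk : Q ^+ k = expR 1 by rewrite -expRM_natl mulfV// pnatr_eq0 -lt0n.
pose nu (x : 'cV[R]_n.+1) := \sum_(j < k) Q ^+ j * `|C ^+ j *m x|.
pose K := \sum_(j < k) Q ^+ j * (n.+1%:R * `|C ^+ j|).
have nu_ge x : `|x| <= nu x.
  rewrite /nu; case: k k0 {hk Ck Qk nu K} @Q Q0 Q1 => // k _ Q Q0 Q1.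
  rewrite big_ord_recl/= expr0 mul1r expr0 mul1mx lerDl.
  by apply: sumr_ge0 => j _; rewrite mulr_ge0// exprn_ge0// ltW.
have nu_le x : nu x <= K * `|x|.
  rewrite mulr_suml; apply: ler_sum => j _; rewrite -mulrA.
  by apply: ler_wpM2l; [rewrite exprn_ge0// ltW|exact: norm_mulmx].
have Kge0 : 0 <= K.
  by apply: sumr_ge0 => j _; rewrite mulr_ge0// ?exprn_ge0 ?ltW// mulr_ge0.
exists nu, Q^-1, (K + 1); split.
- by rewrite invr_ge0 ltW//= invf_lt1.
- by rewrite ltr_wpDl.
- move=> x; rewrite nu_ge (le_trans (nu_le x))//.
  by rewrite mulrDl lerDl mul1r.
- move=> x y; rewrite /nu -big_split/=; apply: ler_sum => j _.
  rewrite -mulrDr mulmxDr; apply: ler_wpM2l; last exact: ler_normD.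
  by rewrite exprn_ge0// ltW.
move=> x; rewrite mulrC ler_pdivlMr// mulrC.
have E : Q * nu (C *m x) + `|x| = nu x + Q ^+ k * `|C ^+ k *m x|.
  transitivity (\sum_(j < k.+1) Q ^+ j * `|C ^+ j *m x|); last by rewrite big_ord_recr.
  rewrite big_ord_recl/= !expr0 mul1r mul1mx addrC; congr (_ + _).
  rewrite mulr_sumr; apply: eq_bigr => j _.
  by rewrite mulrA -exprS /bump add1n mulmxA mulmxE -exprSr.
have : Q ^+ k * `|C ^+ k *m x| <= `|x|.
  rewrite Qk -ler_pdivlMl ?expR_gt0//.
  by rewrite -expRN; exact: Ck.
by move: E; lra.
Qed.

End mxnorm.

(** * Integrals of continuous functions and Gronwall's inequality *)

Section continuous_integral.
Context {R : realType}.
Local Notation mu := (@lebesgue_measure R).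
Implicit Types f g : R -> R.

(** On a reversed interval this is [0], and not the opposite of an integral. *)
Definition cint f (a b : R) : R := \int[mu]_(x in `[a, b]) f x.

Lemma cint_integrable f (a b : R) : continuous f -> mu.-integrable `[a, b] (EFin \o f).
Proof.
move=> cf; apply: continuous_compact_integrable; first exact: segment_compact.
exact: continuous_subspaceT.
Qed.

Lemma le_cint f g (a b : R) : continuous f -> continuous g ->
  (forall x, a <= x <= b -> f x <= g x) -> cint f a b <= cint g a b.
Proof.
move=> cf cg h; apply: le_Rintegral => //.
- exact: cint_integrable.
- exact: cint_integrable.
Qed.

Lemma cint_cst a b c : a <= b -> cint (cst c) a b = c * (b - a).
Proof.
move=> ab; rewrite /cint Rintegral_cst//= lebesgue_measure_itv/= lte_fin.
move: ab; rewrite le_eqVlt => /predU1P[->|->]; last by rewrite -EFinB.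
by rewrite ltxx subrr mulr0.
Qed.

Lemma norm_cint f a b : continuous f -> `|cint f a b| <= cint (fun x => `|f x|) a b.
Proof.
move=> cf; apply: le_normr_Rintegral => //; exact: cint_integrable.
Qed.

Lemma continuous_norm_comp f : continuous f -> continuous (fun x => `|f x|).
Proof. by move=> cf x; apply: continuous_comp; [exact: cf|exact: norm_continuous]. Qed.

Lemma norm_cint_le f a b c : continuous f -> a <= b ->
  (forall x, a <= x <= b -> `|f x| <= c) -> `|cint f a b| <= c * (b - a).
Proof.
move=> cf ab h; apply: (le_trans (norm_cint _ _ cf)); rewrite -(cint_cst c ab).
by apply: le_cint => //; [exact: continuous_norm_comp|move=> x; exact: cst_continuous].
Qed.

Lemma cint_cat f a b c : continuous f -> a <= b -> b <= c ->
  cint f a c = cint f a b + cint f b c.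
Proof.
move=> cf ab bc; apply/eqP; rewrite addrC -subr_eq; apply/eqP.
rewrite /cint Rintegral_itvB ?bnd_simp//; last exact: cint_integrable.
rewrite Rintegral_itv_obnd_cbnd//.
by apply: integrableS (cint_integrable b c cf) => //; exact: subset_itv_oc_cc.
Qed.

Lemma cintB f g a b : continuous f -> continuous g ->
  cint (fun x => f x - g x) a b = cint f a b - cint g a b.
Proof. by move=> cf cg; apply: RintegralB => //; exact: cint_integrable. Qed.

Lemma eq_cint f g a b : (forall x, a <= x <= b -> f x = g x) -> cint f a b = cint g a b.
Proof.
by move=> h; apply: eq_Rintegral => x; rewrite inE /= in_itv/=; exact: h.
Qed.

Lemma cint_FTC2 f (F : R -> R) (a b : R) : a < b -> continuous f -> continuous F ->
  (forall x, a < x < b -> is_derive x 1 F (f x)) -> cint f a b = F b - F a.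
Proof.
move=> ab cf cF h; rewrite /cint /Rintegral.
rewrite (@continuous_FTC2 _ f F a b ab)//.
- exact: continuous_subspaceT.
- split.
  + by move=> x; rewrite in_itv/= => /h[].
  + by apply: cvg_at_right_filter; exact: cF.
  + by apply: cvg_at_left_filter; exact: cF.
by move=> x; rewrite in_itv/= => /h[_ <-]; rewrite derive1E.
Qed.

(** Gronwall's inequality, up to a factor two: evaluate the hypothesis at a
    maximum of [f t * exp (- 2 a (t - s))]. *)
Lemma gronwall f (a z s T : R) : 0 < a -> 0 <= z -> 0 <= T -> continuous f ->
  (forall t, 0 <= f t) ->
  (forall t, s <= t <= s + T -> f t <= z + a * cint f s t) ->
  forall t, s <= t <= s + T -> f t <= 2 * z * expR (2 * a * T).
Proof.
move=> a0 z0 T0 cf f0 h t sT.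
pose E (u : R) := expR (2 * a * (u - s)).
have cE : continuous E.
  move=> u; apply: continuous_comp; last exact: continuous_expR.
  apply: cvgM; first exact: cvg_cst.
  by apply: cvgB; [exact: cvg_id|exact: cvg_cst].
have E0 u : 0 < E u by exact: expR_gt0.
pose g u := f u / E u.
have cg : continuous g.
  move=> u; apply: cvgM; first exact: cf.
  by apply: cvgV; [rewrite gt_eqF|exact: cE].
have sT' : s <= s + T by rewrite lerDl.
have [c] := EVT_max sT' (continuous_subspaceT cg).
rewrite in_itv/= => csT gmax.
have gE u : f u = g u * E u by rewrite /g divfK// gt_eqF.
have g0 u : 0 <= g u by rewrite divr_ge0// ltW.
have intE u : s <= u -> cint E s u <= E u / (2 * a).
  rewrite le_eqVlt => /predU1P[<-|su].
    by rewrite /cint set_itv1 Rintegral_set1 divr_ge0 ?ltW// mulr_gt0.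
  have cEa : continuous (fun v => E v / (2 * a)).
    by move=> v; apply: cvgM; [exact: cE|exact: cvg_cst].
  have dE (v : R) : is_derive v (1 : R) (fun v : R => E v / (2 * a) : R) (E v).
    rewrite /E; apply: is_derive_eq.
    by rewrite subr0 scaler0 add0r /GRing.scale /=; field; rewrite gt_eqF.
  rewrite (cint_FTC2 su cE cEa (fun v _ => dE v)).
  by rewrite lerBlDr lerDl divr_ge0 ?ltW// mulr_gt0.
have gc : g c <= 2 * z.
  have hc := h c csT.
  have /andP[sc _] := csT.
  have : cint f s c <= g c * (E c / (2 * a)).
    apply: (@le_trans _ _ (cint (fun u => g c * E u) s c)).
      apply: le_cint => //.
        by move=> u; apply: cvgM; [exact: cvg_cst|exact: cE].
      move=> u /andP[su uc]; rewrite gE; apply: ler_wpM2r; first exact: ltW.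
      by apply: gmax; rewrite in_itv/= su/=; lra.
    rewrite /cint RintegralZl//; last exact: cint_integrable.
    by apply: ler_wpM2l => //; exact: intE.
  move=> /(ler_wpM2l (ltW a0)).
  have -> : a * (g c * (E c / (2 * a))) = f c / 2.
    by rewrite gE; field; rewrite gt_eqF.
  move=> hh; have fc : f c <= 2 * z by lra.
  apply: le_trans fc; rewrite gE ler_peMr//.
  by rewrite -expR0 ler_expR mulr_ge0 ?subr_ge0// mulr_ge0// ltW.
rewrite gE; apply: ler_pM => //; [exact: ltW|by apply: le_trans gc; apply: gmax; rewrite in_itv/=|].
rewrite ler_expR; apply: ler_wpM2l; first by rewrite mulr_ge0// ltW.
by have /andP[] := sT; lra.
Qed.

End continuous_integral.

Section hat.
Context {R : realType}.

(** A function that is constrained on the half-line only is replaced by its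
    extension by a constant, which is continuous everywhere. *)
Definition hat {V : Type} (u : R -> V) (t : R) : V := u (Num.max 0 t).

Lemma hat_id {V : Type} (u : R -> V) t : 0 <= t -> hat u t = u t.
Proof. by move=> t0; rewrite /hat max_r. Qed.

Lemma max0_continuous : continuous (Num.max 0 : R -> R).
Proof.
have -> : (Num.max 0 : R -> R) = (fun t => 2^-1 * (t + `|t|)).
  apply/funext => t; case: (leP 0 t) => t0.
    by rewrite ger0_norm//; field.
  by rewrite ltr0_norm//; ring.
move=> t; apply: cvgM; first exact: cvg_cst.
by apply: cvgD; [exact: cvg_id|exact: norm_continuous].
Qed.

Lemma hat_continuous {V : topologicalType} (u : R -> V) :
  {within halfline, continuous u} -> continuous (hat u).
Proof.
move=> /subspace_continuousP cu t N hN.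
have hy : (halfline : set R) (Num.max 0 t).
  by rewrite /halfline /= in_itv/= andbT le_max lexx.
have := cu _ hy N hN; rewrite /= /within /= => h.
have hm := max0_continuous h.
have hs : \forall s \near t, N (u (Num.max 0 s)).
  apply: (@filterS _ (nbhs t) _ _ _ _ hm) => s /=; apply.
  by rewrite /halfline /= in_itv/= andbT le_max lexx.
exact: hs.
Qed.

End hat.

Section fundamental.
Context {R : realType} {d : nat}.
Variables (A Psi : R -> 'M[R]_d).
Hypothesis Psi_sol : fundamental_solution A Psi.

Lemma cvg_mulmx_coord {T : Type} (G : set_system T) {FG : Filter G}
    {m n p : nat} (M : T -> 'M[R]_(m, n)) (L : 'M[R]_(m, n)) (y : 'M[R]_(n, p)) i j :
  M x @[x --> G] --> L -> (M x *m y) i j @[x --> G] --> (L *m y) i j.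
Proof.
move=> ML; under eq_cvg do rewrite mxE; rewrite mxE.
apply: cvg_big => [|k _]; first exact: add_continuous.
apply: cvgM; last exact: cvg_cst.
apply: (@cvg_comp _ _ _ M (fun N : 'M[R]_(m, n) => N i k) _ _ _ ML).
exact: coord_continuous.
Qed.

(** At positive times the derivative relative to the half-line is the two-sided
    one. *)
Lemma fundamental_derive (t : R) (y : 'cV[R]_d) i : 0 < t ->
  is_derive t (1 : R) (fun s => (hat Psi s *m y) i ord0) ((A t *m Psi t *m y) i ord0).
Proof.
move=> t0; have [_ _ /(_ t (ltW t0)) hq] := Psi_sol.
have FF : Filter (within (halfline : set R) t^') by exact: within_filter.
have hq' := cvg_mulmx_coord (y := y) (i := i) (j := ord0) hq.
suff cv : h^-1 *: ((hat Psi (h *: 1 + t) *m y) i ord0 - (hat Psi t *m y) i ord0)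
    @[h --> 0^'] --> (A t *m Psi t *m y) i ord0.
  by split; [exact: (cvgP _ cv)|exact: (cvg_lim _ cv)].
apply/cvgrPdist_le => e e0.
have {}hq' := hq' FF.
move/cvgrPdist_le : hq' => /(_ _ e0).
rewrite /within /= => /nbhs_ballP[del /= del0 hdel].
have min0 : 0 < Num.min del t by rewrite lt_min del0.
apply/nbhs_ballP; exists (Num.min del t) => //= h.
rewrite /ball /= sub0r normrN lt_min => /andP[hd ht] h0.
have hh : h *: (1 : R) + t = t + h by rewrite scaler1 addrC.
have th0 : 0 <= t + h by have := ler_norm (- h); rewrite normrN; lra.
have := hdel (t + h); rewrite /ball /= opprD addNKr normrN => /(_ hd).
have thn : t + h != t by rewrite addrC -subr_eq0 addrK.
move=> /(_ thn); rewrite /halfline /= in_itv/= andbT => /(_ th0).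
rewrite hh (hat_id _ th0) (hat_id _ (ltW t0)).
have -> : t + h - t = h by ring.
by rewrite -scalemxAl mulmxBl !mxE.
Qed.

End fundamental.

(** * The perturbed equation over one period *)

Section continuous_matrix.
Context {R : realType}.

Lemma continuous_mulmx_coord {m n p} (M : R -> 'M[R]_(m, n)) (N : R -> 'M[R]_(n, p)) i j :
  continuous M -> continuous N -> continuous (fun s => (M s *m N s) i j).
Proof.
move=> cM cN s.
have -> : (fun s => (M s *m N s) i j) = (fun s => \sum_k M s i k * N s k j).
  by apply/funext => u; rewrite mxE.
apply: cvg_big => [|k _]; first exact: add_continuous.
apply: cvgM.
  by apply: (@cvg_comp _ _ _ M (fun N : 'M[R]_(m, n) => N i k) _ _ _ (cM s)); exact: coord_continuous.
by apply: (@cvg_comp _ _ _ N (fun N : 'M[R]_(n, p) => N k j) _ _ _ (cN s)); exact: coord_continuous.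
Qed.

Lemma continuous_coord {m n} (M : R -> 'M[R]_(m, n)) i j :
  continuous M -> continuous (fun s => M s i j).
Proof.
move=> cM s.
by apply: (@cvg_comp _ _ _ M (fun N : 'M[R]_(m, n) => N i j) _ _ _ (cM s)); exact: coord_continuous.
Qed.

Lemma continuous_mx {m n} (M : R -> 'M[R]_(m, n)) :
  (forall i j, continuous (fun s => M s i j)) -> continuous M.
Proof.
move=> cM s; apply/cvgrPdist_le => e e0.
have h : \forall u \near s, forall ij : 'I_m * 'I_n, `|M s ij.1 ij.2 - M u ij.1 ij.2| <= e.
  apply: (@filter_forall R ('I_m * 'I_n)%type
    (fun ij u => `|M s ij.1 ij.2 - M u ij.1 ij.2| <= e) (nbhs s)) => -[i j] /=.
  by have /cvgrPdist_le/(_ _ e0) := cM i j s.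
apply: (@filterS _ (nbhs s) _ _ _ _ h) => {}u {}h; apply: norm_le_coord; first exact: ltW.
by move=> i j; rewrite !mxE; exact: (h (i, j)).
Qed.

Lemma continuous_norm_mx {m n} (M : R -> 'M[R]_(m, n)) :
  continuous M -> continuous (fun s => `|M s|).
Proof. by move=> cM s; apply: continuous_comp; [exact: cM|exact: norm_continuous]. Qed.

Lemma continuous_bounded_itv {m n} (M : R -> 'M[R]_(m, n)) (a b : R) : a <= b ->
  continuous M -> exists2 c, 0 < c & forall t, a <= t <= b -> `|M t| <= c.
Proof.
move=> ab cM.
have [c _ hc] := EVT_max ab (continuous_subspaceT (continuous_norm_mx cM)).
exists (`|M c| + 1) => [|t tab]; first by rewrite ltr_wpDl.
by apply: (@le_trans _ _ `|M c|); [apply: hc; rewrite in_itv|rewrite lerDl].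
Qed.

End continuous_matrix.

Section period.
Context {R : realType} {n : nat}.
Variables (A Ps : R -> 'M[R]_n.+1) (T : R).
Hypothesis T_gt0 : 0 < T.
Hypothesis cA : continuous A.
Hypothesis A_periodic : forall t : R, 0 <= t -> A (t + T) = A t.
Hypothesis cP : continuous Ps.
Hypothesis P0 : Ps 0 = 1%:M.
Hypothesis dP : forall (t : R) (y : 'cV[R]_n.+1) i, 0 < t ->
  is_derive t (1 : R) (fun s => (Ps s *m y) i ord0) ((A t *m Ps t *m y) i ord0).

(** The integral form of [x' = A x + m'] for a driving path [m] that need not be
    differentiable. *)
Definition path_eq (x : R -> 'cV[R]_n.+1) (xi : 'cV[R]_n.+1) (m : R -> 'cV[R]_n.+1) : Prop :=
  forall t, 0 <= t ->
    x t = xi + (\col_i cint (fun s => (A s *m x s) i ord0) 0 t) + m t.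

Lemma periodic_iter k (t : R) : 0 <= t -> A (t + k%:R * T) = A t.
Proof.
move=> t0; elim: k => [|k IH]; first by rewrite mul0r addr0.
have -> : t + k.+1%:R * T = t + k%:R * T + T by rewrite -natr1; ring.
by rewrite A_periodic// addr_ge0// mulr_ge0// ltW.
Qed.

Lemma periodic_bounded : exists2 c, 0 < c & forall t, 0 <= t -> `|A t| <= c.
Proof.
have [c c0 hc] := continuous_bounded_itv (ltW T_gt0) cA.
exists c => // t t0.
have tT0 : 0 <= t / T by rewrite divr_ge0// ltW.
have /andP[h1 h2] := truncn_itv tT0.
set k := Num.truncn (t / T) in h1 h2.
have k1 : k%:R * T <= t by rewrite -ler_pdivlMr.
have k2 : t < k.+1%:R * T by rewrite -ltr_pdivrMr.
have -> : t = (t - k%:R * T) + k%:R * T by ring.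
rewrite periodic_iter ?subr_ge0//; apply: hc; rewrite subr_ge0 k1/=.
by move: k2; rewrite -natr1 mulrDl mul1r; lra.
Qed.

Lemma path_increment x xi m (s t : R) i : continuous x -> path_eq x xi m ->
  0 <= s -> s <= t ->
  x t i ord0 - x s i ord0 = cint (fun s => (A s *m x s) i ord0) s t
    + (m t i ord0 - m s i ord0).
Proof.
move=> cx pe s0 st; rewrite (pe t (le_trans s0 st)) (pe s s0) !mxE.
rewrite (cint_cat (continuous_mulmx_coord (i := i) (j := ord0) cA cx) s0 st); ring.
Qed.

(** By periodicity of [A], translates of the fundamental solution by multiples of
    the period are again solutions. *)
Lemma fundamental_increment k (y : 'cV[R]_n.+1) (t : R) i : k%:R * T <= t ->
  (Ps (t - k%:R * T) *m y) i ord0 - y i ord0 =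
  cint (fun u => (A u *m (Ps (u - k%:R * T) *m y)) i ord0) (k%:R * T) t.
Proof.
set s := k%:R * T => st.
move: st; rewrite le_eqVlt => /predU1P[<-|st].
  by rewrite subrr P0 mul1mx subrr /cint set_itv1 Rintegral_set1.
have csub : continuous (fun u : R => u - s).
  by move=> u; apply: cvgB; [exact: cvg_id|exact: cvg_cst].
have cPs : continuous (fun u => Ps (u - s)).
  by move=> u; apply: (@cvg_comp _ _ _ (fun u : R => u - s) Ps _ _ _ (csub u)); exact: cP.
have cAs : continuous (fun u => A (u - s)).
  by move=> u; apply: (@cvg_comp _ _ _ (fun u : R => u - s) A _ _ _ (csub u)); exact: cA.
have cy : continuous (fun _ : R => y) by move=> u; exact: cvg_cst.
have cPsy : continuous (fun u => Ps (u - s) *m y).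
  by apply: continuous_mx => i' j'; exact: continuous_mulmx_coord.
transitivity (cint (fun u => (A (u - s) *m (Ps (u - s) *m y)) i ord0) s t); last first.
  apply: eq_cint => u /andP[su _]; rewrite -[in RHS](subrK s u) periodic_iter ?subr_ge0//.
  by rewrite subrK.
have dF (u : R) : s < u < t -> is_derive u (1 : R)
    (fun u : R => (Ps (u - s) *m y) i ord0) ((A (u - s) *m (Ps (u - s) *m y)) i ord0).
  move=> /andP[su _]; have us0 : 0 < u - s by rewrite subr_gt0.
  have d1 := dP y i us0.
  have d2 : is_derive u (1 : R) (fun v : R => v - s) 1.
    by apply: is_derive_eq; rewrite subr0.
  have := @is_derive1_comp _ (fun v => (Ps v *m y) i ord0) (fun v : R => v - s) u _ _ d1 d2.
  by rewrite mulr1 -mulmxA.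
have cf := continuous_mulmx_coord (i := i) (j := ord0) cAs cPsy.
have cF := continuous_mulmx_coord (i := i) (j := ord0) cPs cy.
by rewrite (cint_FTC2 st cf cF dF) subrr P0 mul1mx.
Qed.

(** The difference between [x] and the solution of the homogeneous equation with
    the same value at the start of a period solves the equation driven by the
    increment of [m]; Gronwall bounds it by the oscillation of [m]. *)
Lemma period_step : exists2 K, 0 < K & forall x xi m, continuous x -> path_eq x xi m ->
  forall (k : nat) z, 0 <= z ->
  (forall t, k%:R * T <= t <= k%:R * T + T -> `|m t - m (k%:R * T)| <= z) ->
  forall t, k%:R * T <= t <= k%:R * T + T ->
    `|x t - Ps (t - k%:R * T) *m x (k%:R * T)| <= K * z.
Proof.
have [c c0 hc] := periodic_bounded.
pose a := n.+1%:R * c.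
have a0 : 0 < a by rewrite mulr_gt0.
exists (2 * expR (2 * a * T)); first by rewrite mulr_gt0// expR_gt0.
move=> x xi m cx pe k z z0 hm t tk.
set s := k%:R * T in hm tk *.
have s0 : 0 <= s by rewrite mulr_ge0// ltW.
pose D u := x u - Ps (u - s) *m x s.
have csub : continuous (fun u : R => u - s).
  by move=> u; apply: cvgB; [exact: cvg_id|exact: cvg_cst].
have cPs : continuous (fun u => Ps (u - s)).
  by move=> u; apply: (@cvg_comp _ _ _ (fun u : R => u - s) Ps _ _ _ (csub u)); exact: cP.
have cy : continuous (fun _ : R => x s) by move=> u; exact: cvg_cst.
have cPsy : continuous (fun u => Ps (u - s) *m x s).
  by apply: continuous_mx => i' j'; exact: continuous_mulmx_coord.
have cD : continuous D by move=> u; apply: cvgB; [exact: cx|exact: cPsy].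
have cn := continuous_norm_mx cD.
have := @gronwall _ (fun u => `|D u|) a z s T a0 z0 (ltW T_gt0) cn (fun u => normr_ge0 _) _ t tk.
rewrite -/(D t) => h; rewrite mulrAC; apply: h => {t tk} t /[dup] tk /andP[st tsT].
have int0 : 0 <= cint (fun u => `|D u|) s t.
  by apply: Rintegral_ge0 => u _; exact: normr_ge0.
apply: norm_le_coord; first by rewrite addr_ge0// mulr_ge0// ltW.
move=> i j; rewrite ord1.
have cAx i' := continuous_mulmx_coord (i := i') (j := ord0) cA cx.
have cAP i' := continuous_mulmx_coord (i := i') (j := ord0) cA cPsy.
have cAD i' := continuous_mulmx_coord (i := i') (j := ord0) cA cD.
have -> : D t i ord0 = (m t i ord0 - m s i ord0) + cint (fun u => (A u *m D u) i ord0) s t.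
  have e1 := path_increment i cx pe s0 st.
  have e2 := fundamental_increment (x s) i st.
  have e3 : cint (fun u => (A u *m D u) i ord0) s t =
    cint (fun u => (A u *m x u) i ord0) s t -
    cint (fun u => (A u *m (Ps (u - s) *m x s)) i ord0) s t.
    rewrite -cintB//; apply: eq_cint => u _; rewrite /D mulmxBr.
    by rewrite !mxE.
  rewrite e3 -e2 /D [in LHS]mxE [in X in _ + X]mxE; move: e1; rewrite -/s; lra.
apply: (le_trans (ler_normD _ _)); apply: lerD.
  have := hm t tk; apply: le_trans.
  by have := coord_le_norm (m t - m s) i ord0; rewrite !mxE.
apply: (le_trans (norm_cint _ _ (cAD i))).
apply: (@le_trans _ _ (cint (fun u => a * `|D u|) s t)); last first.
  by rewrite /cint RintegralZl//; exact: cint_integrable.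
apply: le_cint.
- exact: continuous_norm_comp.
- by move=> u; apply: cvgM; [exact: cvg_cst|exact: cn].
move=> u /andP[su _]; apply: (le_trans (coord_le_norm _ _ _)).
apply: (le_trans (norm_mulmx _ _)); rewrite ler_wpM2r// ler_wpM2l//.
by apply: hc; exact: le_trans su.
Qed.

End period.

(** * Periods and blocks *)

Section blocks.
Context {R : realType} {d : nat}.
Variables (T h : R).
Hypothesis T_gt0 : 0 < T.
Hypothesis h_gt0 : 0 < h.

Definition block_bound (m : R -> 'cV[R]_d) (z : nat -> R) : Prop :=
  forall n t, n%:R * h <= t <= n.+1%:R * h -> `|m t - m (n%:R * h)| <= z n.

(** A period meets at most [overlap] consecutive blocks, starting with block
    [first_block]. *)
Definition first_block (n : nat) : nat := Num.truncn (n%:R * T / h).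
Definition overlap : nat := (Num.truncn (T / h)).+2.

(** Bounds the oscillation of [m] over period [n]; the factor two is there because
    the period starts inside its first block. *)
Definition period_osc (z : nat -> R) (n : nat) : R :=
  2 * \sum_(l < overlap) z (first_block n + l)%N.

Lemma block_chain m z k J t : (forall n, 0 <= z n) -> block_bound m z ->
  k%:R * h <= t <= (k + J)%:R * h ->
  `|m t - m (k%:R * h)| <= \sum_(l < J) z (k + l)%N.
Proof.
move=> z0 bz; elim: J t => [|J IH] t /andP[t1 t2].
  have -> : t = k%:R * h by move: t2; rewrite addn0; lra.
  by rewrite subrr normr0 big_ord0.
have kJ : k%:R * h <= (k + J)%:R * h by apply: ler_wpM2r; [exact: ltW|rewrite ler_nat leq_addr].
rewrite big_ord_recr/=; have [tJ|tJ] := leP t ((k + J)%:R * h).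
  by apply: (le_trans (IH t _)); rewrite ?t1// lerDl.
have -> : m t - m (k%:R * h) = (m ((k + J)%:R * h) - m (k%:R * h)) + (m t - m ((k + J)%:R * h)).
  by rewrite [RHS]addrC addrA subrK.
apply: (le_trans (ler_normD _ _)); apply: lerD.
  by apply: IH; rewrite kJ lexx.
by apply: bz; rewrite ltW//= -addnS.
Qed.

Lemma first_blockP n : (first_block n)%:R * h <= n%:R * T < (first_block n).+1%:R * h.
Proof.
have /truncn_itv/andP[h1 h2] : 0 <= n%:R * T / h by rewrite divr_ge0 ?mulr_ge0// ltW.
by rewrite -ler_pdivlMr// h1 -ltr_pdivrMr.
Qed.

Lemma period_osc_ge m z n t : (forall n, 0 <= z n) -> block_bound m z ->
  n%:R * T <= t <= n%:R * T + T -> `|m t - m (n%:R * T)| <= period_osc z n.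
Proof.
move=> z0 bz /andP[t1 t2]; have /andP[f1 f2] := first_blockP n.
have /truncn_itv/andP[_ T2] : 0 <= T / h by rewrite divr_ge0// ltW.
have Th : T < (Num.truncn (T / h)).+1%:R * h by rewrite -ltr_pdivrMr.
have up : n%:R * T + T <= (first_block n + overlap)%:R * h.
  rewrite /overlap natrD mulrDl.
  have -> : (Num.truncn (T / h)).+2%:R * h = (Num.truncn (T / h)).+1%:R * h + h.
    by rewrite -[_.+2%:R]natr1 mulrDl mul1r.
  by move: f2; rewrite -[_.+1%:R]natr1 mulrDl mul1r; lra.
set k := (first_block n)%:R * h in f1 *.
have -> : m t - m (n%:R * T) = (m t - m k) - (m (n%:R * T) - m k).
  by rewrite opprB addrA subrK.
apply: (le_trans (ler_normB _ _)); rewrite /period_osc mulrDl mul1r.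
apply: lerD; apply: block_chain => //.
  by rewrite (le_trans f1 t1) (le_trans t2 up).
by rewrite f1 (le_trans _ up)// lerDl ltW.
Qed.

Lemma first_block_ge (n N : nat) : N%:R * h <= n%:R * T -> (N <= first_block n)%N.
Proof.
move=> hN; have /andP[_ f2] := first_blockP n.
by rewrite -ltnS -(ltr_nat R) -(ltr_pM2r h_gt0) (le_lt_trans hN f2).
Qed.

Lemma first_block_near (N : nat) : \forall n \near \oo, (N <= first_block n)%N.
Proof.
have NT0 : 0 <= N%:R * h / T by rewrite divr_ge0 ?mulr_ge0// ltW.
have /truncn_itv/andP[_ h2] := NT0.
exists (Num.truncn (N%:R * h / T)).+1 => // n /= hn; apply: first_block_ge.
rewrite -ler_pdivrMr//; apply: (le_trans (ltW h2)).
by rewrite ler_nat.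
Qed.

(** The limsup of [(\sum_(n < N) a n) / N] is at most zero; the constant [C] covers
    the small [N]. *)
Definition small_sum (a : nat -> R) : Prop :=
  forall e, 0 < e -> exists C, forall N, \sum_(n < N) a n <= e * N%:R + C.

Lemma small_sum_le a b : (forall n, a n <= b n) -> small_sum b -> small_sum a.
Proof.
move=> ab sb e e0; have [C hC] := sb e e0; exists C => N.
by apply: le_trans (hC N); exact: ler_sum.
Qed.

Lemma small_sumZ c a : 0 < c -> small_sum a -> small_sum (fun n => c * a n).
Proof.
move=> c0 sa e e0; have ec : 0 < e / c by rewrite divr_gt0.
have [C hC] := sa _ ec; exists (c * C) => N; rewrite -mulr_sumr.
have := ler_wpM2l (ltW c0) (hC N); rewrite mulrDr.
by have -> : c * (e / c * N%:R) = e * N%:R by field; rewrite gt_eqF.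
Qed.

Lemma small_sumD a b : small_sum a -> small_sum b -> small_sum (fun n => a n + b n).
Proof.
move=> sa sb e e0; have e2 : 0 < e / 2 by rewrite divr_gt0.
have [C hC] := sa _ e2; have [D hD] := sb _ e2; exists (C + D) => N.
rewrite big_split/=; have := hC N; have := hD N; lra.
Qed.

Lemma small_sum_sum J (a : 'I_J -> nat -> R) : (forall l, small_sum (a l)) ->
  small_sum (fun n => \sum_(l < J) a l n).
Proof.
elim: J a => [|J IH] a sa.
  move=> e e0; exists 0 => N; rewrite big1; last by move=> n _; rewrite big_ord0.
  by rewrite addr0; apply: mulr_ge0 => //; exact: ltW.
apply: (@small_sum_le _ (fun n => a ord0 n + \sum_(l < J) a (lift ord0 l) n)).
  by move=> n; rewrite big_ord_recl.
by apply: small_sumD (sa ord0) (IH (fun l => a (lift ord0 l)) _) => l; exact: sa.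
Qed.

(** Each value of [k] is taken at most [p] times: arguments with the same value
    differ by less than [p], so that they differ modulo [p]. *)
Lemma sum_sample_le (f : nat -> R) (k : nat -> nat) p N K : (0 < p)%N ->
  (forall n, 0 <= f n) -> (forall i j, (i <= j)%N -> (k i <= k j)%N) ->
  (forall n, (k n < k (n + p))%N) -> (forall n, (n < N)%N -> (k n < K)%N) ->
  \sum_(n < N) f (k n) <= p%:R * \sum_(j < K) f j.
Proof.
move=> p0 f0 kmono kstep kK.
have -> : \sum_(n < N) f (k n) = \sum_(j < K) \sum_(n < N | k n == j) f j.
  rewrite (exchange_big_dep xpredT)//=; apply: eq_bigr => n _.
  rewrite (big_pred1 (Ordinal (kK n (ltn_ord n))))//=.
rewrite mulr_sumr; apply: ler_sum => j _.
rewrite sumr_const -[_ *+ _]mulr_natl ler_wpM2r// ler_nat.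
rewrite -[leqRHS]card_ord.
pose g (n : 'I_N) : 'I_p := Ordinal (ltn_pmod n p0).
rewrite -(card_in_imset (f := g)); first exact: max_card.
have aux (n1 n2 : 'I_N) : k n1 == j -> k n2 == j -> g n1 = g n2 -> ~ (n1 < n2)%N.
  move=> /eqP k1 /eqP k2 /(congr1 val) /= /eqP gE n12.
  have dv : (p %| n2 - n1)%N by rewrite -(eqn_mod_dvd p (ltnW n12)) eq_sym.
  have : (p <= n2 - n1)%N by apply: dvdn_leq => //; rewrite subn_gt0.
  rewrite (leq_subRL _ (ltnW n12)) => le2.
  by have := kstep n1; rewrite k1 -k2 ltnNge kmono.
move=> n1 n2; rewrite !unfold_in /= => e1 e2 g12; apply/val_inj.
case: (ltngtP n1 n2) => // lt12; exfalso.
  exact: (aux _ _ e1 e2 g12 lt12).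
exact: (aux _ _ e2 e1 (esym g12) lt12).
Qed.

Lemma first_block_mono i j : (i <= j)%N -> (first_block i <= first_block j)%N.
Proof.
move=> ij; apply: first_block_ge; have /andP[f1 _] := first_blockP i.
by apply: (le_trans f1); apply: ler_wpM2r; [exact: ltW|rewrite ler_nat].
Qed.

(** An upper bound for the number of periods that start in the same block. *)
Definition multiplicity : nat := (Num.truncn (h / T)).+1.

Lemma first_block_step n : (first_block n < first_block (n + multiplicity))%N.
Proof.
apply: first_block_ge; have /andP[f1 _] := first_blockP n.
have /truncn_itv/andP[_ T2] : 0 <= h / T by rewrite divr_ge0// ltW.
have hT : h < multiplicity%:R * T by rewrite -ltr_pdivrMr.
by rewrite -natr1 natrD !mulrDl mul1r; lra.
Qed.

Lemma small_sum_sample (f : nat -> R) l : (forall n, 0 <= f n) -> small_sum f ->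
  small_sum (fun n => f (first_block n + l)%N).
Proof.
move=> f0 sf e e0.
pose p : R := multiplicity%:R.
have p0 : 0 < p by rewrite ltr0n.
pose e' := e / (p * (T / h)).
have Th : 0 < T / h by rewrite divr_gt0.
have e'0 : 0 < e' by rewrite divr_gt0// mulr_gt0.
have [C hC] := sf _ e'0.
exists (p * (e' * (l.+2)%:R + C)) => N.
pose K := (first_block N + l).+1%N.
have h1 : \sum_(n < N) f (first_block n + l)%N <= p * \sum_(j < K) f j.
  apply: (sum_sample_le (k := fun n => (first_block n + l)%N)) => //.
  - by move=> i j ij; rewrite leq_add2r first_block_mono.
  - by move=> n; rewrite ltn_add2r first_block_step.
  - by move=> n nN; rewrite /K ltnS leq_add2r first_block_mono// ltnW.
apply: (le_trans h1).
apply: (@le_trans _ _ (p * (e' * K%:R + C))); first by apply: ler_wpM2l => //; exact: ltW.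
have /andP[f1 _] := first_blockP N.
have hb : (first_block N)%:R <= N%:R * (T / h) by rewrite mulrA ler_pdivlMr.
have KE : K%:R <= N%:R * (T / h) + l.+2%:R.
  rewrite /K -addnS natrD -[l.+2%:R]natr1; lra.
have eE : e * N%:R = p * (e' * (N%:R * (T / h))).
  by rewrite /e'; field; rewrite !gt_eqF// mulr_gt0.
rewrite eE -mulrDr addrA -mulrDr; apply: ler_wpM2l; first exact: ltW.
by rewrite lerD2r; apply: ler_wpM2l => //; exact: ltW.
Qed.

Lemma sqr_sum_le J (a : nat -> R) :
  (\sum_(l < J) a l) ^+ 2 <= 2 ^+ J * \sum_(l < J) a l ^+ 2.
Proof.
elim: J => [|J IH]; first by rewrite !big_ord0 expr0n/= mulr0.
rewrite !big_ord_recr/=; set S := \sum_(l < J) a l in IH *; set Q := \sum_(l < J) _ in IH *.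
have h1 : (S + a J) ^+ 2 <= 2 * S ^+ 2 + 2 * a J ^+ 2 by have := sqr_ge0 (S - a J); lra.
have h2 : 1 <= (2 : R) ^+ J by rewrite exprn_ege1// ler1n.
have h3 := sqr_ge0 (a J).
have h4 : a J ^+ 2 <= 2 ^+ J * a J ^+ 2 by rewrite ler_peMl.
rewrite [2 ^+ J.+1]exprS; set E := 2 ^+ J in IH h2 h4 *.
set A2 := a J ^+ 2 in h1 h3 h4 *; set S2 := S ^+ 2 in IH h1 *.
rewrite mulrDr; have -> : 2 * E * Q = 2 * (E * Q) by ring.
have -> : 2 * E * A2 = 2 * (E * A2) by ring.
lra.
Qed.

Lemma small_sum_period_osc z : small_sum (fun n => z n ^+ 2) ->
  small_sum (fun n => period_osc z n ^+ 2).
Proof.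
move=> sz.
apply: (@small_sum_le _ (fun n => (4 * 2 ^+ overlap) *
    \sum_(l < overlap) z (first_block n + l)%N ^+ 2)).
  move=> n; rewrite /period_osc exprMn -mulrA.
  have -> : (2 : R) ^+ 2 = 4 by ring.
  rewrite ler_wpM2l//; exact: (sqr_sum_le _ (fun l => z (first_block n + l)%N)).
apply: small_sumZ; first by rewrite mulr_gt0// exprn_gt0.
apply: small_sum_sum => l; apply: (@small_sum_sample (fun k => z k ^+ 2)) => // k.
exact: sqr_ge0.
Qed.

Lemma period_osc_ge0 z n : (forall n, 0 <= z n) -> 0 <= period_osc z n.
Proof. by move=> z0; rewrite mulr_ge0// sumr_ge0. Qed.

Lemma period_osc_near z c : (\forall n \near \oo, z n <= c) ->
  \forall n \near \oo, period_osc z n <= 2 * overlap%:R * c.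
Proof.
move=> [N _ hN]; apply: filterS (first_block_near N) => n hn.
rewrite -mulrA ler_wpM2l//; apply: (@le_trans _ _ (\sum_(l < overlap) c)).
  by apply: ler_sum => l _; apply: hN => /=; apply: leq_trans hn (leq_addr _ _).
by rewrite sumr_const card_ord -[c *+ _]mulr_natl.
Qed.

End blocks.

(** * Deterministic estimates of the perturbed equation *)

Section path_consequences.
Context {R : realType} {n : nat}.
Variables (A Ps : R -> 'M[R]_n.+1) (T h : R).
Hypothesis T_gt0 : 0 < T.
Hypothesis h_gt0 : 0 < h.
Hypothesis cA : continuous A.
Hypothesis A_periodic : forall t : R, 0 <= t -> A (t + T) = A t.
Hypothesis cP : continuous Ps.
Hypothesis P0 : Ps 0 = 1%:M.
Hypothesis dP : forall (t : R) (y : 'cV[R]_n.+1) i, 0 < t ->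
  is_derive t (1 : R) (fun s => (Ps s *m y) i ord0) ((A t *m Ps t *m y) i ord0).
Hypothesis rho : spectral_radius (Ps T) < 1.

(** Observed at multiples of the period in the contracted norm, the path satisfies
    a scalar affine recursion driven by the oscillations of [m]. *)
Lemma path_recursion : exists q K : R, [/\ 0 <= q < 1, 0 < K &
  forall x xi m z, continuous x -> path_eq A x xi m -> (forall k, 0 <= z k) ->
  block_bound h m z -> exists u : nat -> R,
  [/\ forall k, 0 <= u k, forall k, u k.+1 <= q * u k + K * period_osc T h z k,
    forall k, `|x (k%:R * T)| <= u k &
    forall k t, k%:R * T <= t <= k%:R * T + T -> `|x t| <= K * (u k + period_osc T h z k)]].
Proof.
have [nu [q [K [q01 K0 nuK nuD nuC]]]] := contracting_norm rho.
have [K1 K10 step] := period_step T_gt0 cA A_periodic cP P0 dP.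
have [kap kap0 hkap] := continuous_bounded_itv (ltW T_gt0) cP.
pose K2 := K * K1 + n.+1%:R * kap + K1.
have KK1 : 0 < K * K1 by rewrite mulr_gt0.
have nk : 0 < n.+1%:R * kap by rewrite mulr_gt0.
exists q, K2; split=> //; first by rewrite /K2; lra.
move=> x xi m z cx pe z0 bz.
have osc0 k := period_osc_ge0 T h k z0.
have st k := step x xi m cx pe k _ (osc0 k)
  (fun t => @period_osc_ge _ _ _ _ T_gt0 h_gt0 m z k t z0 bz).
have nu0 y : 0 <= nu y by have /andP[h1 _] := nuK y; exact: le_trans h1.
exists (fun k => nu (x (k%:R * T))); split=> //.
- move=> k; have -> : k.+1%:R * T = k%:R * T + T by rewrite -natr1 mulrDl mul1r.
  have kT : k%:R * T <= k%:R * T + T <= k%:R * T + T by rewrite lexx lerDl ltW.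
  have := st k _ kT; rewrite [k%:R * T + T - _]addrC addKr => h1.
  rewrite -[X in nu X](subrK (Ps T *m x (k%:R * T))) addrC.
  apply: (le_trans (nuD _ _)); apply: lerD; first exact: nuC.
  have /andP[_ h2] := nuK (x (k%:R * T + T) - Ps T *m x (k%:R * T)).
  apply: (le_trans h2); apply: (@le_trans _ _ (K * (K1 * period_osc T h z k))).
    by apply: ler_wpM2l => //; exact: ltW.
  by rewrite mulrA; apply: ler_wpM2r => //; rewrite /K2; lra.
- by move=> k; have /andP[] := nuK (x (k%:R * T)).
move=> k t tk; have h1 := st k t tk.
rewrite -[x t](subrK (Ps (t - k%:R * T) *m x (k%:R * T))).
apply: (le_trans (ler_normD _ _)); rewrite mulrDr addrC.
apply: lerD; last first.
  by apply: (le_trans h1); apply: ler_wpM2r => //; rewrite /K2; lra.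
apply: (le_trans (norm_mulmx _ _)).
apply: (@le_trans _ _ (n.+1%:R * kap * nu (x (k%:R * T)))).
  have /andP[a1 a2] := tk; have /andP[b1 _] := nuK (x (k%:R * T)).
  apply: ler_pM => //; apply: ler_wpM2l => //; apply: hkap.
  by rewrite subr_ge0 a1/=; lra.
by apply: ler_wpM2r => //; rewrite /K2; lra.
Qed.

Lemma near_pinfty_period (Q : nat -> Prop) (S : R -> Prop) :
  (\forall k \near \oo, Q k) ->
  (forall k t, Q k -> k%:R * T <= t <= k%:R * T + T -> S t) ->
  \forall t \near +oo, S t.
Proof.
move=> [N _ hN] QS; exists (N%:R * T); split; first exact: num_real.
move=> t Nt; have t0 : 0 <= t by apply: le_trans (ltW Nt); rewrite mulr_ge0// ltW.
have /truncn_itv/andP[k1 k2] : 0 <= t / T by rewrite divr_ge0// ltW.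
apply: (QS (Num.truncn (t / T))).
  apply: hN => /=; rewrite -ltnS -(ltr_nat R); apply: le_lt_trans k2.
  by rewrite ler_pdivlMr// ltW.
move: k1 k2; rewrite ler_pdivlMr// ltr_pdivrMr// -natr1 mulrDl mul1r => -> /=.
exact: ltW.
Qed.

Lemma path_bounded : exists2 K : R, 0 < K & forall x xi m z c,
  continuous x -> path_eq A x xi m -> (forall k, 0 <= z k) -> block_bound h m z ->
  0 < c -> (\forall k \near \oo, z k <= c) -> \forall t \near +oo, `|x t| <= K * c.
Proof.
have [q [K [q01 K0 H]]] := path_recursion.
pose J : R := (overlap T h)%:R.
have J0 : 0 < J by rewrite ltr0n.
have /andP[q0 q1] := q01.
pose b := K * (2 * J) / (1 - q) + 1 + 2 * J.
have b0 : 0 < b.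
  have : 0 <= K * (2 * J) / (1 - q).
    by apply: divr_ge0; rewrite ?subr_ge0 ?mulr_ge0// ltW.
  by rewrite /b; lra.
exists (K * b); first by rewrite mulr_gt0.
move=> x xi m z c cx pe z0 bz c0 zc.
have [u [u0 urec xu xt]] := H x xi m z cx pe z0 bz.
have onear := period_osc_near T_gt0 h_gt0 zc.
have bK : 0 <= K * (2 * J * c) by rewrite !mulr_ge0// ltW.
have ur : \forall k \near \oo, u k.+1 <= q * u k + K * (2 * J * c).
  apply: filterS onear => k hk; apply: (le_trans (urec k)).
  by rewrite lerD2l; apply: ler_wpM2l => //; exact: ltW.
have ub := contraction_limsup q01 bK u0 ur c0.
apply: (near_pinfty_period (filterI ub onear)) => k t [h1 h2] tk.
apply: (le_trans (xt k t tk)); rewrite -mulrA.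
apply: ler_wpM2l; first exact: ltW.
have -> : b * c = K * (2 * J * c) / (1 - q) + c + 2 * J * c by rewrite /b; ring.
exact: lerD.
Qed.

(** By the equation, an increment of [m] is an increment of [x] minus the integral
    of [A x]. *)
Lemma path_lower : exists2 K : R, 0 < K & forall x xi m c,
  continuous x -> path_eq A x xi m -> 0 <= c ->
  (\forall t \near +oo, `|x t| <= c) ->
  \forall k \near \oo, `|m (k.+1%:R * h) - m (k%:R * h)| <= K * c.
Proof.
have [a a0 ha] := periodic_bounded T_gt0 cA A_periodic.
have nah : 0 <= n.+1%:R * a * h by rewrite !mulr_ge0// ltW.
exists (2 + n.+1%:R * a * h) => [|x xi m c cx pe c0 [t0 [t0r xc]]].
  by lra.
have /truncn_itv/andP[_ N2] : 0 <= `|t0| / h by rewrite divr_ge0// ltW.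
exists (Num.truncn (`|t0| / h)).+1 => // k /= Nk.
have kt0 : t0 < k%:R * h.
  apply: (le_lt_trans (ler_norm t0)); rewrite -ltr_pdivrMr//.
  by apply: (lt_le_trans N2); rewrite ler_nat.
have k0 : 0 <= k%:R * h by rewrite mulr_ge0// ltW.
have kk1 : k.+1%:R * h = k%:R * h + h by rewrite -natr1 mulrDl mul1r.
have kle : k%:R * h <= k.+1%:R * h by rewrite kk1 lerDl ltW.
apply: norm_le_coord; first by rewrite mulr_ge0//; lra.
move=> i j; rewrite ord1 !mxE.
have := path_increment cA i cx pe k0 kle.
set I := cint _ _ _ => e1.
have hI : `|I| <= n.+1%:R * a * c * h.
  have -> : h = k.+1%:R * h - k%:R * h by rewrite kk1; ring.
  apply: norm_cint_le => //; first exact: continuous_mulmx_coord.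
  move=> s /andP[s1 s2]; apply: (le_trans (coord_le_norm _ _ _)).
  apply: (le_trans (norm_mulmx _ _)); rewrite -!mulrA; apply: ler_wpM2l => //.
  apply: ler_pM => //; first by apply: ha; exact: le_trans s1.
  by apply: xc; exact: lt_le_trans s1.
have x1 := le_trans (coord_le_norm (x (k.+1%:R * h)) i ord0) (xc _ (lt_le_trans kt0 kle)).
have x2 := le_trans (coord_le_norm (x (k%:R * h)) i ord0) (xc _ kt0).
have -> : m (k.+1%:R * h) i ord0 - m (k%:R * h) i ord0 =
  x (k.+1%:R * h) i ord0 - x (k%:R * h) i ord0 - I by rewrite e1; ring.
apply: (le_trans (ler_normB _ _)).
have := ler_normB (x (k.+1%:R * h) i ord0) (x (k%:R * h) i ord0).
have -> : (2 + n.+1%:R * a * h) * c = c + c + n.+1%:R * a * c * h by ring.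
lra.
Qed.

(** Squaring the recursion [u' <= q u + K o] keeps its form, since convexity gives
    [(q u + K o) ^ 2 <= q u ^ 2 + K ^ 2 o ^ 2 / (1 - q)]. *)
Lemma path_small_sum x xi m z : continuous x -> path_eq A x xi m ->
  (forall k, 0 <= z k) -> block_bound h m z -> small_sum (fun k => z k ^+ 2) ->
  exists (u : nat -> R),
   [/\ small_sum u, forall k, 0 <= u k &
    forall k t, k%:R * T <= t <= k%:R * T + T -> `|x t| ^+ 2 <= u k].
Proof.
move=> cx pe z0 bz sz.
have [q [K [q01 K0 H]]] := path_recursion.
have [u [u0 urec xu xt]] := H x xi m z cx pe z0 bz.
have /andP[q0 q1] := q01; have q2 : 0 < 1 - q by lra.
pose o k := period_osc T h z k.
have o0 k : 0 <= o k by exact: period_osc_ge0.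
have so : small_sum (fun k => o k ^+ 2) by exact: small_sum_period_osc.
have rec2 k : u k.+1 ^+ 2 <= q * u k ^+ 2 + K ^+ 2 / (1 - q) * o k ^+ 2.
  have h1 : u k.+1 ^+ 2 <= (q * u k + K * o k) ^+ 2.
    have s0 : 0 <= q * u k + K * o k.
      by apply: addr_ge0; apply: mulr_ge0 => //; exact: ltW.
    by rewrite lerXn2r ?nnegrE//; exact: urec.
  apply: (le_trans h1).
  have : 0 <= q * (1 - q) * (u k - K * o k / (1 - q)) ^+ 2.
    by rewrite mulr_ge0 ?sqr_ge0// mulr_ge0// ltW.
  have -> : q * (1 - q) * (u k - K * o k / (1 - q)) ^+ 2 =
    q * u k ^+ 2 + K ^+ 2 / (1 - q) * o k ^+ 2 - (q * u k + K * o k) ^+ 2.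
    by field; rewrite gt_eqF.
  lra.
have su : small_sum (fun k => u k ^+ 2).
  move=> e e0; have e1 : 0 < e * (1 - q) by rewrite mulr_gt0.
  have K20 : 0 < K ^+ 2 / (1 - q) by rewrite divr_gt0// exprn_gt0.
  have [C hC] := small_sumZ K20 so e1.
  exists ((u 0%N ^+ 2 + C) / (1 - q)) => N.
  apply: (le_trans (contraction_sum q01 (fun k => sqr_ge0 (u k)) rec2 N)).
  have -> : e * N%:R + (u 0%N ^+ 2 + C) / (1 - q) =
     (u 0%N ^+ 2 + (e * (1 - q) * N%:R + C)) / (1 - q) by field; rewrite gt_eqF.
  by rewrite ler_pM2r ?invr_gt0// lerD2l.
have K3 : 0 < 2 * K ^+ 2 by rewrite mulr_gt0// exprn_gt0.
exists (fun k => 2 * K ^+ 2 * (u k ^+ 2 + o k ^+ 2)); split.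
- exact: small_sumZ (small_sumD su so).
- by move=> k; apply: mulr_ge0; [exact: ltW|apply: addr_ge0; exact: sqr_ge0].
move=> k t tk; apply: (@le_trans _ _ ((K * (u k + o k)) ^+ 2)).
  have s0 : 0 <= K * (u k + o k).
    by apply: mulr_ge0; [exact: ltW|exact: addr_ge0].
  by rewrite lerXn2r ?nnegrE//; exact: xt.
rewrite exprMn [2 * K ^+ 2]mulrC -[leRHS]mulrA; apply: ler_wpM2l; first exact: sqr_ge0.
have := sqr_ge0 (u k - o k); lra.
Qed.

Lemma path_average x xi m z : continuous x -> path_eq A x xi m ->
  (forall k, 0 <= z k) -> block_bound h m z -> small_sum (fun k => z k ^+ 2) ->
  (fun t => t^-1 * cint (fun s => `|x s| ^+ 2) 0 t) t @[t --> +oo] --> (0 : R).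
Proof.
move=> cx pe z0 bz sz.
have [u [su u0 xu]] := path_small_sum cx pe z0 bz sz.
have cx2 : continuous (fun s => `|x s| ^+ 2).
  move=> s; apply: (@cvgM _ _ _ _ (fun s => `|x s|) (fun s => `|x s|));
  exact: continuous_norm_mx.
have int0 a b : 0 <= cint (fun s => `|x s| ^+ 2) a b.
  by apply: Rintegral_ge0 => s _; exact: sqr_ge0.
have bound N : cint (fun s => `|x s| ^+ 2) 0 (N%:R * T) <= T * \sum_(k < N) u k.
  elim: N => [|N IH].
    by rewrite mul0r /cint set_itv1 Rintegral_set1 big_ord0 mulr0.
  have N0 : 0 <= N%:R * T by rewrite mulr_ge0// ltW.
  have NE : N.+1%:R * T = N%:R * T + T by rewrite -natr1 mulrDl mul1r.
  have N1 : N%:R * T <= N.+1%:R * T by rewrite NE lerDl ltW.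
  rewrite (cint_cat cx2 N0 N1) big_ord_recr/= mulrDr; apply: lerD => //.
  apply: (le_trans (ler_norm _)).
  have -> : T * u N = u N * (N.+1%:R * T - N%:R * T) by rewrite NE; ring.
  apply: norm_cint_le => // s sN; rewrite ger0_norm ?sqr_ge0//.
  by apply: xu; rewrite -NE.
apply/cvgrPdist_le => e e0.
have e2 : 0 < e / 2 by rewrite divr_gt0.
have [C hC] := su _ e2.
pose C' := T * (e / 2 + `|C|).
have C'0 : 0 <= C' by rewrite mulr_ge0// ?addr_ge0// ltW.
exists (2 * C' / e + 1); split; first exact: num_real.
move=> t ht.
have D0 : 0 <= 2 * C' / e by apply: divr_ge0; [exact: mulr_ge0|exact: ltW].
have t0 : 0 < t by lra.
rewrite sub0r normrN ger0_norm; last by rewrite mulr_ge0// invr_ge0 ltW.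
rewrite mulrC ler_pdivrMr//.
have /truncn_itv/andP[k1 k2] : 0 <= t / T by rewrite divr_ge0// ltW.
set k := Num.truncn (t / T) in k1 k2.
have tk : t <= k.+1%:R * T by rewrite -ler_pdivrMr// ltW.
rewrite ler_pdivlMr// in k1.
have : cint (fun s => `|x s| ^+ 2) 0 t <= cint (fun s => `|x s| ^+ 2) 0 (k.+1%:R * T).
  by rewrite (cint_cat cx2 (ltW t0) tk) lerDl.
move=> /le_trans; apply; apply: (le_trans (bound _)).
apply: (@le_trans _ _ (T * (e / 2 * k.+1%:R + C))).
  by apply: ler_wpM2l; [exact: ltW|exact: hC].
have hC' : T * (e / 2 * k.+1%:R + C) <= e / 2 * t + C'.
  have -> : T * (e / 2 * k.+1%:R + C) = e / 2 * (k%:R * T) + T * (e / 2 + C).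
    by rewrite -natr1; ring.
  apply: lerD; first by apply: ler_wpM2l => //; exact: ltW.
  by apply: ler_wpM2l; [exact: ltW|rewrite lerD2l ler_norm].
apply: (le_trans hC').
have : C' <= e / 2 * t.
  have h1 : 2 * C' / e <= t by lra.
  by move: h1; rewrite ler_pdivrMr//; lra.
lra.
Qed.

(** A path that stays away from zero has square sums of linear growth. *)
Lemma path_liminf x xi m z : continuous x -> path_eq A x xi m ->
  (forall k, 0 <= z k) -> block_bound h m z -> small_sum (fun k => z k ^+ 2) ->
  forall e t0, 0 < e -> exists2 t, t0 <= t & `|x t| <= e.
Proof.
move=> cx pe z0 bz sz e t0 e0.
have [u [su u0 xu]] := path_small_sum cx pe z0 bz sz.
apply: contrapT => nex.
have big t : t0 <= t -> e < `|x t|.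
  by move=> tt; rewrite ltNge; apply/negP => le; apply: nex; exists t.
have e2 : 0 < e ^+ 2 by rewrite exprn_gt0.
have e22 : 0 < e ^+ 2 / 2 by rewrite divr_gt0.
have [C hC] := su _ e22.
have /truncn_itv/andP[_ N2] : 0 <= `|t0| / T by rewrite divr_ge0// ltW.
set N := (Num.truncn (`|t0| / T)).+1 in N2.
have ub k : (N <= k)%N -> e ^+ 2 <= u k.
  move=> Nk; apply: (le_trans _ (xu k (k%:R * T) _)); last by rewrite lexx lerDl ltW.
  rewrite lerXn2r ?nnegrE ?(ltW e0)//; apply: ltW; apply: big.
  apply: (le_trans (ler_norm _)); rewrite -ler_pdivrMr//.
  by apply: (le_trans (ltW N2)); rewrite ler_nat.
have lower M : e ^+ 2 * M%:R <= \sum_(k < N + M) u k.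
  elim: M => [|M IH]; first by rewrite mulr0 sumr_ge0.
  by rewrite addnS big_ord_recr/= -natr1 mulrDr mulr1 lerD// ub// leq_addr.
pose D := (e ^+ 2 / 2 * N%:R + `|C|) / (e ^+ 2 / 2).
have D0 : 0 <= D by apply: divr_ge0; rewrite ?addr_ge0 ?mulr_ge0// ltW.
have /truncn_itv/andP[_ M2] := D0.
set M := (Num.truncn D).+1 in M2.
have h1 := lower M; have h2 := hC (N + M)%N; have h3 := ler_norm C.
move: M2; rewrite /D ltr_pdivrMr//; rewrite natrD mulrDr in h2.
lra.
Qed.

End path_consequences.

(** * Oscillation of the stochastic integral over a block *)

Section maximal.
Context {R : realType} {dis : measure_display} {Omega : measurableType dis}.
Variable P : probability Omega R.
Variables (d r : nat) (F : R -> set (set Omega)).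
Hypothesis F_filtration : filtration F.
Variable sigma : R -> 'M[R]_(d, r).
Hypothesis sigma_cont : {within halfline, continuous sigma}.
Variable N : R -> 'I_d -> Omega -> R.
Hypothesis tails : increment_tails P F (rowvar sigma) N.

Lemma filtration_measurableE (t : R) : 0 <= t -> (F t).-sigma.-measurable = F t.
Proof. by move=> t0; apply: sigma_algebra_id; case: F_filtration => h _ _; exact: h. Qed.

Lemma filtration_le (s t : R) E : 0 <= s -> s <= t -> F s E -> F t E.
Proof. by case: F_filtration => _ _ h s0 st; apply: h. Qed.

Lemma filtration_gt i (s u t : R) x : 0 <= s -> s <= u -> u <= t ->
  F t [set w | x < `|N u i w - N s i w|].
Proof.
move=> s0 su ut; have t0 := le_trans s0 (le_trans su ut).
have sF : sigma_algebra setT (F t) by case: F_filtration => h _ _; exact: h.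
rewrite -(filtration_measurableE t0).
apply: (@measurable_abs_gt _ _ (g_sigma_algebraType (F t)) (fun w => N u i w - N s i w)).
apply: measurable_funB; apply/(measurable_inP _ sF).
  apply: (measurable_in_le F_filtration (le_trans s0 su) ut).
  by apply: (tails_adapted tails); exact: le_trans su.
apply: (measurable_in_le F_filtration s0 (le_trans su ut)).
exact: (tails_adapted tails).
Qed.

(** Ottaviani's maximal inequality, conditionally on an event [E] of the past:
    on the event that [2 x] has been exceeded, the remaining increment is small
    with probability one half at least. *)
Lemma ottaviani i (tau : nat -> R) K E x v : 0 <= tau 0%N ->
  (forall k, (k < K)%N -> tau k <= tau k.+1) -> F (tau 0%N) E ->
  0 < x -> 2 * rowvar sigma i (tau 0%N) (tau K) < v ->
  (P (E `&` [set w | exists2 k, (k <= K)%N & (2 * x < `|N (tau k) i w - N (tau 0%N) i w|)%R]) <=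
   (4 * expR (- (x ^+ 2 / (8 * v))))%:E * P E)%E.
Proof.
move=> tau0 tauS FE x0 Vv.
have mono := grid_mono tauS.
pose p := expR (- (x ^+ 2 / (8 * v))).
rewrite -/p.
have mF t A : 0 <= t -> F t A -> measurable A by exact: filtration_measurable.
have tk0 k : (k <= K)%N -> 0 <= tau k.
  by move=> kK; apply: le_trans tau0 (mono _ _ _ _).
pose S k w := N (tau k) i w - N (tau 0%N) i w.
pose G k := [set w | (2 * x < `|S k w|)%R].
pose W k := E `&` [set w | exists2 j, (j <= k)%N & (2 * x < `|S j w|)%R].
rewrite -/(W K).
(* [W (k + 1)] splits according to whether [2 x] was exceeded before. *)
have WS k : W k.+1 = W k `|` (E `&` G k.+1 `\` W k).
  apply/seteqP; split => w /=.
    move=> [Ew [j jk h]]; have [Wk|nWk] := pselect (W k w); first by left.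
    right; split => //; split => //; move: jk h; rewrite leq_eqVlt => /predU1P[->//|jk h].
    by exfalso; apply: nWk; split => //; exists j.
  move=> [[Ew [j jk h]]|[[Ew h] _]]; split => //; first by exists j => //; exact: leqW.
  by exists k.+1.
have FG k t : (k <= K)%N -> tau k <= t -> F t (G k).
  by move=> kK kt; apply: filtration_gt => //; exact: mono.
have FW k : (k <= K)%N -> F (tau k) (W k).
  elim: k => [_|k IH kK].
    have -> : W 0%N = E `&` G 0%N.
      apply/seteqP; split => w /=; first by move=> [Ew [j]]; rewrite leqn0 => /eqP ->.
      by move=> [Ew h]; split => //; exists 0%N.
    rewrite -(filtration_measurableE tau0); apply: measurableI; rewrite filtration_measurableE//.
    exact: FG.
  have tk1 := tk0 _ kK; have st := tauS k kK.
  rewrite WS -(filtration_measurableE tk1).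
  have FWk : F (tau k.+1) (W k).
    by apply: filtration_le (IH (ltnW kK)) => //; exact: tk0 (ltnW kK).
  apply: measurableU; first by rewrite filtration_measurableE.
  apply: measurableD; last by rewrite filtration_measurableE.
  apply: measurableI; rewrite filtration_measurableE//; last exact: FG.
  by apply: filtration_le FE => //; exact: mono.
have mW k : (k <= K)%N -> measurable (W k) by move=> kK; apply: (mF (tau k)); [exact: tk0|exact: FW].
have mE : measurable E by exact: mF FE.
(* If [4 p >= 1] there is nothing to prove; otherwise an increment exceeds [x]
   with conditional probability at most [2 p < 1 / 2]. *)
have [big|small] := leP 1 (4 * p).
  apply: (@le_trans _ _ (P E)).
    by apply: le_measure; rewrite ?inE//; [exact: mW|move=> w []].
  rewrite -[leLHS]mul1e; apply: lee_wpmul2r; first exact: measure_ge0.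
  by rewrite lee_fin.
pose H := [set w | (x < `|S K w|)%R].
have FH : F (tau K) H by apply: filtration_gt => //; exact: mono.
have mH : measurable H by apply: (mF (tau K)) => //; exact: tk0.
have pr (A : set Omega) : measurable A -> P A = (fine (P A))%:E.
  by move=> mA; rewrite fineK// fin_num_measure.
have pos (A : set Omega) : 0 <= fine (P A) by apply: fine_ge0.
have half k A : (k <= K)%N -> F (tau k) A -> A `<=` G k ->
    fine (P A) <= 2 * fine (P (A `&` H)).
  move=> kK FA AG; have mA : measurable A by apply: (mF (tau k)) => //; exact: tk0.
  have Vk : 2 * rowvar sigma i (tau k) (tau K) < v.
    apply: le_lt_trans Vv; apply: ler_wpM2l => //.
    by apply: le_rowvar => //; exact: mono.
  have up := tails_upper tails (i := i) (tk0 _ kK) (mono _ _ kK (leqnn K)) FA x0 Vk.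
  set D := [set w | (x < `|N (tau K) i w - N (tau k) i w|)%R] in up.
  have FD : F (tau K) D by apply: filtration_gt => //; [exact: tk0|exact: mono].
  have mD : measurable D by apply: (mF (tau K)) => //; exact: tk0.
  have le1 : (P A <= P ((A `&` H) `|` (A `&` D)))%E.
    apply: le_measure; rewrite ?inE//; first by apply: measurableU; exact: measurableI.
    move=> w Aw; have := AG w Aw; rewrite /G /= => gx.
    have [hx|hx] := ltP x `|S K w|; first by left.
    right; split => //; rewrite /D /=.
    have : S k w = S K w - (N (tau K) i w - N (tau k) i w) by rewrite /S; ring.
    move=> e1; have := ler_normB (S K w) (N (tau K) i w - N (tau k) i w).
    by rewrite -e1; lra.
  have le2 := le_trans le1 (measureU2 P (measurableI _ _ mA mH) (measurableI _ _ mA mD)).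
  have le3 := le_trans le2 (leeD2l (P (A `&` H)) up).
  move: le3; rewrite (pr A)// (pr (A `&` H)); last exact: measurableI.
  rewrite -EFinM -EFinD lee_fin -/p => le3.
  have := pos A; move: small le3; set pA := fine (P A); set pH := fine _.
  move=> sm l3 pA0; have : p * pA <= 4^-1 * pA by apply: ler_wpM2r => //; lra.
  by rewrite /=; lra.
have key k : (k <= K)%N -> fine (P (W k)) <= 2 * fine (P (W k `&` H)).
  elim: k => [_|k IH kK].
    apply: (half 0%N) => //; first exact: FW.
    by move=> w [_ [j]]; rewrite leqn0 => /eqP ->.
  pose A := E `&` G k.+1 `\` W k.
  have tk1 := tk0 _ kK; have st := tauS k kK.
  have FA : F (tau k.+1) A.
    rewrite -(filtration_measurableE tk1); apply: measurableD; last first.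
      by rewrite filtration_measurableE//; apply: filtration_le (FW _ (ltnW kK)) => //; exact: tk0 (ltnW kK).
    apply: measurableI; rewrite filtration_measurableE//; last exact: FG.
    by apply: filtration_le FE => //; exact: mono.
  have mA : measurable A by apply: (mF (tau k.+1)).
  have hA : fine (P A) <= 2 * fine (P (A `&` H)).
    by apply: (half k.+1) => // w [[]].
  have mWk := mW k (ltnW kK).
  have dis1 : W k `&` A = set0 by apply/seteqP; split => w //= [hw [_ nw]]; exact: nw.
  have e1 : fine (P (W k.+1)) = fine (P (W k)) + fine (P A).
    rewrite WS measureU// fineD ?fin_num_measure//.
  have e2 : fine (P (W k.+1 `&` H)) = fine (P (W k `&` H)) + fine (P (A `&` H)).
    rewrite WS setIUl measureU; [|exact: measurableI|exact: measurableI|].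
      by rewrite fineD ?fin_num_measure//; exact: measurableI.
    by rewrite setIACA dis1 set0I.
  by rewrite e1 e2; have := IH (ltnW kK); lra.
have := key K (leqnn K).
have hE : (P (W K `&` H) <= (2 * p)%:E * P E)%E.
  apply: (@le_trans _ _ (P (E `&` H))).
    apply: le_measure; rewrite ?inE//; [|exact: measurableI|].
      by apply: measurableI => //; exact: mW.
    by move=> w [[Ew _] Hw].
  exact: (tails_upper tails (i := i) tau0 (mono _ _ (leq0n K) (leqnn K)) FE x0 Vv).
have hE' : fine (P (W K `&` H)) <= 2 * p * fine (P E).
  by rewrite -lee_fin EFinM -!pr//; apply: measurableI => //; exact: mW.
move=> hW; rewrite (pr _ (mW K (leqnn K))) (pr _ mE) -EFinM lee_fin.
by move: hW hE'; rewrite /=; lra.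
Qed.

End maximal.

Section finite_union.
Context {R : realType} {dis : measure_display} {Omega : measurableType dis}.
Variable P : {measure set Omega -> \bar R}.

Lemma measurable_exists_in (I : eqType) (A : I -> set Omega) (s : seq I) :
  (forall i, measurable (A i)) -> measurable [set w | exists2 i, i \in s & A i w].
Proof.
move=> mA; elim: s => [|i s IH].
  rewrite (_ : [set _ | _] = set0) //; by apply/seteqP; split => // w; case => i; rewrite in_nil.
rewrite (_ : [set _ | _] = A i `|` [set w | exists2 i, i \in s & A i w]); first exact: measurableU.
apply/seteqP; split => w /=.
  by move=> [j]; rewrite inE => /predU1P[->|js] Aj; [left|right; exists j].
by move=> [Ai|[j js Aj]]; [exists i; rewrite ?mem_head|exists j; rewrite // inE js orbT].
Qed.

Lemma measure_exists_in (I : eqType) (A : I -> set Omega) (s : seq I) :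
  (forall i, measurable (A i)) ->
  (P [set w | exists2 i, i \in s & A i w] <= \sum_(i <- s) P (A i))%E.
Proof.
move=> mA; elim: s => [|i s IH].
  rewrite big_nil (_ : [set _ | _] = set0) ?measure0//; by apply/seteqP; split => // w; case => i; rewrite in_nil.
rewrite big_cons (_ : [set _ | _] = A i `|` [set w | exists2 i, i \in s & A i w]).
  apply: (le_trans (measureU2 _ _ _)) => //; first exact: measurable_exists_in.
  exact: leeD2l.
apply/seteqP; split => w /=.
  by move=> [j]; rewrite inE => /predU1P[->|js] Aj; [left|right; exists j].
by move=> [Ai|[j js Aj]]; [exists i; rewrite ?mem_head|exists j; rewrite // inE js orbT].
Qed.

End finite_union.

Section block_event.
Context {R : realType} {dis : measure_display} {Omega : measurableType dis}.
Variable P : probability Omega R.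
Variables (d r : nat) (F : R -> set (set Omega)).
Hypothesis F_filtration : filtration F.
Variable sigma : R -> 'M[R]_(d, r).
Hypothesis sigma_cont : {within halfline, continuous sigma}.
Variable N : R -> 'I_d -> Omega -> R.
Hypothesis tails : increment_tails P F (rowvar sigma) N.

Definition dyad (s t : R) (m k : nat) : R := s + (t - s) * (k%:R / 2 ^+ m).

Lemma dyad_double s t m k : dyad s t m.+1 (2 * k) = dyad s t m k.
Proof. by rewrite /dyad natrM exprS; congr (_ + _ * _); field; rewrite expf_neq0. Qed.

Lemma dyad0 s t m : dyad s t m 0 = s.
Proof. by rewrite /dyad mul0r mulr0 addr0. Qed.

Lemma dyad_max s t m : dyad s t m (2 ^ m) = t.
Proof. by rewrite /dyad natrX divff ?expf_neq0// mulr1 addrC subrK. Qed.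

Lemma dyad_le s t m k k' : s <= t -> (k <= k')%N -> dyad s t m k <= dyad s t m k'.
Proof.
move=> st kk'; rewrite lerD2l; apply: ler_wpM2l; first by rewrite subr_ge0.
by apply: ler_wpM2r; [rewrite invr_ge0 exprn_ge0|rewrite ler_nat].
Qed.

Lemma dyad_bounds s t m k : s <= t -> (k <= 2 ^ m)%N -> s <= dyad s t m k <= t.
Proof.
move=> st km; have := dyad_le m st (leq0n k); rewrite dyad0 => -> /=.
by have := dyad_le m st km; rewrite dyad_max.
Qed.

Definition exceed (s t : R) (x : R) (i : 'I_d) : set Omega :=
  \bigcup_m [set w | exists2 k, (k <= 2 ^ m)%N & x < `|N (dyad s t m k) i w - N s i w|].

(** The event that the oscillation of the process over the block [s, t] exceeds
    [x]; only dyadic times are inspected, so that it is measurable. *)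
Definition block_exceed (s t : R) (x : R) : set Omega :=
  [set w | exists2 i : 'I_d, i \in enum 'I_d & exceed s t x i w].

Let Fexc s t x i m : 0 <= s -> s <= t ->
  F t [set w | exists2 k, (k <= 2 ^ m)%N & x < `|N (dyad s t m k) i w - N s i w|].
Proof.
move=> s0 st; have t0 := le_trans s0 st.
rewrite -(filtration_measurableE F_filtration t0).
rewrite (_ : [set _ | _] = [set w | exists2 k : nat, k \in iota 0 (2 ^ m).+1 &
    x < `|N (dyad s t m k) i w - N s i w| /\ (k <= 2 ^ m)%N]); last first.
  apply/seteqP; split => w.
    by move=> [k km h]; exists k; rewrite ?mem_iota ?add0n ?ltnS.
  by move=> [k _ [h km]]; exists k.
apply: (@measurable_exists_in _ (g_sigma_algebraType (F t)) nat
  (fun k => [set w | x < `|N (dyad s t m k) i w - N s i w| /\ (k <= 2 ^ m)%N])) => k.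
have [km|mk] := leqP k (2 ^ m).
  rewrite (_ : [set _ | _] = [set w | x < `|N (dyad s t m k) i w - N s i w|]).
    rewrite filtration_measurableE//; have /andP[h1 h2] := dyad_bounds st km.
    exact: (filtration_gt F_filtration tails).
  by apply/seteqP; split => w /=; [move=> []|].
rewrite (_ : [set _ | _] = set0); first exact: measurable0.
by apply/seteqP; split => // w; case.
Qed.

Lemma exceed_in s t x i : 0 <= s -> s <= t -> F t (exceed s t x i).
Proof.
move=> s0 st; have t0 := le_trans s0 st.
rewrite -(filtration_measurableE F_filtration t0).
by apply: bigcup_measurable => m _; rewrite filtration_measurableE//; exact: Fexc.
Qed.

Lemma block_exceed_in s t x : 0 <= s -> s <= t -> F t (block_exceed s t x).
Proof.
move=> s0 st; have t0 := le_trans s0 st.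
rewrite -(filtration_measurableE F_filtration t0).
apply: (@measurable_exists_in _ (g_sigma_algebraType (F t))) => i.
by rewrite filtration_measurableE//; exact: exceed_in.
Qed.

(** Ottaviani's inequality holds on each dyadic grid with the same bound, and the
    events increase with the grid. *)
Lemma exceed_bound s t x v E i : 0 <= s -> s <= t -> F s E -> 0 < x ->
  2 * rowvar sigma i s t < v ->
  (P (E `&` exceed s t (2 * x) i) <=
   (4 * expR (- (x ^+ 2 / (8 * v))))%:E * P E)%E.
Proof.
move=> s0 st FE x0 Vv; have t0 := le_trans s0 st.
rewrite /exceed setI_bigcupr.
pose A m := [set w | exists2 k, (k <= 2 ^ m)%N & 2 * x < `|N (dyad s t m k) i w - N s i w|].
have mE : measurable E by apply: filtration_measurable FE.
have mA m : measurable (A m).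
  by apply: (filtration_measurable F_filtration t0); exact: Fexc.
have mEA m : measurable (E `&` A m) by exact: measurableI.
have nd : nondecreasing_seq (fun m => E `&` A m).
  apply/nondecreasing_seqP => m; apply/subsetPset => w [Ew [k km h]].
  split => //; exists (2 * k)%N; first by rewrite expnS leq_mul2l km orbT.
  by rewrite dyad_double.
have cv := nondecreasing_cvg_mu (mu := P) mEA (bigcup_measurable (fun k _ => mEA k)) nd.
rewrite -(cvg_lim _ cv)//; apply: lime_le; first by apply: cvgP cv.
apply: nearW => m /=.
have e0 := dyad0 s t m.
have := @ottaviani _ _ _ P d r F F_filtration sigma sigma_cont N tails i (dyad s t m) (2 ^ m) E x v.
rewrite e0 dyad_max; apply => //.
by move=> k _; apply: dyad_le.
Qed.

Lemma block_exceed_bound s t x v E : 0 <= s -> s <= t -> F s E -> 0 < x ->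
  (forall i, 2 * rowvar sigma i s t < v) ->
  (P (E `&` block_exceed s t (2 * x)) <=
   (d%:R * (4 * expR (- (x ^+ 2 / (8 * v)))))%:E * P E)%E.
Proof.
move=> s0 st FE x0 Vv; have t0 := le_trans s0 st.
have mE : measurable E by apply: filtration_measurable FE.
rewrite (_ : E `&` _ = [set w | exists2 i, i \in enum 'I_d & (E `&` exceed s t (2 * x) i) w]); last first.
  apply/seteqP; split => w /=; first by move=> [Ew [i id h]]; exists i.
  by move=> [i id [Ew h]]; split => //; exists i.
apply: (le_trans (measure_exists_in _ _ _)).
  move=> i; apply: measurableI => //; apply: (filtration_measurable F_filtration t0); exact: exceed_in.
apply: (@le_trans _ _ (\sum_(i <- enum 'I_d) ((4 * expR (- (x ^+ 2 / (8 * v))))%:E * P E))%E).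
  by apply: lee_sum => i _; exact: exceed_bound.
rewrite big_enum /= -[P E]fineK ?fin_num_measure//.
under eq_bigr do rewrite -EFinM.
by rewrite sumEFin -EFinM lee_fin sumr_const card_ord -[_ *+ d]mulr_natl mulrA.
Qed.

(** An oscillation exceeding [x] persists in a neighbourhood, which contains dyadic
    times. *)
Lemma block_exceed_path (m : R -> 'cV[R]_d) w s t x : 0 <= x -> s < t ->
  continuous m ->
  (forall j k i, (k <= 2 ^ j)%N -> m (dyad s t j k) i ord0 = N (dyad s t j k) i w) ->
  ~ block_exceed s t x w ->
  forall u, s <= u <= t -> `|m u - m s| <= x.
Proof.
move=> x0 st cm mN nB u /andP[su ut].
apply: norm_le_coord => // i j; rewrite ord1 !mxE leNgt; apply/negP => big.
have cmi : continuous (fun v => `|m v i ord0 - m s i ord0|).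
  move=> v; apply: (@cvg_comp _ _ _ (fun v => m v i ord0 - m s i ord0)); last exact: norm_continuous.
  by apply: cvgB; [exact: continuous_coord|exact: cvg_cst].
have : \forall v \near u, x < `|m v i ord0 - m s i ord0|.
  exact: (cvgr_gt _ (cmi u) x big).
move=> /nbhs_ballP[del /= del0 hdel].
have ts : 0 < t - s by rewrite subr_gt0.
have [a [a0 ha]] : exists a, (0 < a)%N /\ (t - s) / 2 ^+ a < del.
  have q : `|2^-1 : R| < 1 by rewrite ger0_norm// invf_lt1//; lra.
  have e0 : 0 < del / (2 * (t - s)) by rewrite divr_gt0// mulr_gt0.
  have /cvgrPdist_le/(_ _ e0)[a _ ha] := cvg_expr q.
  exists a.+1; split=> //; have := ha a.+1 (leqnSn a); rewrite /= sub0r normrN ger0_norm; last by rewrite exprn_ge0.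
  rewrite exprVn => h1; rewrite mulrC -ltr_pdivlMr//; apply: (le_lt_trans h1).
  by rewrite invfM mulrA ltr_pM2r ?invr_gt0//; lra.
pose y := (u - s) / (t - s) * 2 ^+ a.
have pa : 0 < (2 : R) ^+ a by rewrite exprn_gt0.
have y0 : 0 <= y by rewrite mulr_ge0 ?divr_ge0 ?subr_ge0// ltW.
have /truncn_itv/andP[k1 k2] := y0.
set k := Num.truncn y in k1 k2.
have ku : (k <= 2 ^ a)%N.
  rewrite -(ler_nat R) natrX (le_trans k1)// /y ler_piMl ?(ltW pa)//.
  by rewrite ler_pdivrMr// mul1r lerD2r.
have uE : u = s + (t - s) * (y / 2 ^+ a).
  by rewrite /y; field; rewrite !gt_eqF.
have dk : `|u - dyad s t a k| < del.
  have -> : u - dyad s t a k = (t - s) / 2 ^+ a * (y - k%:R).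
    by rewrite {1}uE /dyad; field; rewrite gt_eqF.
  have yk : 0 <= y - k%:R < 1 by rewrite subr_ge0 k1/= ltrBlDr addrC natr1.
  move: yk => /andP[yk0 yk1]; rewrite ger0_norm; last by rewrite mulr_ge0// divr_ge0 ?ltW.
  apply: le_lt_trans ha; apply: ler_piMr; last exact: ltW.
  by rewrite divr_ge0 ?ltW.
apply: nB; exists i; first by rewrite mem_enum.
exists a => //; exists k => //.
rewrite -mN// -[s in N s](dyad0 s t a) -mN// dyad0.
by apply: hdel; rewrite /ball /=.
Qed.

End block_event.

(** * Exponential weights *)

Section chernoff_blocks.
Context {R : realType} {dis : measure_display} {Omega : measurableType dis}.
Variable P : probability Omega R.
Variable FF : nat -> set (set Omega).
Hypothesis sFF : forall k, sigma_algebra setT (FF k).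
Hypothesis mFF : forall k E, FF k E -> measurable E.
Hypothesis FFS : forall k E, FF k E -> FF k.+1 E.
Variable G : nat -> nat -> set Omega.
Hypothesis FG : forall k j, FF k.+1 (G k j).
Hypothesis PG : forall k j E, FF k E ->
  (P (E `&` G k j) <= (expR (- j.+1%:R) * (4^-1 * 2^-1 ^+ j))%:E * P E)%E.

(** A product over the blocks of factors [1 + \sum_j exp (j + 1) \1_(G k j)].  When
    [G k j] is the event that a quantity [y k] exceeds [j + 1], such a factor
    dominates [exp (y k - 1)], while its conditional mean given the past is at
    most [3 / 2].  The series may diverge, hence the extended values. *)
Fixpoint weight (k : nat) (w : Omega) : \bar R :=
  if k is k'.+1 then
    (weight k' w + \sum_(j <oo) (expR j.+1%:R)%:E * (\1_(G k' j) w)%:E * weight k' w)%E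
  else 1%E.

Lemma weight_ge1 k w : (1%:E <= weight k w)%E.
Proof.
elim: k => [|k IH] //=; rewrite -[leLHS]adde0; apply: leeD => //.
apply: nneseries_ge0 => j _ _; rewrite !mule_ge0 ?lee_fin ?expR_ge0//.
exact: le_trans IH.
Qed.

Let w0 k w : (0 <= weight k w)%E.
Proof. exact: le_trans (weight_ge1 k w). Qed.

Let mmF k (A : set Omega) : FF k A ->
  measurable_fun [set: g_sigma_algebraType (FF k)] (fun w => (\1_A w)%:E : \bar R).
Proof.
move=> FA; apply/measurable_EFinP; apply: measurable_indic.
by rewrite [_.-measurable]sigma_algebra_id.
Qed.

Lemma weight_measurable k : measurable_in (FF k) (weight k).
Proof.
elim: k => [|k IH]; first by apply/(measurable_inP _ (sFF 0)); exact: measurable_cst.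
have mW : measurable_fun [set: g_sigma_algebraType (FF k.+1)] (weight k).
  by apply/(measurable_inP _ (sFF k.+1)) => U mU; apply: FFS; exact: IH.
apply/(measurable_inP _ (sFF k.+1)); apply: emeasurable_funD => //.
apply: ge0_emeasurable_sum => [j w _ _|j _].
  by rewrite !mule_ge0 ?lee_fin ?expR_ge0.
apply: emeasurable_funM => //; apply: measurable_funeM; exact: mmF.
Qed.

Let mweight k : measurable_fun setT (weight k).
Proof.
move=> _ U mU; rewrite setTI; apply: (@mFF k); exact: weight_measurable.
Qed.

(** The bound on [G k j] holds on every event of [FF k], and the weight is
    measurable for [FF k]. *)
Lemma weight_indic_le k j :
  (\int[P]_w ((\1_(G k j) w)%:E * weight k w) <=
   (expR (- j.+1%:R) * (4^-1 * 2^-1 ^+ j))%:E * \int[P]_w weight k w)%E.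
Proof.
set b := expR _ * _.
have b0 : 0 <= b by rewrite mulr_ge0 ?expR_ge0// mulr_ge0// exprn_ge0.
have mG : measurable (G k j) by exact: mFF (FG k j).
rewrite -ge0_integralZl_EFin//.
rewrite [leLHS](eq_integral (fun w => (\1_(G k j) w)%:E * `|weight k w|)%E); last first.
  by move=> w _; rewrite (gee0_abs (w0 k w)).
rewrite [leRHS](eq_integral (fun w => (cst b w)%:E * `|weight k w|)%E); last first.
  by move=> w _; rewrite (gee0_abs (w0 k w)).
apply: (@le_integral_weight R _ _ _ _ _ _ P P (weight k) (weight k) (\1_(G k j)) (cst b)
  _ _ _ _ _ _ (@abse R)) => //.
- move=> V mV; pose E := weight k @^-1` V.
  have FE : FF k E by exact: weight_measurable.
  have mE : measurable E by exact: mFF FE.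
  apply: (@le_trans _ _ (P (E `&` G k j))).
    rewrite le_eqVlt; apply/orP; left; apply/eqP.
    rewrite -[E `&` _]setIT -integral_indic//; last exact: measurableI.
    by apply: eq_integral => w _; rewrite -EFinM setIC indicI.
  apply: (le_trans (PG j FE)).
  rewrite ge0_integralZl_EFin//.
    have -> : (\int[P]_x (\1_V (weight k x))%:E = P E)%E by rewrite -[E]setIT -integral_indic.
    exact: lexx.
  by apply/measurable_EFinP; apply: (measurableT_comp (measurable_indic _)) => //.
Qed.

(** Each factor has conditional mean at most [1 + \sum_j 2 ^ - j / 4 = 3 / 2], which
    is at most [exp (1 / 2)]. *)
Lemma weight_mean k : (\int[P]_w weight k w <= (expR (k%:R / 2))%:E)%E.
Proof.
elim: k => [|k IH].
  rewrite mul0r expR0 /= integral_cst//= mul1e.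
  exact: probability_le1.
have mG j : measurable_fun setT (fun w => (\1_(G k j) w)%:E : \bar R).
  by apply/measurable_EFinP; apply: measurable_indic; exact: mFF (FG k j).
have mT j : measurable_fun setT (fun w => (expR j.+1%:R)%:E * (\1_(G k j) w)%:E * weight k w)%E.
  by apply: emeasurable_funM => //; exact: measurable_funeM.
have T0 j w : (0 <= (expR j.+1%:R)%:E * (\1_(G k j) w)%:E * weight k w)%E.
  by rewrite !mule_ge0 ?lee_fin ?expR_ge0.
rewrite /= ge0_integralD//; last 2 first.
- by move=> w _; apply: nneseries_ge0 => j _ _; exact: T0.
- by apply: ge0_emeasurable_sum => [j w _ _|j _]; [exact: T0|exact: mT].
rewrite integral_nneseries//.
set I := (\int[P]_w weight k w)%E in IH *.
have I0 : (0 <= I)%E by apply: integral_ge0.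
have step j : (\int[P]_w ((expR j.+1%:R)%:E * (\1_(G k j) w)%:E * weight k w) <=
    (4^-1 * 2^-1 ^+ j)%:E * I)%E.
  under eq_integral do rewrite -muleA.
  rewrite ge0_integralZl_EFin ?expR_ge0//; last 2 first.
  - by move=> w _; rewrite mule_ge0.
  - exact: emeasurable_funM.
  have := lee_wpmul2l (_ : (0 <= (expR j.+1%:R)%:E)%E) (weight_indic_le k j).
  rewrite lee_fin expR_ge0 => /(_ isT) /le_trans; apply.
  by rewrite muleA -EFinM mulrA -expRD subrr expR0 mul1r.
have series : (\sum_(j <oo) \int[P]_w ((expR j.+1%:R)%:E * (\1_(G k j) w)%:E * weight k w) <= 2^-1%:E * I)%E.
  apply: lime_le.
    by apply: is_cvg_nneseries => j _ _; apply: integral_ge0 => w _; exact: T0.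
  apply: nearW => M.
  apply: (@le_trans _ _ (\sum_(0 <= j < M) ((4^-1 * 2^-1 ^+ j)%:E * I))%E).
    by apply: lee_sum => j _; exact: step.
  rewrite -ge0_sume_distrl; last by move=> j _; rewrite lee_fin mulr_ge0// exprn_ge0.
  rewrite sumEFin; apply: lee_wpmul2r => //; rewrite lee_fin -mulr_sumr.
  by have := @sum_half_le R M; lra.
apply: (le_trans (leeD2l I series)).
apply: (@le_trans _ _ ((3 / 2)%:E * I)%E).
  rewrite -{1}[I]mul1e -ge0_muleDl// ?lee_fin// -EFinD.
  by have -> : 1 + 2^-1 = 3 / 2 :> R by field.
apply: (@le_trans _ _ ((3 / 2)%:E * (expR (k%:R / 2))%:E)%E).
  by apply: lee_wpmul2l => //; rewrite lee_fin divr_ge0.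
rewrite -EFinM lee_fin.
have -> : k.+1%:R / 2 = k%:R / 2 + 1 / 2 :> R by rewrite -natr1 mulrDl.
rewrite expRD mulrC; apply: ler_wpM2l; first exact: expR_ge0.
by have := expR_ge1Dx (1 / 2 : R); lra.
Qed.

(** Markov's inequality and the Borel-Cantelli lemma, since
    [exp (k / 2) / exp k] is summable. *)
Lemma weight_eventually :
  {ae P, forall w, exists n0, forall k, (n0 <= k)%N -> (weight k w < (expR k%:R)%:E)%E}.
Proof.
pose A k := [set w | ((expR k%:R)%:E <= weight k w)%E].
have mA k : measurable (A k).
  rewrite (_ : A k = weight k @^-1` `[(expR k%:R)%:E, +oo[%classic); last first.
    by apply/seteqP; split => w /=; rewrite in_itv/= andbT.
  by rewrite -[_ @^-1` _]setTI; apply: mweight => //; exact: emeasurable_itv.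
have PA k : (P (A k) <= (expR (- (k%:R / 2)))%:E)%E.
  have e0 : 0 < expR k%:R :> R by exact: expR_gt0.
  have h : ((expR k%:R)%:E * P (A k) <= \int[P]_w weight k w)%E.
    rewrite -[A k]setIT -integral_indic// -ge0_integralZl_EFin ?(ltW e0)//; last first.
      by apply/measurable_EFinP; exact: measurable_indic.
    apply: ge0_le_integral => //.
    - have mI : measurable_fun setT (fun w => (\1_(A k) w)%:E : \bar R).
        by apply/measurable_EFinP; exact: measurable_indic.
      exact: measurable_funeM.
    - by move=> w _; rewrite indicE; case: (boolP (w \in A k)) => [|_];
        [rewrite inE /= mule1|rewrite mule0].
  have := le_trans h (weight_mean k).
  rewrite -lee_pdivlMl// -EFinM => /le_trans; apply.
  rewrite lee_fin -expRN -expRD ler_expR; lra.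
have fin : (\sum_(k <oo) P (A k) < +oo)%E.
  have e10 : 0 < expR (- 2^-1 : R) by exact: expR_gt0.
  have e11 : expR (- 2^-1 : R) < 1 by rewrite expR_lt1 oppr_lt0 invr_gt0.
  set q := expR (- 2^-1) in e10 e11.
  apply: (@series_bounded_lty _ _ (1 / (1 - q))) => // n.
  apply: (@le_trans _ _ (\sum_(0 <= k < n) (q ^+ k)%:E)%E).
    apply: lee_sum => k _; apply: (le_trans (PA k)).
    by rewrite lee_fin /q -expRM_natl mulrN.
  rewrite sumEFin lee_fin ler_pdivlMr; last by lra.
  have -> : (\sum_(0 <= k < n) q ^+ k) * (1 - q) = 1 - q ^+ n.
    elim: n => [|n IH]; first by rewrite big_geq// mul0r expr0 subrr.
    by rewrite big_nat_recr//= mulrDl IH exprS; ring.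
  by rewrite lerBlDr lerDl exprn_ge0// ltW.
apply: filterS (borel_cantelli_ae mA fin) => w [n0 hn0]; exists n0 => k hk.
by rewrite ltNge; apply/negP => h; exact: (hn0 k hk).
Qed.

(** If [y = z n ^ 2 / del > 1] lies in ]j + 1, j + 2], then [G n j] occurs and the
    single term [exp (j + 1)] of the factor is at least [exp (y - 1)]. *)
Lemma weight_ge (w : Omega) (del : R) (z : nat -> R) : 0 < del ->
  (forall k j, ~ G k j w -> z k ^+ 2 <= j.+1%:R * del) ->
  forall n, ((expR (\sum_(k < n) (z k ^+ 2 / del - 1)))%:E <= weight n w)%E.
Proof.
move=> del0 hz; elim=> [|n IH]; first by rewrite big_ord0 expR0.
rewrite big_ord_recr/=; set S := \sum_(k < n) _ in IH *.
set y := z n ^+ 2 / del.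
have T0 j : (0 <= (expR j.+1%:R)%:E * (\1_(G n j) w)%:E * weight n w)%E.
  by rewrite !mule_ge0 ?lee_fin ?expR_ge0.
have [y1|y1] := leP y 1.
  apply: (@le_trans _ _ (weight n w)).
    by apply: le_trans IH; rewrite lee_fin ler_expR; lra.
  by rewrite -[leLHS]adde0; apply: leeD2l; apply: nneseries_ge0 => j _ _; exact: T0.
have y0 : 0 <= y by lra.
have /truncn_itv/andP[k1 k2] := y0.
have kpos : (0 < Num.truncn y)%N by rewrite -ltnS -(ltr_nat R); lra.
have [j jE] : exists j, y <= j.+2%:R /\ j.+1%:R < y.
  have [e|ne] := eqVneq (Num.truncn y)%:R y.
    case: (Num.truncn y) kpos k1 k2 e => // -[|k] _ h1 h2 e; first by move: y1; rewrite -e ltxx.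
    by exists k; rewrite -e lexx ltr_nat.
  case: (Num.truncn y) kpos k1 k2 ne => // k _ h1 h2 ne; exists k; split; first exact: ltW.
  by rewrite lt_neqAle ne h1.
have Gj : G n j w.
  apply: contrapT => nG; have := hz n j nG.
  rewrite leNgt => /negP; apply; have [_] := jE.
  by rewrite /y ltr_pdivlMr.
apply: (@le_trans _ _ ((expR j.+1%:R)%:E * (\1_(G n j) w)%:E * weight n w)%E).
  rewrite indicE mem_set// mule1.
  apply: (@le_trans _ _ ((expR j.+1%:R)%:E * (expR S)%:E)%E); last first.
    by apply: lee_wpmul2l; rewrite ?lee_fin ?expR_ge0.
  rewrite -EFinM lee_fin -expRD ler_expR.
  by have [h _] := jE; move: h; rewrite -natr1; lra.
apply: (@le_trans _ _ (\sum_(i <oo) (expR i.+1%:R)%:E * (\1_(G n i) w)%:E * weight n w)%E); last first.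
  by rewrite -[leLHS]add0e; apply: leeD2r; exact: w0.
rewrite -[leLHS]add0e; apply: (@le_trans _ _
  (\sum_(0 <= i < j.+1) (expR i.+1%:R)%:E * (\1_(G n i) w)%:E * weight n w)%E).
  by rewrite big_nat_recr//=; apply: leeD2r; apply: sume_ge0 => i _; exact: T0.
by apply: nneseries_lim_ge => i _ _; exact: T0.
Qed.

End chernoff_blocks.

(** * The series and the oscillations *)

Section series_criterion.
Context {R : realType} {dis : measure_display} {Omega : measurableType dis}.
Variable P : probability Omega R.
Variables (d r : nat) (F : R -> set (set Omega)).
Hypothesis d_gt0 : (0 < d)%N.
Hypothesis F_filtration : filtration F.
Variable sigma : R -> 'M[R]_(d, r).
Hypothesis sigma_cont : {within halfline, continuous sigma}.
Variable N : R -> 'I_d -> Omega -> R.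
Hypothesis tails : increment_tails P F (rowvar sigma) N.
Variable h : R.
Hypothesis h_gt0 : 0 < h.
Hypothesis variance_cvg0 : block_variance h sigma n @[n --> \oo] --> 0.

Local Notation v := (block_variance h sigma).
Local Notation G n x := (block_exceed N (n%:R * h) (n.+1%:R * h) x).

Let nh0 n : 0 <= n%:R * h.
Proof. by rewrite mulr_ge0// ltW. Qed.

Let nhS n : n%:R * h <= n.+1%:R * h.
Proof. by apply: ler_wpM2r; [exact: ltW|rewrite ler_nat]. Qed.

Let v0 n : 0 <= v n.
Proof. exact: block_variance_ge0. Qed.

Let d1 : 1 <= @GRing.natmul R 1 d.
Proof. by rewrite ler1n. Qed.

Let dp : 0 < @GRing.natmul R 1 d.
Proof. by rewrite ltr0n. Qed.

Let v_small (e : R) : 0 < e -> exists n0, forall n, (n0 <= n)%N -> v n < e.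
Proof.
move=> e0; have [n0 _ hn] : \forall n \near \oo, v n < e.
  exact: (cvgr_lt _ variance_cvg0).
by exists n0.
Qed.

Lemma block_exceed_measurable n x : measurable (G n x).
Proof.
apply: (filtration_measurable F_filtration (nh0 n.+1)).
exact: (block_exceed_in F_filtration tails).
Qed.

Lemma block_exceed_tail n x u E : F (n%:R * h) E -> 0 < x -> 2 * v n < u ->
  (P (E `&` G n (2 * x)) <= (d%:R * (4 * expR (- (x ^+ 2 / (8 * u)))))%:E * P E)%E.
Proof.
move=> FE x0 vu; apply: (block_exceed_bound F_filtration sigma_cont tails) => // i.
by apply: le_lt_trans vu; apply: ler_wpM2l => //; apply: rowvar_le_block => //; exact: ltW.
Qed.

Definition series_term (eps : R) (n : nat) : R :=
  if v n == 0 then 0 else Num.sqrt (v n) * expR (- (eps ^+ 2 / (2 * v n))).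

Lemma series_term_ge0 eps n : 0 <= series_term eps n.
Proof. by rewrite /series_term; case: ifPn => // _; rewrite mulr_ge0 ?sqrtr_ge0 ?expR_ge0. Qed.

Let le_sqrt (u : R) : 0 <= u -> u <= 1 -> u <= Num.sqrt u.
Proof.
move=> u0 u1; rewrite -{1}(sqr_sqrtr u0) expr2 -[leRHS]mulr1.
apply: ler_wpM2l; first exact: sqrtr_ge0.
by rewrite -[leRHS]sqrtr1; apply: ler_wsqrtr.
Qed.

(** With the threshold [10 eps] the Gaussian exponent beats [eps ^ 2 / (2 v)] by
    [13 / 12] of it, and the surplus factor is [O (v)], hence [O (sqrt v)].  If
    [v = 0] the bound holds with every positive number in place of the variance,
    so that the probability is zero. *)
Lemma exceed_le_series_term eps n : 0 < eps -> v n <= 1 ->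
  (P (G n (10 * eps)) <= (d%:R * 8 / eps ^+ 2 * series_term eps n)%:E)%E.
Proof.
move=> eps0 v1; have mG := block_exceed_measurable n (10 * eps).
have FT : F (n%:R * h) setT.
  rewrite -(filtration_measurableE F_filtration (nh0 n)); exact: measurableT.
have e50 : 0 < 5 * eps by lra.
have ee : 0 < eps ^+ 2 by rewrite exprn_gt0.
have bnd u : 2 * v n < u ->
    (P (G n (10 * eps)) <= (d%:R * (4 * expR (- ((5 * eps) ^+ 2 / (8 * u)))))%:E)%E.
  move=> vu; have := block_exceed_tail FT e50 vu.
  by rewrite setTI probability_setT mule1; have -> : 2 * (5 * eps) = 10 * eps by ring.
rewrite /series_term; case: eqP => [vz|/eqP vn0].
  rewrite mulr0; apply/lee_addgt0Pr => /= e e0; rewrite add0e.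
  pose u := e * eps ^+ 2 / (2 * d%:R).
  have u0 : 0 < u by rewrite /u divr_gt0 ?mulr_gt0.
  have vu : 2 * v n < u by rewrite vz mulr0.
  apply: (le_trans (bnd u vu)); rewrite lee_fin.
  have y0 : 0 < (5 * eps) ^+ 2 / (8 * u) by rewrite divr_gt0 ?exprn_gt0// mulr_gt0.
  apply: (@le_trans _ _ (d%:R * (4 * ((5 * eps) ^+ 2 / (8 * u))^-1))).
    by do 2 (apply: ler_wpM2l => //); exact: expRN_le.
  have -> : d%:R * (4 * ((5 * eps) ^+ 2 / (8 * u))^-1) = e * (16 / 25).
    by rewrite /u; field; rewrite !gt_eqF.
  lra.
have vp : 0 < v n by rewrite lt_neqAle eq_sym vn0 v0.
have vu : 2 * v n < 3 * v n by lra.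
apply: (le_trans (bnd _ vu)); rewrite lee_fin.
set y := eps ^+ 2 / (2 * v n).
have y0 : 0 < y by rewrite divr_gt0// mulr_gt0.
have -> : (5 * eps) ^+ 2 / (8 * (3 * v n)) = y + y * (13 / 12).
  by rewrite /y; field; rewrite gt_eqF.
rewrite opprD expRD.
have h1 : expR (- (y * (13 / 12))) <= y^-1.
  apply: (le_trans (expRN_le _)); first by lra.
  by rewrite lef_pV2 ?posrE//; lra.
have -> : d%:R * 8 / eps ^+ 2 * (Num.sqrt (v n) * expR (- y)) =
    d%:R * (4 * (expR (- y) * (2 / eps ^+ 2 * Num.sqrt (v n)))).
  by field; rewrite gt_eqF.
do 2 (apply: ler_wpM2l => //); apply: ler_wpM2l; first exact: expR_ge0.
apply: (le_trans h1).
have -> : y^-1 = 2 / eps ^+ 2 * v n by rewrite /y; field; rewrite !gt_eqF.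
by apply: ler_wpM2l; [rewrite divr_ge0// ltW|exact: le_sqrt].
Qed.

Let sum_shift (u : nat -> R) m n :
  \sum_(m <= k < m + n) u k = \sum_(0 <= k < n) u (m + k)%N.
Proof. by rewrite -{1}[m]add0n big_addn addKn; under eq_bigr do rewrite addnC. Qed.

Lemma series_partial_le eps m n :
  (0 < m)%N -> (S' h sigma eps < +oo)%E ->
  \sum_(0 <= k < n) series_term eps (m + k) <= fine (S' h sigma eps).
Proof.
move=> m0 Sf; have t0 k : (0 <= (series_term eps k)%:E)%E by rewrite lee_fin series_term_ge0.
have S0 : (0 <= S' h sigma eps)%E by apply: nneseries_ge0 => k _ _; exact: t0.
rewrite -lee_fin fineK ?ge0_fin_numE//.
apply: (@le_trans _ _ (\sum_(1 <= k < m + n) (series_term eps k)%:E)%E); last first.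
  by apply: nneseries_lim_ge => k _ _; exact: t0.
rewrite sumEFin lee_fin [leRHS](big_cat_nat _ (n := m)) ?leq_addr//=.
by rewrite (sum_shift _ m n) lerDr; apply: sumr_ge0 => k _; exact: series_term_ge0.
Qed.

(** The terms of the series bound the probabilities in the Borel-Cantelli
    lemma. *)
Lemma series_finite_exceed eps : 0 < eps -> (S' h sigma eps < +oo)%E ->
  {ae P, forall w, exists n0, forall n, (n0 <= n)%N -> ~ G n (10 * eps) w}.
Proof.
move=> eps0 Sf; have [n1 hn1] := v_small (ltr01 : 0 < 1 :> R).
pose m := n1.+1.
have C0 : 0 <= d%:R * 8 / eps ^+ 2 :> R.
  by rewrite mulr_ge0 ?invr_ge0 ?exprn_ge0 ?(ltW eps0)// mulr_ge0.
have mG k : measurable (G (m + k)%N (10 * eps)) by exact: block_exceed_measurable.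
have fin : (\sum_(k <oo) P (G (m + k)%N (10 * eps)) < +oo)%E.
  apply: (@series_bounded_lty _ _ (d%:R * 8 / eps ^+ 2 * fine (S' h sigma eps))) => // n.
  apply: (@le_trans _ _ (\sum_(0 <= k < n) (d%:R * 8 / eps ^+ 2 * series_term eps (m + k))%:E)%E).
    apply: lee_sum => k _; apply: exceed_le_series_term => //; apply: ltW; apply: hn1.
    by rewrite /m addSn ltnW// ltnS leq_addr.
  rewrite sumEFin lee_fin -mulr_sumr; apply: ler_wpM2l => //.
  exact: series_partial_le.
apply: filterS (borel_cantelli_ae mG fin) => w [n0 hn0]; exists (m + n0)%N => n hn.
have mn : (m <= n)%N by apply: leq_trans hn; rewrite leq_addr.
rewrite -(subnKC mn); apply: hn0.
by rewrite -(leq_add2l m) subnKC.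
Qed.

Definition jump (x : R) (n : nat) : set Omega :=
  [set w | exists2 i, i \in enum 'I_d & x < N (n.+1%:R * h) i w - N (n%:R * h) i w].

Let jump_in x n : F (n.+1%:R * h) (jump x n).
Proof.
rewrite -(filtration_measurableE F_filtration (nh0 n.+1)).
apply: (@measurable_exists_in _ (g_sigma_algebraType (F (n.+1%:R * h)))) => i.
apply: (@measurable_gt _ _ (g_sigma_algebraType (F (n.+1%:R * h)))
  (fun w => N (n.+1%:R * h) i w - N (n%:R * h) i w)).
have sF : sigma_algebra setT (F (n.+1%:R * h)) by case: F_filtration => hF _ _; exact: hF.
apply: measurable_funB; apply/(measurable_inP _ sF); first exact: (tails_adapted tails).
by apply: (measurable_in_le F_filtration _ (nhS n)) => //; exact: (tails_adapted tails).
Qed.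

(** Some coordinate carries the fraction [1 / d] of the block variance; the
    threshold is scaled so that its lower tail has an exponent of at most
    [eps ^ 2 / (2 v)]. *)
Lemma jump_ge_series_term eps n E : 0 < eps -> v n <= 1 ->
  3 * v n <= 4 * (eps / (12 * d%:R)) ^+ 2 -> F (n%:R * h) E ->
  ((series_term eps n / 4)%:E * P E <= P (E `&` jump (eps / (12 * d%:R) / 2) n))%E.
Proof.
move=> eps0 v1 vx FE; set x := eps / (12 * d%:R) in vx *.
have x0 : 0 < x by rewrite divr_gt0// mulr_gt0//; lra.
rewrite /series_term; case: eqP => [vz|/eqP vn0]; first by rewrite mul0r mul0e.
have vp : 0 < v n by rewrite lt_neqAle eq_sym vn0 v0.
have [i hi] := block_le_rowvar sigma_cont n (ltW h_gt0) d_gt0.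
have iv := rowvar_le_block sigma_cont i n (ltW h_gt0).
have Vp : 0 < rowvar sigma i (n%:R * h) (n.+1%:R * h).
  by apply: lt_le_trans hi; rewrite divr_gt0//; lra.
have Vx : 3 * rowvar sigma i (n%:R * h) (n.+1%:R * h) <= 4 * x ^+ 2 by lra.
have L := tails_lower tails (nh0 n) (nhS n) FE x0 Vp Vx.
have mE : measurable E by exact: (filtration_measurable F_filtration (nh0 n) FE).
apply: (@le_trans _ _ (P (E `&` [set w | x / 2 < N (n.+1%:R * h) i w - N (n%:R * h) i w]))); last first.
  have sF : sigma_algebra setT (F (n.+1%:R * h)) by case: F_filtration => hF _ _; exact: hF.
  have mN t : 0 <= t -> measurable_fun setT (N t i).
    by move=> t0; exact: (measurable_in_fun F_filtration t0 (tails_adapted tails i t0)).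
  apply: le_measure; rewrite ?inE.
  - by apply: measurableI => //; apply: measurable_gt; apply: measurable_funB; exact: mN.
  - by apply: measurableI => //; exact: (filtration_measurable F_filtration (nh0 n.+1) (jump_in _ _)).
  - by move=> w [Ew hw]; split => //; exists i; rewrite ?mem_enum.
apply: le_trans L; apply: lee_wpmul2r => //; rewrite lee_fin ler_wpM2r//.
rewrite -[leRHS]mul1r; apply: ler_pM; rewrite ?sqrtr_ge0 ?expR_ge0//.
  by rewrite -[leRHS]sqrtr1; apply: ler_wsqrtr.
rewrite ler_expR lerN2.
apply: (@le_trans _ _ (64 * x ^+ 2 / (v n / d%:R))).
  apply: ler_wpM2l; first by rewrite mulr_ge0// exprn_ge0// ltW.
  by rewrite lef_pV2 ?posrE// divr_gt0//; lra.
have -> : 64 * x ^+ 2 / (v n / d%:R) = (eps ^+ 2 / v n) * (4 / 9) * d%:R^-1.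
  by rewrite /x; field; rewrite !gt_eqF.
have -> : eps ^+ 2 / (2 * v n) = (eps ^+ 2 / v n) * 2^-1 * 1.
  by field; rewrite gt_eqF.
have q0 : 0 <= eps ^+ 2 / v n by rewrite divr_ge0// exprn_ge0// ltW.
apply: ler_pM; [by apply: mulr_ge0 => //; lra|by rewrite invr_ge0 ltW| |].
  by apply: ler_wpM2l => //; lra.
by rewrite invf_le1.
Qed.

(** The second half of the Borel-Cantelli lemma, with conditional lower bounds in
    place of independence: the probability of seeing no jump from block [m] on is
    at most the product of the [1 - term / 4], hence at most [exp (- sum / 4)]. *)
Lemma series_infinite_jump eps : 0 < eps -> S' h sigma eps = +oo%E ->
  {ae P, forall w, forall n0, exists n, (n0 <= n)%N /\ jump (eps / (12 * d%:R) / 2) n w}.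
Proof.
move=> eps0 Soo; set y := _ / 2.
have x0 : 0 < 4 * (eps / (12 * d%:R)) ^+ 2 / 3.
  by rewrite divr_gt0// mulr_gt0// exprn_gt0// divr_gt0// mulr_gt0//; lra.
have [n1 hn1] := v_small (ltr01 : 0 < 1 :> R).
have [n2 hn2] := v_small x0.
pose m0 := maxn n1 n2.
pose E m := fix E j := if j is j'.+1 then E j' `&` ~` jump y (m + j')%N else [set: Omega].
have FE m j : F ((m + j)%:R * h) (E m j).
  elim: j => [|j IH].
    by rewrite -(filtration_measurableE F_filtration (nh0 _)); exact: measurableT.
  rewrite addnS -(filtration_measurableE F_filtration (nh0 _)) /=.
  apply: measurableI.
    rewrite filtration_measurableE//; exact: (filtration_le F_filtration (nh0 _) (nhS _) IH).
  by apply: measurableC; rewrite filtration_measurableE//; exact: jump_in.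
have mE m j : measurable (E m j) by exact: (filtration_measurable F_filtration (nh0 _) (FE m j)).
have mJ k : measurable (jump y k) by exact: (filtration_measurable F_filtration (nh0 _) (jump_in _ _)).
pose tm := series_term eps.
have PE m j : (m0 <= m)%N ->
    fine (P (E m j)) <= expR (- (\sum_(0 <= k < j) tm (m + k)%N / 4)).
  move=> hm; elim: j => [|j IH].
    by rewrite big_geq// oppr0 expR0 probability_setT.
  have l0 : 0 <= tm (m + j)%N / 4 by rewrite divr_ge0// series_term_ge0.
  have hmj : (m0 <= m + j)%N by exact: leq_trans (leq_addr _ _).
  have /andP[h1 h2] : (n1 <= m + j)%N && (n2 <= m + j)%N by rewrite -geq_max.
  have J : ((tm (m + j)%N / 4)%:E * P (E m j) <= P (E m j `&` jump y (m + j)%N))%E.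
    apply: jump_ge_series_term => //; first by apply: ltW; exact: hn1.
    by have := hn2 _ h2; lra.
  have split_ : P (E m j) = (P (E m j `&` jump y (m + j)%N) + P (E m j.+1))%E.
    by rewrite (measureDI P (mE m j) (mJ (m + j)%N)) addeC /= setDE.
  move: J split_; rewrite -(fineK (fin_num_measure P _ (mE m j))).
  rewrite -(fineK (fin_num_measure P _ (mE m j.+1))).
  rewrite -(fineK (fin_num_measure P _ (measurableI _ _ (mE m j) (mJ (m + j)%N)))).
  rewrite -EFinM lee_fin -EFinD => J [split_].
  rewrite big_nat_recr//= opprD expRD.
  have := expR_ge1Dx (- (tm (m + j)%N / 4)) => ex.
  apply: (@le_trans _ _ (fine (P (E m j)) * expR (- (tm (m + j)%N / 4)))).
    apply: (@le_trans _ _ (fine (P (E m j)) * (1 + - (tm (m + j)%N / 4)))); first by lra.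
    by apply: ler_wpM2l => //; exact: fine_ge0.
  by apply: ler_wpM2r => //; exact: expR_ge0.
pose Q m := \bigcap_j E m j.
have mQ m : measurable (Q m) by apply: bigcapT_measurable.
have Q0 m : (m0 <= m)%N -> P (Q m) = 0%E.
  move=> hm; apply/eqP; rewrite eq_le measure_ge0 andbT leNgt; apply/negP => Qpos.
  have fQ := fin_num_measure P _ (mQ m).
  set p := fine (P (Q m)).
  have p0 : 0 < p by apply: fine_gt0; rewrite Qpos ltey_eq fQ.
  have bnd j : \sum_(0 <= k < j) tm (m + k)%N <= 4 / p.
    have pj : p <= expR (- (\sum_(0 <= k < j) tm (m + k)%N / 4)).
      apply: le_trans (PE m j hm); apply: fine_le => //; first exact: fin_num_measure.
      by apply: le_measure; rewrite ?inE// => w; exact.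
    have s0 : 0 <= \sum_(0 <= k < j) tm (m + k)%N by apply: sumr_ge0 => k _; exact: series_term_ge0.
    move: pj; rewrite -mulr_suml; set s := \sum_(0 <= k < j) _ in s0 * => pj.
    move: s0; rewrite le_eqVlt => /predU1P[<-|s0]; first by rewrite divr_ge0// ltW.
    have := le_trans pj (expRN_le (_ : 0 < s / 4)); rewrite divr_gt0// => /(_ isT).
    rewrite invf_div ler_pdivlMr// => ps; rewrite ler_pdivlMr//; lra.
  suff : (S' h sigma eps < +oo)%E by rewrite Soo ltxx.
  apply: (@le_lt_trans _ _ (\sum_(0 <= k < m.+1) tm k + 4 / p)%:E); last by rewrite ltry.
  have t0 k : (0 <= (tm k)%:E)%E by rewrite lee_fin series_term_ge0.
  apply: lime_le; first by apply: is_cvg_nneseries => k _ _; exact: t0.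
  apply: nearW => n.
  rewrite sumEFin lee_fin.
  apply: (@le_trans _ _ (\sum_(0 <= k < m + n) tm k)).
    case: n => [|n]; first by rewrite big_geq// sumr_ge0// => k _; exact: series_term_ge0.
    rewrite [leRHS](big_cat_nat _ (n := 1)) ?addnS//=.
    rewrite [X in _ <= _ + X](big_cat_nat _ (n := n.+1)) ?ltnS ?leq_addl//=.
    by rewrite addrCA lerDl addr_ge0//; apply: sumr_ge0 => k _; exact: series_term_ge0.
  rewrite (big_cat_nat _ (n := m)) ?leq_addr//=; apply: lerD.
    by rewrite big_nat_recr//= lerDl series_term_ge0.
  by rewrite (sum_shift _ m n); exact: bnd.
have : {ae P, forall w, forall j, ~ Q (m0 + j)%N w}.
  apply/ae_foralln => j; exists (Q (m0 + j)%N); split => //; first by apply: Q0; rewrite leq_addr.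
  by move=> w /= /contrapT.
apply: filterS => w hw n0; apply: contrapT => nex; apply: (hw n0).
move=> j _; elim: j => [|j IH] //=; split => // hj; apply: nex; exists (m0 + n0 + j)%N; split => //.
by rewrite -addnA addnCA leq_addr.
Qed.

(** As the block variances tend to zero, from some block on the square of the
    oscillation divided by [del] has the exponential tails that the weights
    require. *)
Lemma exceed_average (del : R) : 0 < del ->
  {ae P, forall w, forall z : nat -> R, (forall k, 0 <= z k) ->
    (forall k x, 0 <= x -> ~ G k x w -> z k <= x) ->
    exists C, forall n, \sum_(k < n) z k ^+ 2 <= 2 * del * n%:R + C}.
Proof.
(* The constant [u] turns the exponent [(j + 1) del / (32 u)] of the tail bound at
   the level [sqrt ((j + 1) del)] into [(j + 1) (1 + 16 d)]; the part [16 d (j + 1)]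
   pays for the factor [4 d] and for the geometric sequence. *)
move=> del0; pose u := del / (32 * (1 + 16 * d%:R)).
have u0 : 0 < u by rewrite divr_gt0// mulr_gt0//; lra.
have [m0 hm0] := v_small (divr_gt0 u0 (ltr0Sn R 1)).
pose FF k := F ((m0 + k)%:R * h).
pose GG k j := G (m0 + k)%N (2 * (Num.sqrt (j.+1%:R * del) / 2)).
have sFF k : sigma_algebra setT (FF k) by case: F_filtration => hF _ _; exact: hF.
have mFF k E : FF k E -> measurable E by exact: (filtration_measurable F_filtration (nh0 _)).
have FFS k E : FF k E -> FF k.+1 E.
  by rewrite /FF addnS; exact: (filtration_le F_filtration (nh0 _) (nhS _)).
have FG k j : FF k.+1 (GG k j).
  by rewrite /FF addnS; exact: (block_exceed_in F_filtration tails).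
have PG k j E : FF k E ->
  (P (E `&` GG k j) <= (expR (- j.+1%:R) * (4^-1 * 2^-1 ^+ j))%:E * P E)%E.
  move=> FE; have jd : 0 < j.+1%:R * del by rewrite mulr_gt0.
  have y0 : 0 < Num.sqrt (j.+1%:R * del) / 2 by rewrite divr_gt0// sqrtr_gt0.
  have vu : 2 * v (m0 + k)%N < u by have := hm0 _ (leq_addr k m0); lra.
  apply: (le_trans (block_exceed_tail FE y0 vu)); apply: lee_wpmul2r => //; rewrite lee_fin.
  have -> : (Num.sqrt (j.+1%:R * del) / 2) ^+ 2 / (8 * u) = j.+1%:R + 16 * d%:R * j.+1%:R.
    rewrite expr_div_n sqr_sqrtr ?(ltW jd)// /u; field; rewrite !gt_eqF//; lra.
  rewrite opprD expRD.
  have -> : d%:R * (4 * (expR (- j.+1%:R) * expR (- (16 * d%:R * j.+1%:R)))) =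
    expR (- j.+1%:R) * (d%:R * 4 * expR (- (16 * d%:R * j.+1%:R))) :> R by ring.
  apply: ler_wpM2l; first exact: expR_ge0.
  have e1 : expR (- (16 * d%:R * j.+1%:R)) <= expR (- (16 * d%:R)) * expR (- 1) ^+ j :> R.
    rewrite -expRM_natl -expRD ler_expR -(@natr1 R j).
    have : (j%:R : R) <= d%:R * j%:R by rewrite -{1}[j%:R]mul1r; apply: ler_wpM2r.
    by have := ler0n R j; lra.
  have e2 : expR (- (16 * d%:R)) <= (16 * d%:R)^-1 :> R by apply: expRN_le; rewrite mulr_gt0.
  have e3 : expR (- 1) ^+ j <= 2^-1 ^+ j :> R.
    apply: lerXn2r; rewrite ?nnegrE ?expR_ge0//.
    by rewrite expRN lef_pV2 ?posrE ?expR_gt0//; have := expR_ge1Dx (1 : R); lra.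
  apply: (@le_trans _ _ (d%:R * 4 * ((16 * d%:R)^-1 * 2^-1 ^+ j))).
    apply: ler_wpM2l; first by rewrite mulr_ge0.
    apply: (le_trans e1); apply: ler_pM; [exact: expR_ge0| |exact: e2|exact: e3].
    by apply: exprn_ge0; exact: expR_ge0.
  rewrite le_eqVlt; apply/orP; left; apply/eqP; field.
  by rewrite gt_eqF//; exact: dp.
apply: filterS (weight_eventually sFF mFF FFS FG PG) => w [n0 hn0] z z0 hz.
have zG k j : ~ GG k j w -> z (m0 + k)%N ^+ 2 <= j.+1%:R * del.
  move=> nG; have jd : 0 <= j.+1%:R * del by rewrite mulr_ge0// ltW.
  have s0 := sqrtr_ge0 (j.+1%:R * del).
  rewrite -[leRHS](sqr_sqrtr jd); apply: lerXn2r; rewrite ?nnegrE//.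
  by apply: (hz (m0 + k)%N _ s0) => hG; apply: nG; rewrite /GG [2 * (_ / 2)]mulrC divfK.
have W n := weight_ge (z := fun k => z (m0 + k)%N) del0 zG n.
exists (\sum_(k < m0) z k ^+ 2 + 2 * del * n0%:R) => n.
have big : \sum_(k < n0 + n) z (m0 + k)%N ^+ 2 <= 2 * del * (n0 + n)%:R.
  have := le_lt_trans (W (n0 + n)%N) (hn0 _ (leq_addr n n0)).
  rewrite lte_fin ltr_expR sumrB -mulr_suml sumr_const card_ord.
  rewrite -[X in _ - X]mulr_natl mulr1 ltrBlDr ltr_pdivrMr// => lt.
  by apply: ltW; apply: lt_le_trans lt _; rewrite -mulr2n -mulr_natl; lra.
apply: (@le_trans _ _ (\sum_(k < m0 + (n0 + n)) z k ^+ 2)).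
  rewrite -!(big_mkord predT (fun k => z k ^+ 2)).
  rewrite [leRHS](big_cat_nat _ (n := n)) ?leq_addl//=; last by rewrite addnA leq_addl.
  by rewrite lerDl; apply: sumr_ge0 => k _; exact: sqr_ge0.
rewrite big_split_ord/= addrCA; apply: lerD => //.
by move: big; rewrite natrD mulrDr addrC.
Qed.

End series_criterion.

(** * Long-time behaviour of paths *)

Section long_time.
Context {R : realType} {n : nat}.
Implicit Types x : R -> 'cV[R]_n.+1.

Lemma frobenius_col (v : 'cV[R]_n.+1) : frobenius v ^+ 2 = \sum_i v i ord0 ^+ 2.
Proof. by rewrite frobenius_sqr; apply: eq_bigr => i _; rewrite big_ord1. Qed.

Lemma frobenius_ge0 (v : 'cV[R]_n.+1) : 0 <= frobenius v.
Proof. exact: sqrtr_ge0. Qed.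

(** The estimates of paths are in the sup norm, the long-time quantities in the
    Euclidean one; each is bounded by a multiple of the other. *)
Lemma norm_le_frobenius (v : 'cV[R]_n.+1) : `|v| <= frobenius v.
Proof.
apply: norm_le_coord => [|i j]; first exact: frobenius_ge0.
rewrite (ord1 j) -(@ler_pXn2r _ 2) ?nnegrE ?frobenius_ge0// frobenius_col.
rewrite (bigD1 i)//= real_normK ?num_real// lerDl.
by apply: sumr_ge0 => k _; exact: sqr_ge0.
Qed.

Lemma frobenius_sqr_le (v : 'cV[R]_n.+1) : frobenius v ^+ 2 <= n.+1%:R * `|v| ^+ 2.
Proof.
rewrite frobenius_col; apply: (@le_trans _ _ (\sum_(i < n.+1) `|v| ^+ 2)).
  apply: ler_sum => i _; rewrite -(real_normK (num_real (v i ord0))).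
  by apply: lerXn2r; rewrite ?nnegrE//; exact: coord_le_norm.
by rewrite sumr_const card_ord mulr_natl.
Qed.

Lemma frobenius_le (v : 'cV[R]_n.+1) : frobenius v <= n.+1%:R * `|v|.
Proof.
rewrite -(@ler_pXn2r _ 2) ?nnegrE ?frobenius_ge0 ?mulr_ge0//.
apply: (le_trans (frobenius_sqr_le v)); rewrite exprMn; apply: ler_wpM2r; first exact: exprn_ge0.
by rewrite expr2 ler_peMr ?ler1n.
Qed.

Lemma limsup_norm_le x c : (\forall t \near +oo, `|x t| <= c) ->
  (limsup_norm x <= (n.+1%:R * c)%:E)%E.
Proof.
move=> xc; apply: (@le_trans _ _ (ereal_sup ((fun t => (frobenius (x t))%:E) @` [set t | `|x t| <= c]))).
  by apply: ereal_inf_lbound; exists [set t | `|x t| <= c].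
apply: ge_ereal_sup => _ [t /= xt <-]; rewrite lee_fin.
by apply: (le_trans (frobenius_le _)); apply: ler_wpM2l.
Qed.

Lemma limsup_norm_lt x a : (limsup_norm x < a%:E)%E -> \forall t \near +oo, `|x t| <= a.
Proof.
move=> /ereal_inf_lt[_ [V nV <-] Va].
apply: (@filterS _ (nbhs +oo) _ V) => // t Vt; apply: (le_trans (norm_le_frobenius _)).
rewrite -lee_fin; apply: ltW; apply: le_lt_trans Va.
by apply: ereal_sup_ubound; exists t.
Qed.

Lemma liminf_norm_eq0 x :
  (forall e t0, 0 < e -> exists2 t, t0 <= t & `|x t| <= e) -> liminf_norm x = 0%E.
Proof.
move=> h; rewrite /liminf_norm limf_einfE; apply/eqP; rewrite eq_le; apply/andP; split.
  apply: ge_ereal_sup => _ [V [t0 [t0r hV]] <-].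
  apply/lee_addgt0Pr => e e0; rewrite add0e.
  have [t t0t xt] := h (e / n.+1%:R) (t0 + 1) (divr_gt0 e0 (ltr0Sn R n)).
  apply: (@le_trans _ _ (frobenius (x t))%:E).
    apply: ereal_inf_lbound; exists t => //; apply: hV.
    by apply: lt_le_trans t0t; rewrite ltrDl.
  rewrite lee_fin; apply: (le_trans (frobenius_le _)).
  by rewrite -ler_pdivlMl// mulrC.
apply: (@le_trans _ _ (ereal_inf ((fun t => (frobenius (x t))%:E) @` setT))).
  by apply: le_ereal_inf_tmp => _ [t _ <-]; rewrite lee_fin frobenius_ge0.
by apply: ereal_sup_ubound; exists setT => //; exact: filterT.
Qed.

Lemma continuous_frobenius_sqr x : continuous x -> continuous (fun s => frobenius (x s) ^+ 2).
Proof.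
move=> cx s; have -> : (fun s => frobenius (x s) ^+ 2) = (fun s => \sum_i x s i ord0 ^+ 2).
  by apply/funext => u; rewrite frobenius_col.
apply: cvg_big => [|i _]; first exact: add_continuous.
have h := continuous_coord (i := i) (j := ord0) cx (x := s).
by apply: (@cvgM R _ (nbhs s) _ (fun u => x u i ord0) (fun u => x u i ord0)); exact: h.
Qed.

Lemma time_average_cvg0 x (y : R -> 'cV[R]_n.+1) : continuous x ->
  (forall t, 0 <= t -> y t = x t) ->
  t^-1 * cint (fun s => `|x s| ^+ 2) 0 t @[t --> +oo] --> (0 : R) ->
  time_average_sq y t @[t --> +oo] --> 0.
Proof.
move=> cx xy h.
have cn : continuous (fun s => n.+1%:R * `|x s| ^+ 2).
  move=> s; apply: cvgM; first exact: cvg_cst.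
  apply: (@cvgM _ _ _ _ (fun s => `|x s|) (fun s => `|x s|)); exact: continuous_norm_mx.
have cn1 : continuous (fun s => `|x s| ^+ 2).
  move=> s; apply: (@cvgM _ _ _ _ (fun s => `|x s|) (fun s => `|x s|)); exact: continuous_norm_mx.
have h2 : n.+1%:R * (t^-1 * cint (fun s => `|x s| ^+ 2) 0 t) @[t --> +oo] --> (0 : R).
  by rewrite -[X in _ --> X](mulr0 n.+1%:R); apply: cvgM; [exact: cvg_cst|exact: h].
apply: (squeeze_cvgr _ (cvg_cst (0 : R)) h2).
exists 0; split => // t t0.
have yx : time_average_sq y t = t^-1 * cint (fun s => frobenius (x s) ^+ 2) 0 t.
  rewrite /time_average_sq; congr (_ * _); apply: eq_cint => s /andP[s0 _].
  by rewrite xy.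
rewrite yx; have t1 : 0 <= t^-1 by rewrite invr_ge0 ltW.
have cf := continuous_frobenius_sqr cx.
apply/andP; split.
  by rewrite mulr_ge0//; apply: Rintegral_ge0 => s _; exact: sqr_ge0.
rewrite mulrCA; apply: ler_wpM2l => //.
rewrite -RintegralZl//; last exact: cint_integrable.
by apply: le_cint => // s _; exact: frobenius_sqr_le.
Qed.

(** The primitive is Lipschitz on bounded intervals. *)
Lemma hat_cint_continuous (f : R -> R) : continuous f -> continuous (hat (cint f 0)).
Proof.
move=> cf t; apply/cvgrPdist_le => e e0.
pose s := Num.max 0 t; have s0 : 0 <= s by rewrite le_max lexx.
have s1 : 0 <= s + 1 by lra.
have [b _ hb] := EVT_max s1 (continuous_subspaceT (continuous_norm_comp cf)).
pose c := `|f b| + 1; have c0 : 0 < c by rewrite /c ltr_wpDl.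
have bnd u : 0 <= u <= s + 1 -> `|f u| <= c.
  by move=> hu; apply: (@le_trans _ _ `|f b|); [apply: hb; rewrite in_itv|rewrite /c lerDl].
have cm := max0_continuous (x := t).
have m0 : 0 < Num.min 1 (e / c) by rewrite lt_min ltr01 divr_gt0.
move/cvgrPdist_lt : cm => /(_ _ m0); apply: (@filterS _ (nbhs t)) => u.
rewrite lt_min => /andP[u1 u2]; rewrite /hat -/s in u1 u2 *.
set u' := Num.max 0 u in u1 u2 *; have u0 : 0 <= u' by rewrite le_max lexx.
have lip a a' : 0 <= a -> a <= a' -> a' <= s + 1 -> `|cint f 0 a' - cint f 0 a| <= c * (a' - a).
  move=> a0 aa' a's; rewrite (cint_cat cf a0 aa') addrC addKr.
  apply: norm_cint_le => // v /andP[v1 v2]; apply: bnd.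
  by apply/andP; split; lra.
move: u2; rewrite ltr_pdivlMr// => u2; apply: ltW; apply: le_lt_trans u2.
have [us|su] := leP u' s.
  by rewrite (@ger0_norm _ (s - u')) ?subr_ge0// mulrC; apply: lip => //; lra.
rewrite distrC (distrC s) (@ger0_norm _ (u' - s)) ?subr_ge0 ?(ltW su)// mulrC.
apply: lip => //; first exact: ltW.
by move: u1; rewrite distrC ger0_norm ?subr_ge0 ?(ltW su)//; lra.
Qed.

(** By the extreme value theorem the oscillation over a block is attained; the two
    clauses characterize it as a least upper bound. *)
Lemma block_oscillation (m : R -> 'cV[R]_n.+1) (h : R) : 0 <= h -> continuous m ->
  exists z : nat -> R, forall k,
    (forall u, k%:R * h <= u <= k.+1%:R * h -> `|m u - m (k%:R * h)| <= z k) /\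
    (forall c, (forall u, k%:R * h <= u <= k.+1%:R * h -> `|m u - m (k%:R * h)| <= c) ->
       z k <= c).
Proof.
move=> h0 cm.
suff /choice[z hz] : forall k : nat, exists z : R,
    (forall u, k%:R * h <= u <= k.+1%:R * h -> `|m u - m (k%:R * h)| <= z) /\
    (forall c, (forall u, k%:R * h <= u <= k.+1%:R * h -> `|m u - m (k%:R * h)| <= c) ->
       z <= c) by exists z.
move=> k.
have kh : k%:R * h <= k.+1%:R * h by apply: ler_wpM2r => //; rewrite ler_nat.
have co : continuous (fun u => `|m u - m (k%:R * h)|).
  apply: continuous_norm_mx => u; apply: cvgB; [exact: cm|exact: cvg_cst].
have [b bk hb] := EVT_max kh (continuous_subspaceT co).
exists `|m b - m (k%:R * h)|; split => [u uk|c]; last by apply; rewrite in_itv in bk.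
by apply: hb; rewrite in_itv.
Qed.

End long_time.

(** * The stochastic equation *)

Section solution.
Context {R : realType} {dis : measure_display} {Omega : measurableType dis}.
Variable P : probability Omega R.
Context {n r : nat}.
Variables (F : R -> set (set Omega)) (B : R -> Omega -> 'cV[R]_r).
Hypothesis F_filtration : filtration F.
Hypothesis B_brownian : brownian_motion P F B.
Variable sigma : R -> 'M[R]_(n.+1, r).
Hypothesis sigma_cont : {within halfline, continuous sigma}.
Variable A : R -> 'M[R]_n.+1.
Hypothesis A_cont : {within halfline, continuous A}.
Variable T : R.
Hypothesis T_gt0 : 0 < T.
Hypothesis A_periodic : forall t, 0 <= t -> A (t + T) = A t.
Variable Psi : R -> 'M[R]_n.+1.
Hypothesis Psi_sol : fundamental_solution A Psi.
Hypothesis rho_lt1 : spectral_radius (Psi T) < 1.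
Variable h : R.
Hypothesis h_gt0 : 0 < h.
Hypothesis variance_cvg0 : block_variance h sigma k @[k --> \oo] --> 0.

Let cA : continuous (hat A) := hat_continuous A_cont.

Let per (t : R) : 0 <= t -> hat A (t + T) = hat A t.
Proof. by move=> t0; rewrite !hat_id ?addr_ge0 ?(ltW T_gt0)//; exact: A_periodic. Qed.

Let cP : continuous (hat Psi).
Proof. by apply: hat_continuous; case: Psi_sol. Qed.

Let P0 : hat Psi 0 = 1%:M.
Proof. by rewrite hat_id//; case: Psi_sol. Qed.

Let dP (t : R) (y : 'cV[R]_n.+1) i : 0 < t ->
  is_derive t (1 : R) (fun s => (hat Psi s *m y) i ord0) ((hat A t *m hat Psi t *m y) i ord0).
Proof. by move=> t0; rewrite !(hat_id _ (ltW t0)); exact: fundamental_derive. Qed.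

Let rho : spectral_radius (hat Psi T) < 1.
Proof. by rewrite hat_id// ltW. Qed.

Local Notation G N k x := (block_exceed N (k%:R * h) (k.+1%:R * h) x).

(** The meeting point of the two halves of the proof: the path [x] satisfies the
    hypotheses of the deterministic estimates, and the oscillations [z] of its
    driving path are controlled by the events of the adapted process [N]. *)
Record controlled_path (N : R -> 'I_n.+1 -> Omega -> R) (xi : 'cV[R]_n.+1)
    (x m : R -> 'cV[R]_n.+1) (z : nat -> R) (w : Omega) : Prop := {
  controlled_continuous : continuous x ;
  controlled_eq : path_eq (hat A) x xi m ;
  controlled_ge0 : forall k, 0 <= z k ;
  controlled_block : block_bound h m z ;
  controlled_le : forall k c, 0 <= c -> ~ G N k c w -> z k <= c ;
  controlled_grid : forall k i, m (k%:R * h) i ord0 = N (k%:R * h) i w }.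

Let kh0 k : 0 <= k%:R * h.
Proof. by rewrite mulr_ge0// ltW. Qed.

Let khS k : k%:R * h < k.+1%:R * h.
Proof. by rewrite ltr_pM2r// ltr_nat. Qed.

(** The null sets of continuity, of the equation and of the disagreement between
    the adapted version and the stochastic integral at countably many dyadic
    times are discarded.  The driving path is read off from the equation, so that
    it is continuous without any continuity of the stochastic integral. *)
Lemma solution_controlled xi X : sde_solution P F B A sigma xi X ->
  exists2 N, increment_tails P F (rowvar sigma) N &
    {ae P, forall w, exists m z, controlled_path N xi (hat (X^~ w)) m z w}.
Proof.
move=> [_ cX _ [M [WM eqX]]].
have [N tails NM] := adapted_version F_filtration B_brownian sigma_cont WM.
exists N => //.
pose dy k j l := dyad (k%:R * h) (k.+1%:R * h) j l.
have dy0 k j l : 0 <= dy k j l.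
  apply: addr_ge0; [exact: kh0|apply: mulr_ge0].
    by rewrite subr_ge0; exact: ltW.
  by rewrite divr_ge0// exprn_ge0.
have NMd : {ae P, forall w, forall k j l i, N (dy k j l) i w = M (dy k j l) w i ord0}.
  apply: ae_foralln => k; apply: ae_foralln => j; apply: ae_foralln => l.
  apply: filter_forall => i; exact: NM.
apply: filterS3 cX eqX NMd => w cXw eqw NMw.
pose x := hat (X^~ w); have cx : continuous x by exact: hat_continuous.
pose f i s := (hat A s *m x s) i ord0.
have cf i : continuous (f i) by exact: continuous_mulmx_coord.
pose m t := x t - xi - \col_i hat (cint (f i) 0) t.
have cm : continuous m.
  move=> t; apply: cvgB.
    by apply: cvgB; [exact: cx|exact: cvg_cst].
  apply: continuous_mx => i j.
  have -> : (fun s => (\col_i hat (cint (f i) 0) s) i j) = hat (cint (f i) 0).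
    by apply/funext => s; rewrite mxE.
  exact: hat_cint_continuous.
have pe : path_eq (hat A) x xi m.
  move=> t t0; rewrite /m; have -> : (\col_i hat (cint (f i) 0) t) = \col_i cint (f i) 0 t.
    by apply/matrixP => i j; rewrite !mxE hat_id.
  by apply/matrixP => i j; rewrite !mxE; ring.
have mM t : 0 <= t -> m t = M t w.
  move=> t0; rewrite /m {1}/x (hat_id _ t0) eqw//.
  apply/matrixP => i j; rewrite !mxE (hat_id _ t0).
  have -> : cint (f i) 0 t = \int[lebesgue_measure]_(s in `[0, t]) (A s *m X s w) i ord0.
    by apply: eq_cint => s /andP[s0 _]; rewrite /f /x !(hat_id _ s0).
  by ring.
have mN k j l i : m (dy k j l) i ord0 = N (dy k j l) i w by rewrite mM// NMw.
have [z hz] := block_oscillation (ltW h_gt0) cm.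
exists m, z; split => //.
- move=> k; have [+ _] := hz k; move=> /(_ (k%:R * h)).
  by rewrite lexx (ltW (khS k)) subrr normr0; exact.
- by move=> k t; exact: (hz k).1.
- move=> k c c0 nG; apply: (hz k).2 => u.
  by apply: (@block_exceed_path _ _ _ _ N m w) => // j l i _; exact: mN.
- by move=> k i; have := mN k 0%N 0%N i; rewrite /dy dyad0.
Qed.

Lemma hat_near (x : R -> 'cV[R]_n.+1) c : (\forall t \near +oo, `|hat x t| <= c) ->
  \forall t \near +oo, `|x t| <= c.
Proof.
move=> [t0 [t0r hx]]; exists (Num.max 0 t0); split; first exact: num_real.
by move=> t; rewrite gt_max => /andP[tp tt]; rewrite -(hat_id x (ltW tp)); exact: hx.
Qed.

Lemma near_hat (x : R -> 'cV[R]_n.+1) c : (\forall t \near +oo, `|x t| <= c) ->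
  \forall t \near +oo, `|hat x t| <= c.
Proof.
move=> [t0 [t0r hx]]; exists (Num.max 0 t0); split; first exact: num_real.
by move=> t; rewrite gt_max => /andP[tp tt]; rewrite (hat_id x (ltW tp)); exact: hx.
Qed.

Lemma solution_bounded : exists2 K : R, 0 < K &
  forall xi X, sde_solution P F B A sigma xi X ->
  forall eps, 0 < eps -> (S' h sigma eps < +oo)%E ->
    {ae P, forall w, \forall t \near +oo, `|X t w| <= K * eps}.
Proof.
have [K K0 HK] := path_bounded T_gt0 h_gt0 cA per cP P0 dP rho.
exists (K * 10); first by rewrite mulr_gt0.
move=> xi X /solution_controlled[N tails ctl] eps eps0 Sf.
have ev := series_finite_exceed (ltn0Sn n) F_filtration sigma_cont tails h_gt0 variance_cvg0 eps0 Sf.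
apply: filterS2 ctl ev => w [m [z [cx pe z0 bz zG _]]] [k0 hk0].
apply: hat_near; rewrite -mulrA; apply: (HK _ _ _ _ _ cx pe z0 bz).
  by rewrite mulr_gt0.
by exists k0 => // k /hk0; apply: zG; rewrite mulr_ge0// ltW.
Qed.

Lemma solution_lower : exists2 K : R, 0 < K &
  forall xi X, sde_solution P F B A sigma xi X ->
  forall eps, 0 < eps -> S' h sigma eps = +oo%E ->
    {ae P, forall w, forall c, 0 <= c -> (\forall t \near +oo, `|X t w| <= c) -> eps <= K * c}.
Proof.
have [K K0 HK] := path_lower T_gt0 h_gt0 cA per.
exists (24 * n.+1%:R * K); first by rewrite !mulr_gt0.
move=> xi X /solution_controlled[N tails ctl] eps eps0 Soo.
have io := series_infinite_jump (ltn0Sn n) F_filtration sigma_cont tails h_gt0 variance_cvg0 eps0 Soo.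
apply: filterS2 ctl io => w [m [z [cx pe z0 bz _ mN]]] hio c c0 xc.
have [k0 _ hk] := HK _ _ _ _ cx pe c0 (near_hat xc).
have [k [k0k [i _ big]]] := hio k0.
have le : eps / (12 * n.+1%:R) / 2 <= K * c.
  apply: (le_trans (ltW big)); apply: le_trans (hk k k0k).
  rewrite -!mN; apply: (le_trans (ler_norm _)).
  by have := coord_le_norm (m (k.+1%:R * h) - m (k%:R * h)) i ord0; rewrite !mxE.
have -> : eps = 24 * n.+1%:R * (eps / (12 * n.+1%:R) / 2) by field.
by rewrite -[leRHS]mulrA; apply: ler_wpM2l => //; rewrite mulr_ge0.
Qed.

Lemma solution_average xi X : sde_solution P F B A sigma xi X ->
  {ae P, forall w, liminf_norm (X^~ w) = 0%E} /\
  {ae P, forall w, time_average_sq (X^~ w) t @[t --> +oo] --> 0}.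
Proof.
move=> /solution_controlled[N tails ctl].
have av : {ae P, forall w, forall j : nat, forall z : nat -> R, (forall k, 0 <= z k) ->
    (forall k x, 0 <= x -> ~ G N k x w -> z k <= x) ->
    exists C, forall l, \sum_(k < l) z k ^+ 2 <= 2 * j.+1%:R^-1 * l%:R + C}.
  apply: ae_foralln => j.
  exact: (exceed_average (ltn0Sn n) F_filtration sigma_cont tails h_gt0 variance_cvg0).
have small : {ae P, forall w, exists m z, controlled_path N xi (hat (X^~ w)) m z w /\
    small_sum (fun k => z k ^+ 2)}.
  apply: filterS2 ctl av => w [m [z cp]] avw; exists m, z; split => //.
  move=> e e0; pose j := Num.truncn (2 / e).
  have [C hC] := avw j z (controlled_ge0 cp) (controlled_le cp).
  exists C => l; apply: (le_trans (hC l)); rewrite lerD2r; apply: ler_wpM2r => //.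
  have /truncn_itv/andP[_ lt] : 0 <= 2 / e by rewrite divr_ge0// ltW.
  rewrite ler_pdivrMr// mulrC -ler_pdivrMr//; exact: ltW.
split; apply: filterS small => w [m [z [[cx pe z0 bz _ _] sm]]].
  apply: liminf_norm_eq0 => e t0 e0.
  have [t tt xt] := path_liminf T_gt0 h_gt0 cA per cP P0 dP rho cx pe z0 bz sm (Num.max 0 t0) e0.
  by move: tt; rewrite ge_max => /andP[tp tt]; exists t; rewrite // -(hat_id (X^~ w) tp).
apply: (time_average_cvg0 cx); first by move=> t t0; rewrite hat_id.
exact: (path_average T_gt0 h_gt0 cA per cP P0 dP rho cx pe z0 bz sm).
Qed.

Lemma solution_cvg0 : (forall eps, 0 < eps -> (S' h sigma eps < +oo)%E) ->
  forall xi X, sde_solution P F B A sigma xi X ->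
  {ae P, forall w, X t w @[t --> +oo] --> (0 : 'cV[R]_n.+1)}.
Proof.
move=> Sf xi X sX; have [K K0 HK] := solution_bounded.
have ev : {ae P, forall w, forall j : nat, \forall t \near +oo, `|X t w| <= K * j.+1%:R^-1}.
  by apply: ae_foralln => j; apply: (HK xi) => //; apply: Sf.
apply: filterS ev => w hw; apply/cvgrPdist_le => e e0.
pose j := Num.truncn (K / e).
have /truncn_itv/andP[_ lt] : 0 <= K / e by rewrite divr_ge0// ltW.
apply: (@filterS _ (nbhs +oo) _ _ _ _ (hw j)) => t xt; rewrite sub0r normrN.
apply: (le_trans xt); rewrite ler_pdivrMr// mulrC -ler_pdivrMr//; exact: ltW.
Qed.

(** The convergent series at [2 eps'] gives the upper bound, the divergent one at
    [eps' / 2] the lower bound. *)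
Lemma solution_limsup : (exists eps', [/\ 0 < eps',
    forall eps, eps' < eps -> (S' h sigma eps < +oo)%E
  & forall eps, 0 < eps -> eps < eps' -> S' h sigma eps = +oo%E]) ->
  exists c1 c2 : R, [/\ 0 < c1, c1 <= c2
  & forall xi X, sde_solution P F B A sigma xi X ->
      {ae P, forall w,
         (c1%:E <= limsup_norm (X^~ w))%E /\ (limsup_norm (X^~ w) <= c2%:E)%E}].
Proof.
move=> [eps [eps0 Sf Soo]].
have [K K0 HK] := solution_bounded; have [L L0 HL] := solution_lower.
pose c1 := eps / (4 * L); pose c2 := n.+1%:R * (K * (2 * eps)).
have c10 : 0 < c1 by rewrite divr_gt0// mulr_gt0.
exists c1, (Num.max c1 c2); split; [by []|by rewrite le_max lexx|move=> xi X sX].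
have e2 : 0 < eps / 2 < eps by apply/andP; split; lra.
have /andP[e20 e2e] := e2.
have e2' : 0 < 2 * eps by lra.
have e2l : eps < 2 * eps by lra.
apply: filterS2 (HK xi X sX _ e2' (Sf _ e2l)) (HL xi X sX _ e20 (Soo _ e20 e2e)) => w up low.
split.
  rewrite leNgt; apply/negP => /limsup_norm_lt /(low _ (ltW c10)).
  have -> : L * c1 = eps / 4 by rewrite /c1; field; rewrite gt_eqF.
  by apply/negP; rewrite -ltNge; lra.
apply: (le_trans (limsup_norm_le up)).
by rewrite lee_fin le_max lexx orbT.
Qed.

Lemma solution_limsup_oo : (forall eps, 0 < eps -> S' h sigma eps = +oo%E) ->
  forall xi X, sde_solution P F B A sigma xi X ->
  {ae P, forall w, limsup_norm (X^~ w) = +oo%E}.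
Proof.
move=> Soo xi X sX; have [L L0 HL] := solution_lower.
have low : {ae P, forall w, forall j : nat, forall c, 0 <= c ->
    (\forall t \near +oo, `|X t w| <= c) -> j.+1%:R <= L * c}.
  by apply: ae_foralln => j; apply: (HL xi) => //; exact: Soo.
apply: filterS low => w hw; apply/eqyP => c c0.
rewrite leNgt; apply/negP => /limsup_norm_lt xc.
have /truncn_itv/andP[_ lt] : 0 <= L * c by rewrite mulr_ge0// ltW.
have : (Num.truncn (L * c)).+1%:R <= L * c := hw _ _ (ltW c0) xc; by rewrite leNgt lt.
Qed.

End solution.

Theorem theorem13 (R : realType) (dis : measure_display)
    (Omega : measurableType dis) (P : probability Omega R)
    (d r : nat) (d_gt0 : (0 < d)%N) (r_gt0 : (0 < r)%N)
    (F : R -> set (set Omega)) (F_filtration : filtration F)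
    (B : R -> Omega -> 'cV[R]_r) (B_brownian : brownian_motion P F B)
    (sigma : R -> 'M[R]_(d, r))
    (sigma_cont : {within halfline, continuous sigma})
    (A : R -> 'M[R]_d) (A_cont : {within halfline, continuous A})
    (T : R) (T_gt0 : 0 < T)
    (A_periodic : forall t, 0 <= t -> A (t + T) = A t)
    (Psi : R -> 'M[R]_d) (Psi_sol : fundamental_solution A Psi)
    (rho_lt1 : spectral_radius (Psi T) < 1)
    (h : R) (h_gt0 : 0 < h)
    (variance_cvg0 : block_variance h sigma n @[n --> \oo] --> 0) :
  [/\ (* (A) *)
      (forall eps, 0 < eps -> (S' h sigma eps < +oo)%E) ->
      forall xi X, sde_solution P F B A sigma xi X ->
        {ae P, forall w, X t w @[t --> +oo] --> (0 : 'cV[R]_d)},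
      (* (B) *)
      (exists eps', [/\ 0 < eps',
          forall eps, eps' < eps -> (S' h sigma eps < +oo)%E
        & forall eps, 0 < eps -> eps < eps' -> S' h sigma eps = +oo%E]) ->
      (exists c1 c2 : R, [/\ 0 < c1, c1 <= c2
        & forall xi X, sde_solution P F B A sigma xi X ->
            {ae P, forall w,
               (c1%:E <= limsup_norm (X^~ w))%E /\
               (limsup_norm (X^~ w) <= c2%:E)%E}]) /\
      (forall xi X, sde_solution P F B A sigma xi X ->
         {ae P, forall w, liminf_norm (X^~ w) = 0%E} /\
         {ae P, forall w, time_average_sq (X^~ w) t @[t --> +oo] --> 0})
    & (* (C) *)
      (forall eps, 0 < eps -> S' h sigma eps = +oo%E) ->
      (forall xi X, sde_solution P F B A sigma xi X ->
         {ae P, forall w, limsup_norm (X^~ w) = +oo%E}) /\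
      (forall xi X, sde_solution P F B A sigma xi X ->
         {ae P, forall w, liminf_norm (X^~ w) = 0%E} /\
         {ae P, forall w, time_average_sq (X^~ w) t @[t --> +oo] --> 0})].

Proof.
case: d d_gt0 sigma sigma_cont A A_cont A_periodic Psi Psi_sol rho_lt1 variance_cvg0 =>
  // n _ {}sigma sc {}A Ac Ap {}Psi Ps rho vc.
split.
- exact: (solution_cvg0 F_filtration B_brownian sc Ac T_gt0 Ap Ps rho h_gt0 vc).
- move=> Sh; split.
    exact: (solution_limsup F_filtration B_brownian sc Ac T_gt0 Ap Ps rho h_gt0 vc Sh).
  exact: (solution_average F_filtration B_brownian sc Ac T_gt0 Ap Ps rho h_gt0 vc).
- move=> Sh; split.
    exact: (solution_limsup_oo F_filtration B_brownian sc Ac T_gt0 Ap h_gt0 vc Sh).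
  exact: (solution_average F_filtration B_brownian sc Ac T_gt0 Ap Ps rho h_gt0 vc).
Qed.
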